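(* Let $\mathbb{C}$ be a zero-sum-free compact closed category with finite biproducts, with $0_{I,I}\neq 1_I$, satisfying feeble full completeness. Then the category $\mathbf{G}_1\mathbb{C}$ satisfies $\mathrm{MLL}^-{+}\mathrm{Mix}$ full completeness.
   Context: Logic. $\mathrm{MLL}^-$ is unit-free multiplicative linear logic: formulae are built from literals $\alpha_i,\alpha_i^\bot$ with $\otimes$ and par, written $\wp$; sequents are right-sided, commas read as $\wp$. A proof structure over a sequent is its parse forest together with a set of axiom links perfectly matching each positive literal occurrence with a negative occurrence of the same literal. A switching is obtained by deleting, at each $\wp$-vertex, exactly one of its two argument edges. A cut-free proof net for $\mathrm{MLL}^-{+}\mathrm{Mix}$ is a proof structure all of whose switchings are acyclic. Categories. In a $*$-autonomous category $\mathbb{D}$ with unit $I$, put $\bot=I^\bot$, $A\wp B=(A^\bot\otimes B^\bot)^\bot$. A sequent over literals $\alpha_1,\dots,\alpha_N$ gives an $\mathrm{MLL}^-$ functor $F:\mathbb{D}^N\times(\mathbb{D}^{op})^N\to\mathbb{D}$ (first arguments for positive occurrences, duals of the second arguments for negative ones). An $\mathrm{MLL}^-$ (equivalently $\mathrm{MLL}^-{+}\mathrm{Mix}$) transformation is a dinatural transformation from the constant functor at $I$ to such an $F$: a family $\tau_{\mathbf R}:I\to F(\mathbf R,\mathbf R)$ with $F(\mathbf f,1_{\mathbf R})\circ\tau_{\mathbf R}=F(1_{\mathbf S},\mathbf f)\circ\tau_{\mathbf S}$ for all $\mathbf f:\mathbf R\to\mathbf S$. $\mathbb{D}$ models Mix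 when there is a Mix natural transformation $A\otimes B\to A\wp B$ (equivalently a Mix morphism $\bot\to I$); proof nets of $\mathrm{MLL}^-{+}\mathrm{Mix}$ are then interpreted as such transformations in the standard way. $\mathbb{D}$ satisfies $\mathrm{MLL}^-{+}\mathrm{Mix}$ full completeness if every such transformation is the interpretation of a cut-free proof net of $\mathrm{MLL}^-{+}\mathrm{Mix}$. Compact closed case. In a compact closed category $\mathbb{C}$ with finite biproducts (dual $(-)^*$) there is a canonical natural isomorphism $\mathrm{Mix}:A\otimes B\cong A\wp B$, and every proof structure has an interpretation: one copy of the unit $\eta_X:I\to X\otimes X^*$ per axiom link, tensored together, followed by associativity/symmetry isomorphisms and $\mathrm{Mix}$. The scalars $\mathbb{C}[I,I]$ form a commutative semiring and homsets are semimodules over it; linear combinations of transformations are componentwise. $\mathbb{C}$ satisfies feeble full completeness if every $\mathrm{MLL}^-$ transformation in $\mathbb{C}$ is a linear combination of interpretations of proof structures over the same sequent. $\mathbb{C}$ is zero-sum-free if in the semiring $\mathbb{C}[I,I]$ the element $0$ is the only one with an additive inverse. Double glueing. $\mathbf{G}\mathbb{C}$ has objects $(A,U,X)$ with $A\in\mathbb{C}$, $U\subseteq\mathbb{C}[I,A]$, $X\subseteq\mathbb{C}[A,\bot]$; an arrow $(A,U,X)\to(B,V,Y)$ is an $f\in\mathbb{C}[A,B]$ with $f\circ U\subseteq V$, $Y\circ f\subseteq X$. Structure on arrows is inherited from $\mathbb{C}$; on objects $(A,U,X)^\bot=(A^\bot,\{x^\bot\circ\chi_I\},\{u^\bot\})$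 ($\chi_I:I\to\bot^\bot$ canonical) and $(A,U,X)\otimes(B,V,Y)=(A\otimes B,\{(u\otimes v)\circ\lambda_I^{-1}\},Z)$, where $\lambda_I:I\otimes I\to I$ and $Z$ is the set of $z:A\otimes B\to\bot$ with $z\circ(1_A\otimes v)\circ\rho_A^{-1}\in X$ for all $v\in V$ and $z\circ(u\otimes1_B)\circ\lambda_B^{-1}\in Y$ for all $u\in U$. Let $\iota:I\to\bot$ be the canonical isomorphism $I\cong I^*$ of $\mathbb{C}$. $\mathbf{G}_1\mathbb{C}$ is the full subcategory of $\mathbf{G}\mathbb{C}$ on the objects $(A,U,X)$ with $x\circ u=\iota$ for all $u\in U,x\in X$; it is $*$-autonomous with $\otimes$ and $(-)^\bot$ the restrictions of the operations $\otimes$ and $(-)^\bot$ of $\mathbf{G}\mathbb{C}$ and unit $(I,\{1_I\},\{\iota\})$, and it models Mix. *)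

(* Defs.v *)
From mathcomp Require Import all_boot.
From Stdlib Require Import ProofIrrelevance.

Set Implicit Arguments.
Unset Strict Implicit.
Unset Printing Implicit Defensive.

Declare Scope cat_scope.
Delimit Scope cat_scope with cat.
Local Open Scope cat_scope.

Record category := Category {
  obj :> Type;
  hom : obj -> obj -> Type;
  idm : forall A, hom A A;
  comp : forall A B C, hom B C -> hom A B -> hom A C;
  compA : forall A B C D (h : hom C D) (g : hom B C) (f : hom A B),
    comp h (comp g f) = comp (comp h g) f;
  comp1m : forall A B (f : hom A B), comp (idm B) f = f;
  compm1 : forall A B (f : hom A B), comp f (idm A) = f }.

Arguments hom {_} _ _.
Arguments idm {_} _.
Arguments comp {_ _ _ _} _ _.
Notation "g ∘ f" := (comp g f) (at level 40, left associativity) : cat_scope.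

Record smcat := SMCat {
  smcat_cat :> category;
  tens : smcat_cat -> smcat_cat -> smcat_cat;
  tensm : forall A B C D : smcat_cat,
    hom A B -> hom C D -> hom (tens A C) (tens B D);
  unit : smcat_cat;
  tensm1 : forall A B, tensm (idm A) (idm B) = idm (tens A B);
  tensmM : forall A B C A' B' C' (g : hom B C) (f : hom A B)
      (g' : hom B' C') (f' : hom A' B'),
    tensm (g ∘ f) (g' ∘ f') = tensm g g' ∘ tensm f f';
  assoc : forall A B C, hom (tens (tens A B) C) (tens A (tens B C));
  associ : forall A B C, hom (tens A (tens B C)) (tens (tens A B) C);
  lun : forall A, hom (tens unit A) A;
  luni : forall A, hom A (tens unit A);
  run : forall A, hom (tens A unit) A;
  runi : forall A, hom A (tens A unit);
  sym : forall A B, hom (tens A B) (tens B A);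
  assocK : forall A B C, associ A B C ∘ assoc A B C = idm _;
  associK : forall A B C, assoc A B C ∘ associ A B C = idm _;
  lunK : forall A, luni A ∘ lun A = idm _;
  luniK : forall A, lun A ∘ luni A = idm _;
  runK : forall A, runi A ∘ run A = idm _;
  runiK : forall A, run A ∘ runi A = idm _;
  symK : forall A B, sym B A ∘ sym A B = idm _;
  assoc_nat : forall A B C A' B' C' (f : hom A A') (g : hom B B') (h : hom C C'),
    assoc A' B' C' ∘ tensm (tensm f g) h = tensm f (tensm g h) ∘ assoc A B C;
  lun_nat : forall A B (f : hom A B), lun B ∘ tensm (idm unit) f = f ∘ lun A;
  run_nat : forall A B (f : hom A B), run B ∘ tensm f (idm unit) = f ∘ run A;
  sym_nat : forall A B A' B' (f : hom A A') (g : hom B B'),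
    sym A' B' ∘ tensm f g = tensm g f ∘ sym A B;
  pentagon : forall A B C D,
    assoc A B (tens C D) ∘ assoc (tens A B) C D =
    tensm (idm A) (assoc B C D) ∘ assoc A (tens B C) D
      ∘ tensm (assoc A B C) (idm D);
  triangle : forall A B,
    tensm (idm A) (lun B) ∘ assoc A unit B = tensm (run A) (idm B);
  hexagon : forall A B C,
    assoc B C A ∘ sym A (tens B C) ∘ assoc A B C =
    tensm (idm B) (sym A C) ∘ assoc B A C ∘ tensm (sym A B) (idm C) }.

Arguments tens {_} _ _.
Arguments tensm {_ _ _ _ _} _ _.
Arguments unit {_}.
Arguments assoc {_} _ _ _.
Arguments associ {_} _ _ _.
Arguments lun {_} _.
Arguments luni {_} _.
Arguments run {_} _.
Arguments runi {_} _.
Arguments sym {_} _ _.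
Notation "A ⊗ B" := (tens A B) (at level 38, right associativity) : cat_scope.
Notation "f ⊠ g" := (tensm f g) (at level 38, right associativity) : cat_scope.
Notation "1" := (idm _) : cat_scope.

Section SMTheory.
Variable C : smcat.
Implicit Types A B : C.

Lemma epi_l A B X (f : hom A B) (g : hom B A) (u v : hom B X) :
  f ∘ g = 1 -> u ∘ f = v ∘ f -> u = v.
Proof. by move=> fg e; rewrite -(compm1 u) -(compm1 v) -fg !compA e. Qed.

Lemma mono_l A B X (f : hom A B) (g : hom B A) (u v : hom X A) :
  g ∘ f = 1 -> f ∘ u = f ∘ v -> u = v.
Proof. by move=> gf e; rewrite -(comp1m u) -(comp1m v) -gf -!compA e. Qed.

Lemma luni_nat A B (f : hom A B) : (1 ⊠ f) ∘ luni A = luni B ∘ f.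
Proof.
apply: (mono_l (lunK B)).
by rewrite !compA lun_nat luniK comp1m -compA luniK compm1.
Qed.

Lemma runi_nat A B (f : hom A B) : (f ⊠ 1) ∘ runi A = runi B ∘ f.
Proof.
apply: (mono_l (runK B)).
by rewrite !compA run_nat runiK comp1m -compA runiK compm1.
Qed.

Lemma associ_nat A B (D : C) A' B' D' (f : hom A A') (g : hom B B')
    (h : hom D D') :
  associ A' B' D' ∘ (f ⊠ (g ⊠ h)) = ((f ⊠ g) ⊠ h) ∘ associ A B D.
Proof.
apply: (mono_l (assocK A' B' D')).
by rewrite !compA associK comp1m assoc_nat -compA associK compm1.
Qed.

Lemma tensm_l A B X Y (f : hom A B) (g : hom X Y) :
  f ⊠ g = (f ⊠ 1) ∘ (1 ⊠ g).
Proof. by rewrite -tensmM compm1 comp1m. Qed.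

Lemma tensm_r A B X Y (f : hom A B) (g : hom X Y) :
  f ⊠ g = (1 ⊠ g) ∘ (f ⊠ 1).
Proof. by rewrite -tensmM compm1 comp1m. Qed.

Lemma tens1M A X Y Z (g : hom Y Z) (f : hom X Y) :
  idm A ⊠ (g ∘ f) = (1 ⊠ g) ∘ (1 ⊠ f).
Proof. by rewrite -tensmM comp1m. Qed.

Lemma tensM1 A X Y Z (g : hom Y Z) (f : hom X Y) :
  (g ∘ f) ⊠ idm A = (g ⊠ 1) ∘ (f ⊠ 1).
Proof. by rewrite -tensmM comp1m. Qed.

Lemma tens1_inj A B (f g : hom A B) :
  idm (@unit C) ⊠ f = 1 ⊠ g -> f = g.
Proof.
move=> e; apply: (epi_l (luniK A)).
by rewrite -!lun_nat e.
Qed.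

Lemma tensI_inj A B (f g : hom A B) :
  f ⊠ idm (@unit C) = g ⊠ 1 -> f = g.
Proof.
move=> e; apply: (epi_l (runiK A)).
by rewrite -!run_nat e.
Qed.

Lemma lun_assoc A B : lun (A ⊗ B) ∘ assoc unit A B = lun A ⊠ 1.
Proof.
apply: tens1_inj.
have aK : (assoc unit (unit ⊗ A) B ∘ (assoc unit unit A ⊠ 1))
   ∘ ((associ unit unit A ⊠ 1) ∘ associ unit (unit ⊗ A) B) = 1.
  rewrite compA -(compA (assoc _ _ _)) -tensM1 associK tensm1 compm1.
  exact: associK.
apply: (epi_l aK).
rewrite tens1M !compA -[LHS]compA.
have -> : (idm unit ⊠ lun (A ⊗ B)) ∘ (idm unit ⊠ assoc unit A B)
   ∘ (assoc unit (unit ⊗ A) B ∘ (assoc unit unit A ⊠ 1)) =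
   (idm unit ⊠ lun (A ⊗ B)) ∘ (assoc unit unit (A ⊗ B)
      ∘ assoc (unit ⊗ unit) A B).
  by rewrite pentagon !compA.
rewrite compA triangle -tensm1 -assoc_nat -triangle tensM1 compA assoc_nat.
by [].
Qed.

Lemma run_assoc A B : (1 ⊠ run B) ∘ assoc A B unit = run (A ⊗ B).
Proof.
apply: tensI_inj.
apply: (mono_l (assocK A B unit)).
rewrite -(triangle (A ⊗ B)) tensM1 !compA assoc_nat -triangle tens1M.
rewrite -tensm1 assoc_nat -!compA; congr (_ ∘ _).
by rewrite pentagon !compA.
Qed.

Lemma lun_run : lun (@unit C) = run unit.
Proof.
apply: tensI_inj; rewrite -lun_assoc -triangle; congr (_ ∘ _).
by apply: (mono_l (lunK unit)); rewrite lun_nat.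
Qed.

Lemma luni_runi : luni (@unit C) = runi unit.
Proof.
by apply: (mono_l (lunK unit)); rewrite luniK lun_run runiK.
Qed.

Lemma lun_sym A : lun A ∘ sym A unit = run A.
Proof.
apply: tensI_inj; apply: (mono_l (symK A unit)).
have e := congr1 (fun h => lun (unit ⊗ A) ∘ h) (hexagon A unit (@unit C)).
rewrite /= !compA lun_nat lun_assoc -(compA (sym _ _)) lun_assoc in e.
by rewrite tensM1 compA -e -sym_nat -compA triangle.
Qed.

Lemma assoc_runi A B : assoc A unit B ∘ (runi A ⊠ 1) = 1 ⊠ luni B.
Proof.
have e : (1 ⊠ luni B) ∘ (idm A ⊠ lun B) = 1.
  by rewrite -tens1M lunK tensm1.
by apply: (mono_l e); rewrite compA triangle -tensM1 -tens1M runiK luniK !tensm1.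
Qed.

Lemma associ_luni A B : associ A unit B ∘ (1 ⊠ luni B) = runi A ⊠ 1.
Proof. by rewrite -assoc_runi compA assocK comp1m. Qed.

Lemma associ_runi A B : associ A B unit ∘ (1 ⊠ runi B) = runi (A ⊗ B).
Proof.
apply: (mono_l (runK (A ⊗ B))).
rewrite runiK -run_assoc compA -(compA _ (assoc _ _ _)) associK compm1.
by rewrite -tens1M runiK tensm1.
Qed.

Lemma assoc_runi_r A B : assoc A B unit ∘ runi (A ⊗ B) = 1 ⊠ runi B.
Proof. by rewrite -associ_runi compA associK comp1m. Qed.

Lemma assoc_luni A B : assoc unit A B ∘ (luni A ⊠ 1) = luni (A ⊗ B).
Proof.
apply: (mono_l (lunK (A ⊗ B))).
by rewrite luniK compA lun_assoc -tensM1 luniK tensm1.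
Qed.

Lemma pentagon_l A B X Y :
  assoc (A ⊗ B) X Y ∘ (associ A B X ⊠ 1) =
  associ A B (X ⊗ Y) ∘ (1 ⊠ assoc B X Y) ∘ assoc A (B ⊗ X) Y.
Proof.
apply: (mono_l (assocK A B (X ⊗ Y))).
rewrite !compA associK comp1m pentagon -compA -tensM1 associK tensm1.
by rewrite compm1.
Qed.

Lemma pentagon_r A B X Y :
  associ A B (X ⊗ Y) ∘ (1 ⊠ assoc B X Y) =
  assoc (A ⊗ B) X Y ∘ (associ A B X ⊠ 1) ∘ associ A (B ⊗ X) Y.
Proof. by rewrite pentagon_l -compA associK compm1. Qed.

Lemma run_sym A : run A ∘ sym unit A = lun A.
Proof. by rewrite -lun_sym -compA symK compm1. Qed.

Lemma sym_luni A : sym unit A ∘ luni A = runi A.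
Proof. by apply: (mono_l (runK A)); rewrite runiK compA run_sym luniK. Qed.

Lemma sym_runi A : sym A unit ∘ runi A = luni A.
Proof. by apply: (mono_l (lunK A)); rewrite luniK compA lun_sym runiK. Qed.

End SMTheory.

(* [unit^⊥] is a dualising object: [ev A] exhibits [A^⊥] as the internal hom
   [A -o unit^⊥], and the canonical [A -> A^⊥^⊥], see [chi] below, is
   invertible.  The internal homs are [A -o B = (A ⊗ B^⊥)^⊥].  The law
   [ev_unit] says that [unit^⊥] is [unit -o unit^⊥] in the canonical way; it
   normalises the structure, which is otherwise only determined up to an
   automorphism of [unit^⊥]. *)
Record starcat := StarCat {
  star_sm :> smcat;
  dual : star_sm -> star_sm;
  ev : forall A, hom (dual A ⊗ A) (dual unit);
  name : forall X A : star_sm, hom (X ⊗ A) (dual unit) -> hom X (dual A);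
  nameK : forall X A (f : hom (X ⊗ A) (dual unit)),
    ev A ∘ (name f ⊠ 1) = f;
  evK : forall X A (g : hom X (dual A)), name (ev A ∘ (g ⊠ 1)) = g;
  ev_unit : ev unit = run (dual unit);
  chii : forall A, hom (dual (dual A)) A;
  chiK : forall A, chii A ∘ name (ev A ∘ sym A (dual A)) = 1;
  chiiK : forall A, name (ev A ∘ sym A (dual A)) ∘ chii A = 1 }.

Arguments dual {_} _.
Arguments ev {_} _.
Arguments name {_ _ _} _.
Arguments chii {_} _.
Notation "A ^⊥" := (dual A) (at level 2, left associativity, format "A ^⊥") : cat_scope.

Definition bot {D : starcat} : D := unit^⊥.

Definition chi {D : starcat} (A : D) : hom A (A^⊥^⊥) :=
  name (ev A ∘ sym A (A^⊥)).

Definition dualm {D : starcat} (A B : D) (f : hom A B) : hom (B^⊥) (A^⊥) :=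
  name (ev B ∘ (1 ⊠ f)).

(* The inverse of [dualm], which is full and faithful. *)
Definition undualm {D : starcat} (A B : D) (h : hom (B^⊥) (A^⊥)) : hom A B :=
  chii B ∘ dualm h ∘ chi A.

Definition par {D : starcat} (A B : D) : D := (A^⊥ ⊗ B^⊥)^⊥.
Definition parm {D : starcat} (A A' B B' : D) (f : hom A A') (g : hom B B') :
  hom (par A B) (par A' B') := dualm (dualm f ⊠ dualm g).
Notation "A ⅋ B" := (par A B) (at level 38, right associativity) : cat_scope.

Section StarTheory.
Variable D : starcat.
Implicit Types A B X : D.

Lemma ev_inj X A (f g : hom X (A^⊥)) :
  ev A ∘ (f ⊠ 1) = ev A ∘ (g ⊠ 1) -> f = g.
Proof. by move=> e; rewrite -(evK f) e evK. Qed.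

Lemma ev_chi A : ev (A^⊥) ∘ (chi A ⊠ 1) = ev A ∘ sym A (A^⊥).
Proof. exact: nameK. Qed.

Lemma ev_dualm A B (f : hom A B) : ev A ∘ (dualm f ⊠ 1) = ev B ∘ (1 ⊠ f).
Proof. exact: nameK. Qed.

Lemma name_comp X Y A (f : hom (X ⊗ A) bot) (g : hom Y X) :
  name f ∘ g = name (f ∘ (g ⊠ 1)).
Proof. by apply: ev_inj; rewrite tensM1 compA !nameK. Qed.

Lemma dualmM A B X (g : hom B X) (f : hom A B) :
  dualm (g ∘ f) = dualm f ∘ dualm g.
Proof.
apply: ev_inj; rewrite tensM1 compA !ev_dualm tens1M compA -ev_dualm.
by rewrite -!compA -tensm_l -tensm_r.
Qed.

Lemma dualm1 A : dualm (idm A) = 1.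
Proof. by apply: ev_inj; rewrite ev_dualm !tensm1. Qed.

Lemma chi_nat A B (f : hom A B) : dualm (dualm f) ∘ chi A = chi B ∘ f.
Proof.
apply: ev_inj; rewrite !tensM1 !compA ev_dualm ev_chi -compA -tensm_r tensm_l.
rewrite compA ev_chi -!compA !sym_nat !compA ev_dualm.
by [].
Qed.

Lemma chi_chii A : chi A ∘ chii A = 1. Proof. exact: chiiK. Qed.
Lemma chii_chi A : chii A ∘ chi A = 1. Proof. exact: chiK. Qed.

Lemma dualm_chi A : dualm (chi A) ∘ chi (A^⊥) = 1.
Proof.
apply: ev_inj; rewrite tensM1 compA ev_dualm -compA -tensm_r tensm_l.
by rewrite compA ev_chi -compA sym_nat compA ev_chi -compA symK tensm1.
Qed.

Lemma chii_dual A : chii (A^⊥) = dualm (chi A).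
Proof.
by apply: (epi_l (chi_chii (A^⊥))); rewrite chii_chi dualm_chi.
Qed.

Lemma chii_nat A B (f : hom A B) : f ∘ chii A = chii B ∘ dualm (dualm f).
Proof.
apply: (epi_l (chi_chii A)).
by rewrite -!compA chii_chi chi_nat compm1 compA chii_chi comp1m.
Qed.

(* A copoint and its transpose: [dualm x ∘ chi unit] is the name of [x]. *)
Lemma ev_copoint A (x : hom A bot) :
  ev A ∘ ((dualm x ∘ chi unit) ⊠ 1) = x ∘ lun A.
Proof.
rewrite tensM1 compA ev_dualm -compA -tensm_r tensm_l compA ev_chi.
by rewrite -compA sym_nat compA ev_unit run_nat -compA run_sym.
Qed.

Lemma copointE A (x : hom A bot) : dualm x ∘ chi unit = name (x ∘ lun A).
Proof. by apply: ev_inj; rewrite ev_copoint nameK. Qed.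

(* The transpose of a point is evaluation at it. *)
Lemma dualm_point A (u : hom unit A) :
  dualm u = ev A ∘ (1 ⊠ u) ∘ runi (A^⊥).
Proof.
apply: (epi_l (runiK (A^⊥))).
by rewrite -run_nat -ev_unit ev_dualm -compA runK compm1.
Qed.

Lemma copoint_unit (i : hom (@unit D) bot) : dualm i ∘ chi unit = i.
Proof.
by apply: ev_inj; rewrite ev_copoint ev_unit run_nat lun_run.
Qed.

End StarTheory.

(* [mixm_coh] is the usual coherence condition making the two induced arrows
   [A ⊗ B -> A ⅋ B] equal. *)
Record mixcat := MixCat {
  mix_star :> starcat;
  mixm : hom (@bot mix_star) unit;
  mixm_coh : lun (@bot mix_star) ∘ (mixm ⊠ 1) = run bot ∘ (1 ⊠ mixm) }.

Arguments mixm {_}.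

Record compact := Compact {
  cc_sm :> smcat;
  cdual : cc_sm -> cc_sm;
  eta : forall A, hom unit (A ⊗ cdual A);
  eps : forall A, hom (cdual A ⊗ A) unit;
  zigzag : forall A,
    run A ∘ (1 ⊠ eps A) ∘ assoc A (cdual A) A ∘ (eta A ⊠ 1) ∘ luni A = 1;
  zagzig : forall A,
    lun (cdual A) ∘ (eps A ⊠ 1) ∘ associ (cdual A) A (cdual A)
      ∘ (1 ⊠ eta A) ∘ runi (cdual A) = 1 }.

Arguments cdual {_} _.
Arguments eta {_} _.
Arguments eps {_} _.

Section CompactStar.
Variable C : compact.
Implicit Types A B X : C.

Definition ctr X A (f : hom (X ⊗ A) unit) : hom X (cdual A) :=
  lun _ ∘ (f ⊠ 1) ∘ associ X A (cdual A) ∘ (1 ⊠ eta A) ∘ runi X.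
Definition ctrl X A (f : hom (cdual A ⊗ X) unit) : hom X A :=
  run _ ∘ (1 ⊠ f) ∘ assoc A (cdual A) X ∘ (eta A ⊠ 1) ∘ luni X.

Lemma ctrK X A (f : hom (X ⊗ A) unit) : eps A ∘ (ctr f ⊠ 1) = f.
Proof.
have zz : (1 ⊠ eps A) ∘ assoc A (cdual A) A ∘ (eta A ⊠ 1) ∘ luni A = runi A.
  by apply: (mono_l (runK A)); rewrite runiK !compA zigzag.
rewrite /ctr !tensM1 !compA -lun_assoc compA -lun_nat.
rewrite -(compA _ (assoc _ _ _)) assoc_nat tensm1 !compA.
rewrite -(compA _ (1 ⊠ eps A)) -tensm_r tensm_l !compA.
rewrite -(compA _ (assoc _ _ _)) pentagon_l !compA.
rewrite -(compA _ (assoc _ _ _)) assoc_nat !compA.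
rewrite -(compA _ (assoc _ _ _)) assoc_runi -tensm1.
rewrite -(compA _ ((1 ⊠ 1) ⊠ eps A)) -associ_nat !compA.
rewrite -(compA _ _ (1 ⊠ luni A)) -!tens1M -!(compA _ (1 ⊠ _)) -!tens1M !compA zz.
by rewrite -(compA _ (associ _ _ _)) associ_runi -compA runi_nat compA lun_run runiK comp1m.
Qed.

Lemma epsK X A (g : hom X (cdual A)) : ctr (eps A ∘ (g ⊠ 1)) = g.
Proof.
rewrite /ctr tensM1 -!compA (compA ((g ⊠ 1) ⊠ 1)) -associ_nat tensm1 -!compA.
rewrite (compA (g ⊠ 1)) -tensm_l (tensm_r g) -compA runi_nat !compA.
by rewrite zagzig comp1m.
Qed.

Lemma ctrlK X A (f : hom (cdual A ⊗ X) unit) : eps A ∘ (1 ⊠ ctrl f) = f.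
Proof.
have zz : (eps A ⊠ 1) ∘ associ (cdual A) A (cdual A) ∘ (1 ⊠ eta A)
    ∘ runi (cdual A) = luni (cdual A).
  by apply: (mono_l (lunK (cdual A))); rewrite luniK !compA zagzig.
have e : eps A ∘ (1 ⊠ run A) =
    run unit ∘ (eps A ⊠ 1) ∘ associ (cdual A) A unit.
  by rewrite run_nat -compA -run_assoc -compA associK compm1.
rewrite /ctrl !tens1M !compA e.
rewrite -(compA _ (associ _ _ _)) associ_nat tensm1 !compA.
rewrite -(compA _ (eps A ⊠ 1)) -tensm_l tensm_r !compA.
rewrite -(compA _ (associ _ _ _)) pentagon_r !compA.
rewrite -(compA _ (associ _ _ _)) associ_nat !compA.
rewrite -(compA _ (associ _ _ _)) associ_luni -tensm1.
rewrite -(compA _ ((eps A) ⊠ (1 ⊠ 1))) -assoc_nat !compA.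
rewrite -(compA _ _ (runi _ ⊠ 1)) -!tensM1 -!(compA _ (_ ⊠ 1)) -!tensM1 !compA zz.
by rewrite -(compA _ (assoc _ _ _)) assoc_luni -compA luni_nat compA -lun_run luniK comp1m.
Qed.

Lemma epslK X A (g : hom X A) : ctrl (eps A ∘ (1 ⊠ g)) = g.
Proof.
rewrite /ctrl tens1M -!compA (compA (1 ⊠ (1 ⊠ g))) -assoc_nat tensm1 -!compA.
rewrite (compA (1 ⊠ g)) -tensm_r (tensm_l _ g) -compA luni_nat !compA.
by rewrite zigzag comp1m.
Qed.

Definition iota : hom unit (cdual (@unit C)) := lun _ ∘ eta unit.
Definition iotai : hom (cdual (@unit C)) unit := eps unit ∘ runi _.

Lemma iotaK : iotai ∘ iota = 1.
Proof.
have := zigzag (@unit C); rewrite -lun_run lun_nat.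
rewrite -(compA _ _ (assoc _ _ _)) lun_assoc -(compA _ _ (eta _ ⊠ 1)) -tensM1.
by rewrite luni_runi -compA runi_nat compA.
Qed.

Lemma iotaiK : iota ∘ iotai = 1.
Proof.
have e : eta unit = luni (cdual (@unit C)) ∘ iota.
  by rewrite /iota compA lunK comp1m.
have := zagzig (@unit C); rewrite e tens1M.
rewrite !compA -(compA _ _ (1 ⊠ luni _)) associ_luni.
rewrite -(compA _ _ (runi _ ⊠ 1)) -tensM1 -/iotai -(compA _ _ (1 ⊠ iota)).
rewrite -tensm_l tensm_r compA lun_nat -!compA runi_nat.
by rewrite (compA (lun unit)) lun_run runiK comp1m /iotai !compA.
Qed.

Definition cev A : hom (cdual A ⊗ A) (cdual unit) := iota ∘ eps A.
Definition cname X A (f : hom (X ⊗ A) (cdual unit)) : hom X (cdual A) :=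
  ctr (iotai ∘ f).
Definition cchii A : hom (cdual (cdual A)) A :=
  ctrl (eps (cdual A) ∘ sym (cdual A) (cdual (cdual A))).

Lemma cnameK X A (f : hom (X ⊗ A) (cdual unit)) :
  cev A ∘ (cname f ⊠ 1) = f.
Proof. by rewrite -compA ctrK compA iotaiK comp1m. Qed.

Lemma cevK X A (g : hom X (cdual A)) : cname (cev A ∘ (g ⊠ 1)) = g.
Proof.
by rewrite /cname /cev -(compA iota) (compA iotai) iotaK comp1m epsK.
Qed.

Lemma cev_unit : cev unit = run (cdual unit).
Proof.
have e : eps unit = iotai ∘ run (cdual (@unit C)) by rewrite -compA runK compm1.
by rewrite /cev e (compA iota) iotaiK comp1m.
Qed.

Lemma cchiE A :
  cname (cev A ∘ sym A (cdual A)) = ctr (eps A ∘ sym A (cdual A)).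
Proof.
by rewrite /cname /cev -(compA iota) (compA iotai) iotaK comp1m.
Qed.

Lemma cchiK A : cchii A ∘ cname (cev A ∘ sym A (cdual A)) = 1.
Proof.
rewrite cchiE -[LHS]epslK -[RHS]epslK tens1M compA ctrlK.
by rewrite -compA sym_nat compA ctrK -compA symK tensm1.
Qed.

Lemma cchiiK A : cname (cev A ∘ sym A (cdual A)) ∘ cchii A = 1.
Proof.
rewrite cchiE -[LHS]epsK -[RHS]epsK tensM1 compA ctrK.
by rewrite -compA sym_nat compA ctrlK -compA symK tensm1.
Qed.

Definition compact_star : starcat :=
  StarCat cnameK cevK cev_unit cchiK cchiiK.

End CompactStar.

Definition full_sub (C : category) (P : C -> Prop) : category :=
  @Category {A : C | P A} (fun A B => hom (sval A) (sval B))
    (fun A => idm (sval A)) (fun A B D g f => g ∘ f)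
    (fun A B D E h g f => compA h g f)
    (fun A B f => comp1m f) (fun A B f => compm1 f).

Section Plug.
Variable C : smcat.
Implicit Types A B X Y : C.

Definition plugr A B Y (z : hom (A ⊗ B) Y) (v : hom unit B) : hom A Y :=
  z ∘ (1 ⊠ v) ∘ runi A.
Definition plugl A B Y (z : hom (A ⊗ B) Y) (u : hom unit A) : hom B Y :=
  z ∘ (u ⊠ 1) ∘ luni B.

Lemma plugr_tensm A B A' B' Y (z : hom (A' ⊗ B') Y) (f : hom A A')
    (g : hom B B') v : plugr (z ∘ (f ⊠ g)) v = plugr z (g ∘ v) ∘ f.
Proof.
rewrite /plugr -!compA; congr (_ ∘ _).
by rewrite -runi_nat !compA -!tensmM comp1m !compm1.
Qed.

Lemma plugl_tensm A B A' B' Y (z : hom (A' ⊗ B') Y) (f : hom A A')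
    (g : hom B B') u : plugl (z ∘ (f ⊠ g)) u = plugl z (f ∘ u) ∘ g.
Proof.
rewrite /plugl -!compA; congr (_ ∘ _).
by rewrite -luni_nat !compA -!tensmM comp1m !compm1.
Qed.

Lemma plugrM A B Y Y' (z : hom (A ⊗ B) Y) (h : hom Y Y') v :
  plugr (h ∘ z) v = h ∘ plugr z v.
Proof. by rewrite /plugr !compA. Qed.

Lemma pluglM A B Y Y' (z : hom (A ⊗ B) Y) (h : hom Y Y') u :
  plugl (h ∘ z) u = h ∘ plugl z u.
Proof. by rewrite /plugl !compA. Qed.

Lemma plug_pt A B Y (z : hom (A ⊗ B) Y) u v :
  z ∘ ((u ⊠ v) ∘ luni unit) = plugr z v ∘ u.
Proof. by rewrite /plugr -!compA -runi_nat luni_runi (compA _ (u ⊠ 1)) -tensm_r. Qed.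

Lemma plug_ptl A B Y (z : hom (A ⊗ B) Y) u v :
  z ∘ ((u ⊠ v) ∘ luni unit) = plugl z u ∘ v.
Proof. by rewrite /plugl -!compA -luni_nat (compA _ (1 ⊠ v)) -tensm_l. Qed.

Lemma plugr_sym A B Y (z : hom (B ⊗ A) Y) v : plugr (z ∘ sym A B) v = plugl z v.
Proof.
rewrite /plugr /plugl -!compA; congr (_ ∘ _).
by rewrite compA sym_nat -compA sym_runi.
Qed.

Lemma plugl_sym A B Y (z : hom (B ⊗ A) Y) u : plugl (z ∘ sym A B) u = plugr z u.
Proof.
by rewrite -(plugr_sym (z ∘ sym A B)) -compA symK compm1.
Qed.

Lemma plugr_assoc A B D Y (z : hom (A ⊗ (B ⊗ D)) Y) v w :
  plugr (plugr (z ∘ assoc A B D) w) v = plugr z ((v ⊠ w) ∘ luni unit).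
Proof.
rewrite /plugr -!compA; congr (_ ∘ _).
rewrite (compA (runi _)) -runi_nat -!compA (compA (1 ⊠ w)) -tensmM comp1m compm1.
rewrite (compA (assoc _ _ _)) assoc_nat -!compA.
by rewrite (compA (assoc _ _ _)) assoc_runi_r compA -tens1M luni_runi.
Qed.

Lemma plugl_assoc A B D Y (z : hom (A ⊗ (B ⊗ D)) Y) u v :
  plugl (z ∘ assoc A B D) ((u ⊠ v) ∘ luni unit) = plugl (plugl z u) v.
Proof.
rewrite /plugl -!compA; congr (_ ∘ _).
rewrite tensM1 -!compA (compA (assoc _ _ _)) assoc_nat -!compA.
rewrite (compA (assoc _ _ _)) assoc_luni [in RHS](compA (luni _)) -(luni_nat (v ⊠ 1)) !compA.
by rewrite -tensmM compm1 comp1m.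
Qed.

Lemma plug_assoc A B D Y (z : hom (A ⊗ (B ⊗ D)) Y) u w :
  plugl (plugr (z ∘ assoc A B D) w) u = plugr (plugl z u) w.
Proof.
rewrite /plugl /plugr -!compA; congr (_ ∘ _).
rewrite (compA (runi _)) -runi_nat -!compA (compA (1 ⊠ w)) -tensmM comp1m compm1.
rewrite (compA (assoc _ _ _)) assoc_nat -!compA (compA (assoc _ _ _)).
rewrite assoc_runi_r luni_nat.
by rewrite [in RHS](compA (luni _)) -(luni_nat (1 ⊠ w)) !compA -!tensmM !compm1 !comp1m.
Qed.

Lemma assoc_pt A B D (u : hom unit A) (v : hom unit B) (w : hom unit D) :
  assoc A B D ∘ ((((u ⊠ v) ∘ luni unit) ⊠ w) ∘ luni unit) =
  (u ⊠ ((v ⊠ w) ∘ luni unit)) ∘ luni unit.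
Proof.
by rewrite plug_ptl -(comp1m (assoc A B D)) plugl_assoc -!plug_ptl comp1m.
Qed.

Lemma associ_pt A B D (u : hom unit A) (v : hom unit B) (w : hom unit D) :
  associ A B D ∘ ((u ⊠ ((v ⊠ w) ∘ luni unit)) ∘ luni unit) =
  (((u ⊠ v) ∘ luni unit) ⊠ w) ∘ luni unit.
Proof.
by rewrite -(assoc_pt u v w) (compA (associ _ _ _)) assocK comp1m.
Qed.

End Plug.

Section Glue.
Variable C : starcat.

(* Objects [(A, U, X)]: [gpt] is [U] and [gcopt] is [X]. *)
Record gobj := GObj {
  gcar : C;
  gpt : hom unit gcar -> Prop;
  gcopt : hom gcar bot -> Prop }.

Definition garrow (A B : gobj) (f : hom (gcar A) (gcar B)) : Prop :=
  (forall u, gpt u -> gpt (f ∘ u)) /\ (forall y, gcopt y -> gcopt (y ∘ f)).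

Definition ghom (A B : gobj) := {f : hom (gcar A) (gcar B) | garrow f}.

Lemma ghom_eq A B (f g : ghom A B) : sval f = sval g -> f = g.
Proof. by apply: eq_sig_hprop => ? ? ?; apply: proof_irrelevance. Qed.

Lemma garrow1 A : @garrow A A 1.
Proof. by split=> [u hu|y hy]; rewrite ?comp1m ?compm1. Qed.

Lemma garrowM A B D (g : hom (gcar B) (gcar D)) (f : hom (gcar A) (gcar B)) :
  garrow g -> garrow f -> garrow (g ∘ f).
Proof.
move=> [g1 g2] [f1 f2]; split=> [u hu|y hy].
  by rewrite -compA; apply/g1/f1.
by rewrite compA; apply/f2/g2.
Qed.

Definition glue : category.
refine (@Category gobj ghom (fun A => exist _ 1 (garrow1 A))
  (fun A B D g f => exist _ (sval g ∘ sval f) (garrowM (svalP g) (svalP f)))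
  _ _ _).
- by move=> *; apply: ghom_eq; apply: compA.
- by move=> *; apply: ghom_eq; apply: comp1m.
- by move=> *; apply: ghom_eq; apply: compm1.
Defined.

Definition gtens (A B : gobj) : gobj :=
  @GObj (gcar A ⊗ gcar B)
    (fun p => exists u v, [/\ @gpt A u, @gpt B v & p = (u ⊠ v) ∘ luni unit])
    (fun z =>
      (forall v, @gpt B v -> @gcopt A (z ∘ (1 ⊠ v) ∘ runi (gcar A))) /\
      (forall u, @gpt A u -> @gcopt B (z ∘ (u ⊠ 1) ∘ luni (gcar B)))).

Definition gdual (A : gobj) : gobj :=
  @GObj ((gcar A)^⊥)
    (fun p => exists x, @gcopt A x /\ p = dualm x ∘ chi unit)
    (fun q => exists u, @gpt A u /\ q = dualm u).

Lemma garrow_tensm (A B A' B' : gobj) (f : hom (gcar A) (gcar B))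
    (g : hom (gcar A') (gcar B')) :
  garrow f -> garrow g -> @garrow (gtens A A') (gtens B B') (f ⊠ g).
Proof.
move=> [f1 f2] [g1 g2]; split=> [_ [u [v [hu hv ->]]]|z [z1 z2]].
  by exists (f ∘ u), (g ∘ v); rewrite compA -tensmM; split; auto.
split=> [v hv|u hu].
  by rewrite -/(plugr _ _) plugr_tensm; apply/f2/z1/g1.
by rewrite -/(plugl _ _) plugl_tensm; apply/g2/z2/f1.
Qed.

Lemma garrow_assoc (A B D : gobj) :
  @garrow (gtens (gtens A B) D) (gtens A (gtens B D)) (assoc _ _ _).
Proof.
split=> [_ [_ [w [[u [v [hu hv ->]]] hw ->]]]|z [z1 z2]].
  exists u, ((v ⊠ w) ∘ luni unit); split=> //; first by exists v, w.
  exact: assoc_pt.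
split=> [w hw|_ [u [v [hu hv ->]]]].
  split=> [v hv|u hu]; rewrite -!/(plugr _ _) -?/(plugl _ _).
    by rewrite plugr_assoc; apply: z1; exists v, w.
  by rewrite plug_assoc; case: (z2 u hu) => h _; apply: h.
rewrite -/(plugl _ _) plugl_assoc.
by case: (z2 u hu) => _ h; apply: h.
Qed.

Lemma garrow_associ (A B D : gobj) :
  @garrow (gtens A (gtens B D)) (gtens (gtens A B) D) (associ _ _ _).
Proof.
split=> [_ [u [_ [hu [v [w [hv hw ->]]] ->]]]|z [z1 z2]].
  exists ((u ⊠ v) ∘ luni unit), w; split=> //; first by exists u, v.
  exact: associ_pt.
have zE : z = z ∘ associ _ _ _ ∘ assoc _ _ _ by rewrite -compA assocK compm1.
split=> [_ [v [w [hv hw ->]]]|u hu].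
  rewrite -/(plugr _ _) -plugr_assoc -zE.
  by case: (z1 w hw) => h _; apply: h.
split=> [w hw|v hv]; rewrite -!/(plugl _ _) -?/(plugr _ _).
  by rewrite -plug_assoc -zE; case: (z1 w hw) => _ h; apply: h.
by rewrite -plugl_assoc -zE; apply: z2; exists u, v.
Qed.

Lemma garrow_sym (A B : gobj) : @garrow (gtens A B) (gtens B A) (sym _ _).
Proof.
split=> [_ [u [v [hu hv ->]]]|z [z1 z2]].
  by exists v, u; split=> //; rewrite compA sym_nat -compA sym_luni luni_runi.
split=> [v hv|u hu].
  by rewrite -/(plugr _ _) plugr_sym; apply: z2.
by rewrite -/(plugl _ _) plugl_sym; apply: z1.
Qed.

Section G1.
Variable i : hom (@unit C) bot.

Definition orth (A : glue) : Prop :=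
  forall u x, @gpt A u -> @gcopt A x -> x ∘ u = i.

Definition G1_cat : category := full_sub orth.

Lemma orth_tens A B : orth A -> orth B -> orth (gtens A B).
Proof.
move=> hA hB _ z [u [v [hu hv ->]]] [z1 _].
by rewrite plug_pt; apply: hA => //; apply: z1.
Qed.

Lemma orth_dual A : orth A -> orth (gdual A).
Proof.
move=> hA _ _ [x [hx ->]] [u [hu ->]].
by rewrite compA -dualmM (hA u x) // copoint_unit.
Qed.

Definition gunit : gobj :=
  @GObj unit (fun u => u = 1) (fun x => x = i).

Lemma orth_unit : orth gunit.
Proof. by move=> _ _ -> ->; rewrite compm1. Qed.

Lemma garrow_lun (A : gobj) : orth A -> @garrow (gtens gunit A) A (lun _).
Proof.
move=> hA; split=> [_ [_ [v [-> hv ->]]]|y hy].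
  by rewrite compA lun_nat -compA luniK compm1.
split=> [v hv|_ ->].
  rewrite -(compA y) lun_nat -!compA lun_run runiK compm1.
  exact: hA.
by rewrite tensm1 compm1 -compA luniK compm1.
Qed.

Lemma garrow_luni (A : gobj) : @garrow A (gtens gunit A) (luni _).
Proof.
split=> [u hu|z [z1 z2]]; first by exists 1, u; rewrite luni_nat.
by have := z2 _ erefl; rewrite tensm1 compm1.
Qed.

Lemma garrow_run (A : gobj) : orth A -> @garrow (gtens A gunit) A (run _).
Proof.
move=> hA; rewrite -lun_sym.
exact: (@garrowM (gtens A gunit) (gtens gunit A) A _ _
  (garrow_lun hA) (garrow_sym _ _)).
Qed.

Lemma garrow_runi (A : gobj) : @garrow A (gtens A gunit) (runi _).
Proof.
rewrite -sym_luni.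
exact: (@garrowM A (gtens gunit A) (gtens A gunit) _ _
  (garrow_sym gunit A) (garrow_luni A)).
Qed.

Lemma gcopt_bot (q : hom bot bot) : @gcopt (gdual gunit) q <-> q = 1.
Proof.
split=> [[_ [-> ->]]|->]; first exact: dualm1.
by exists 1; split=> //; rewrite dualm1.
Qed.

Lemma gpt_bot (p : hom unit bot) : @gpt (gdual gunit) p <-> p = i.
Proof.
split=> [[_ [-> ->]]|->]; first exact: copoint_unit.
by exists i; split=> //; rewrite copoint_unit.
Qed.

Lemma garrow_ev (A : gobj) : orth A ->
  @garrow (gtens (gdual A) A) (gdual gunit) (ev _).
Proof.
move=> hA; split=> [_ [_ [v [[x [hx ->]] hv ->]]]|_ /gcopt_bot ->].
  apply/gpt_bot; rewrite plug_ptl /plugl ev_copoint -(compA x) luniK compm1.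
  exact: hA.
rewrite comp1m; split=> [v hv|_ [x [hx ->]]].
  by exists v; rewrite dualm_point.
by rewrite ev_copoint -compA luniK compm1.
Qed.

Lemma garrow_name (X A : gobj) (f : hom (gcar X ⊗ gcar A) bot) :
  @garrow (gtens X A) (gdual gunit) f -> @garrow X (gdual A) (name f).
Proof.
move=> [_ f2]; have /= [f3 f4]: @gcopt (gtens X A) f.
  by rewrite -(comp1m f); apply/f2/gcopt_bot.
split=> [u hu|_ [v [hv ->]]].
  exists (plugl f u); split; first exact: f4.
  by rewrite name_comp copointE /plugl -(compA _ (luni _)) lunK compm1.
rewrite dualm_point -!compA -runi_nat !compA -(compA (ev _)) -tensm_r tensm_l.
by rewrite compA nameK; apply: f3.
Qed.

Lemma garrow_chii (A : gobj) : @garrow (gdual (gdual A)) A (chii _).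
Proof.
split=> [_ [_ [[u [hu ->]] ->]]|x hx].
  by rewrite chi_nat compA chii_chi comp1m.
exists (dualm x ∘ chi unit); split; first by exists x.
by rewrite dualmM chii_nat chii_dual.
Qed.

Definition G1_tens (A B : G1_cat) : G1_cat :=
  exist _ (gtens (sval A) (sval B)) (orth_tens (svalP A) (svalP B)).
Definition G1_unit : G1_cat := exist _ gunit orth_unit.
Definition G1_dual (A : G1_cat) : G1_cat :=
  exist _ (gdual (sval A)) (orth_dual (svalP A)).

Definition G1_smcat : smcat.
refine (@SMCat G1_cat G1_tens
  (fun A B A' B' f g =>
     exist _ (sval f ⊠ sval g) (garrow_tensm (svalP f) (svalP g)))
  G1_unit _ _
  (fun A B D => exist _ (assoc _ _ _) (garrow_assoc (sval A) (sval B) (sval D)))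
  (fun A B D => exist _ (associ _ _ _) (garrow_associ (sval A) (sval B) (sval D)))
  (fun A => exist _ (lun _) (garrow_lun (svalP A)))
  (fun A => exist _ (luni _) (garrow_luni (sval A)))
  (fun A => exist _ (run _) (garrow_run (svalP A)))
  (fun A => exist _ (runi _) (garrow_runi (sval A)))
  (fun A B => exist _ (sym _ _) (garrow_sym (sval A) (sval B)))
  _ _ _ _ _ _ _ _ _ _ _ _ _ _); move=> *; apply: ghom_eq.
- exact: tensm1.
- exact: tensmM.
- exact: assocK.
- exact: associK.
- exact: lunK.
- exact: luniK.
- exact: runK.
- exact: runiK.
- exact: symK.
- exact: assoc_nat.
- exact: lun_nat.
- exact: run_nat.
- exact: sym_nat.
- exact: pentagon.
- exact: triangle.
- exact: hexagon.
Defined.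

Definition G1 : starcat.
refine (@StarCat G1_smcat G1_dual
  (fun A => exist _ (ev _) (garrow_ev (svalP A)))
  (fun X A f => exist _ (name (sval f)) (garrow_name (svalP f)))
  _ _ _
  (fun A => exist _ (chii _) (garrow_chii (sval A)))
  _ _); move=> *; apply: ghom_eq.
- exact: nameK.
- exact: evK.
- exact: ev_unit.
- exact: chiK.
- exact: chiiK.
Defined.

End G1.
End Glue.

Section G1Mix.
Variable C : compact.

Local Notation S := (compact_star C).

Lemma garrow_mixm :
  @garrow S (gdual (@gunit S (iota C))) (@gunit S (iota C)) (iotai C).
Proof.
split=> [u /gpt_bot ->|_ ->]; first exact: iotaK.
by apply/gcopt_bot; apply: iotaiK.
Qed.

Lemma iotai_coh : lun (cdual unit) ∘ (iotai C ⊠ 1) = run _ ∘ (1 ⊠ iotai C).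
Proof.
have e : (iota C ⊠ iota C) ∘ (iotai C ⊠ iotai C) = 1.
  by rewrite -tensmM !iotaiK tensm1.
apply: (epi_l e); rewrite -!compA -!tensmM !iotaK !comp1m.
by rewrite lun_nat run_nat lun_run.
Qed.

Definition G1_mix : mixcat.
refine (@MixCat (@G1 S (iota C)) (exist _ (iotai C) garrow_mixm) _).
by apply: ghom_eq; exact: iotai_coh.
Defined.

End G1Mix.

Record biproducts (C : category) := Biproducts {
  zob : C;
  zto : forall A, hom A zob;
  zfrom : forall A, hom zob A;
  zto_uniq : forall A (f : hom A zob), f = zto A;
  zfrom_uniq : forall A (f : hom zob A), f = zfrom A;
  bip : C -> C -> C;
  bpr1 : forall A B, hom (bip A B) A;
  bpr2 : forall A B, hom (bip A B) B;
  bin1 : forall A B, hom A (bip A B);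
  bin2 : forall A B, hom B (bip A B);
  bpair : forall X A B, hom X A -> hom X B -> hom X (bip A B);
  bcopair : forall X A B, hom A X -> hom B X -> hom (bip A B) X;
  bpair1 : forall X A B (f : hom X A) (g : hom X B), bpr1 A B ∘ bpair f g = f;
  bpair2 : forall X A B (f : hom X A) (g : hom X B), bpr2 A B ∘ bpair f g = g;
  bpair_uniq : forall X A B (h : hom X (bip A B)),
    h = bpair (bpr1 A B ∘ h) (bpr2 A B ∘ h);
  bcopair1 : forall X A B (f : hom A X) (g : hom B X),
    bcopair f g ∘ bin1 A B = f;
  bcopair2 : forall X A B (f : hom A X) (g : hom B X),
    bcopair f g ∘ bin2 A B = g;
  bcopair_uniq : forall X A B (h : hom (bip A B) X),
    h = bcopair (h ∘ bin1 A B) (h ∘ bin2 A B);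
  bpr1_bin1 : forall A B, bpr1 A B ∘ bin1 A B = 1;
  bpr2_bin2 : forall A B, bpr2 A B ∘ bin2 A B = 1;
  bpr1_bin2 : forall A B, bpr1 A B ∘ bin2 A B = zfrom A ∘ zto B;
  bpr2_bin1 : forall A B, bpr2 A B ∘ bin1 A B = zfrom B ∘ zto A }.

Section Additive.
Variables (C : compact) (P : biproducts C).

Definition zerom (A B : C) : hom A B := zfrom P B ∘ zto P A.
Definition addm (A B : C) (f g : hom A B) : hom A B :=
  bcopair P 1 1 ∘ bpair P f g.
Definition scalem (A B : C) (s : hom (@unit C) unit) (f : hom A B) : hom A B :=
  lun B ∘ (s ⊠ f) ∘ luni A.

Definition zero_sum_free : Prop :=
  forall s : hom (@unit C) unit,
    (exists t, addm s t = zerom unit unit) -> s = zerom unit unit.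

End Additive.

Arguments addm {C} P {A B}.

(* [Lit true x] is the positive literal [x], [Lit false x] its negation. *)
Inductive formula (T : Type) :=
  | Lit of bool & T
  | Tens of formula T & formula T
  | Par of formula T & formula T.

Fixpoint fmap (T U : Type) (h : T -> U) (A : formula T) : formula U :=
  match A with
  | Lit b x => Lit b (h x)
  | Tens A B => Tens (fmap h A) (fmap h B)
  | Par A B => Par (fmap h A) (fmap h B)
  end.

(* A sequent is nonempty, given by its first formula and the others; its
   commas are read as (right-nested) pars. *)
Fixpoint parl (T : Type) (A : formula T) (G : seq (formula T)) : formula T :=
  if G is B :: G' then Par A (parl B G') else A.

(* An axiom link on a literal [i] is named by a pair [(i, k)]; a proof
   structure over a sequent is the sequent with every literal occurrence
   marked by the name of its link, so that every name in use marks exactly one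
   positive and one negative occurrence.  [erase] recovers the sequent. *)
Definition link (N : nat) : eqType := ('I_N * nat)%type.

Definition erase (N : nat) (A : formula (link N)) : formula 'I_N := fmap fst A.

Fixpoint leaves (T : Type) (A : formula T) : seq (bool * T) :=
  match A with
  | Lit b x => [:: (b, x)]
  | Tens A B | Par A B => leaves A ++ leaves B
  end.

Definition proof_structure (N : nat) (G : seq (formula (link N))) : bool :=
  let L := flatten (map (@leaves _) G) in
  uniq L && all (fun l => (~~ l.1, l.2) \in L) L.

(* The vertex [(j, p)] is the subformula occurrence reached from the [j]-th
   formula along the path [p], where [false] stands for the left argument. *)
Definition vertex : eqType := (nat * seq bool)%type.

Fixpoint subformula (T : Type) (A : formula T) (p : seq bool) :
    option (formula T) :=
  match p, A with
  | [::], _ => Some A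
  | b :: p', Tens A1 A2 | b :: p', Par A1 A2 =>
      subformula (if b then A2 else A1) p'
  | _ :: _, Lit _ _ => None
  end.

Definition at_vertex (T : Type) (G : seq (formula T)) (v : vertex) :=
  obind (fun A => subformula A v.2) (onth G v.1).

(* The switching [s] keeps the edge to the argument [s v] at the par [v]. *)
Definition arg_edge (N : nat) (s : vertex -> bool)
    (G : seq (formula (link N))) (v w : vertex) : bool :=
  match at_vertex G v with
  | Some (Tens _ _) =>
      (w == (v.1, rcons v.2 false)) || (w == (v.1, rcons v.2 true))
  | Some (Par _ _) => w == (v.1, rcons v.2 (s v))
  | _ => false
  end.

Definition axiom_edge (N : nat) (G : seq (formula (link N)))
    (v w : vertex) : bool :=
  match at_vertex G v, at_vertex G w with
  | Some (Lit b x), Some (Lit c y) => (c == ~~ b) && (x == y)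
  | _, _ => false
  end.

Definition switching_edge (N : nat) (s : vertex -> bool)
    (G : seq (formula (link N))) (v w : vertex) : bool :=
  [|| arg_edge s G v w, arg_edge s G w v | axiom_edge G v w].

Definition acyclic (e : rel vertex) : Prop :=
  forall c : seq vertex, 2 < size c -> ~~ (cycle e c && uniq c).

Definition proof_net (N : nat) (G : seq (formula (link N))) : Prop :=
  proof_structure G /\ forall s, acyclic (switching_edge s G).

(* Cut-free sequent calculus for MLL^- + Mix.  The proof net of a derivation
   can be read off its end sequent: the two literals introduced by an axiom
   carry the same name and are joined by a link.  When the end sequent is a
   proof structure, distinct axioms have distinct names. *)
Inductive deriv (N : nat) : seq (formula (link N)) -> Type :=
  | d_ax x : deriv [:: Lit true x; Lit false x]
  | d_ex G A B H : deriv (G ++ A :: B :: H) -> deriv (G ++ B :: A :: H)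
  | d_mix G H : deriv G -> deriv H -> deriv (G ++ H)
  | d_tens A B G H :
      deriv (A :: G) -> deriv (B :: H) -> deriv (Tens A B :: G ++ H)
  | d_par A B G : deriv (A :: B :: G) -> deriv (Par A B :: G).

Section Functor.
Variables (D : starcat) (N : nat).

Fixpoint fob (R S : 'I_N -> D) (A : formula 'I_N) : D :=
  match A with
  | Lit true i => R i
  | Lit false i => (S i)^⊥
  | Tens A B => fob R S A ⊗ fob R S B
  | Par A B => fob R S A ⅋ fob R S B
  end.

Fixpoint fmor (R R' S S' : 'I_N -> D) (f : forall i, hom (R i) (R' i))
    (g : forall i, hom (S' i) (S i)) (A : formula 'I_N) :
    hom (fob R S A) (fob R' S' A) :=
  match A with
  | Lit true i => f i
  | Lit false i => dualm (g i)
  | Tens A B => fmor f g A ⊠ fmor f g B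
  | Par A B => parm (fmor f g A) (fmor f g B)
  end.

Definition family (A : formula 'I_N) := forall R : 'I_N -> D, hom unit (fob R R A).

Definition transformation (A : formula 'I_N) (t : family A) : Prop :=
  forall (R S : 'I_N -> D) (f : forall i, hom (R i) (S i)),
    fmor f (fun i => idm (R i)) A ∘ t R =
    fmor (fun i => idm (S i)) f A ∘ t S.

End Functor.

Section Interpretation.
Variables (D : mixcat) (N : nat) (R : 'I_N -> D).

Definition lob (A : formula (link N)) : D := fob R R (erase A).

(* A derivation of [A1, ..., An] is interpreted as an arrow
   [A1^⊥ ⊗ (... ⊗ (An^⊥ ⊗ unit)) -> bot], the transpose of one
   [unit -> A1 ⅋ (... ⅋ An)]. *)
Fixpoint ctx (G : seq (formula (link N))) : D :=
  if G is A :: G' then (lob A)^⊥ ⊗ ctx G' else unit.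

Fixpoint ctx_split (G H : seq (formula (link N))) :
    hom (ctx (G ++ H)) (ctx G ⊗ ctx H) :=
  match G with
  | [::] => luni _
  | A :: G' => associ _ _ _ ∘ (1 ⊠ ctx_split G' H)
  end.

Fixpoint ctx_swap (G : seq (formula (link N))) A B H :
    hom (ctx (G ++ B :: A :: H)) (ctx (G ++ A :: B :: H)) :=
  match G with
  | [::] => assoc _ _ _ ∘ (sym _ _ ⊠ 1) ∘ associ _ _ _
  | X :: G' => 1 ⊠ ctx_swap G' A B H
  end.

Fixpoint dint (G : seq (formula (link N))) (d : deriv G) : hom (ctx G) bot :=
  match d in deriv G return hom (ctx G) bot with
  | d_ax x => ev ((R x.1)^⊥) ∘ sym _ _ ∘ (1 ⊠ run _)
  | d_ex G A B H d => dint d ∘ ctx_swap G A B H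
  | d_mix G H d e =>
      lun bot ∘ (mixm ⊠ 1) ∘ (dint d ⊠ dint e) ∘ ctx_split G H
  | d_tens A B G H d e =>
      ev (lob A ⊗ lob B) ∘
        (1 ⊠ (((chii (lob A) ∘ name (dint d ∘ sym _ _)) ⊠
               (chii (lob B) ∘ name (dint e ∘ sym _ _))) ∘ ctx_split G H))
  | d_par A B G d => dint d ∘ assoc _ _ _ ∘ (chii _ ⊠ 1)
  end.

Fixpoint ctx_close A (G : seq (formula (link N))) :
    hom ((fob R R (parl (erase A) (map (@erase N) G)))^⊥) (ctx (A :: G)) :=
  match G with
  | [::] => runi _
  | B :: G' => (1 ⊠ ctx_close B G') ∘ chii _
  end.

Definition interp A (G : seq (formula (link N))) (d : deriv (A :: G)) :
    hom unit (fob R R (parl (erase A) (map (@erase N) G))) :=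
  undualm (dint d ∘ ctx_close A G).

End Interpretation.

(* [t] is the interpretation of a proof net, that is, of a derivation
   sequentialising it. *)
Inductive net_interp (D : mixcat) (N : nat) :
    forall (A : formula 'I_N) G, family D (parl A G) -> Prop :=
  | NetInterp A G (d : deriv (A :: G))
      (t : family D (parl (erase A) (map (@erase N) G))) :
      proof_net (A :: G) -> (forall R, t R = interp R d) -> net_interp t.

Definition full_completeness (D : mixcat) : Prop :=
  forall (N : nat) (A : formula 'I_N) (G : seq (formula 'I_N))
    (t : family D (parl A G)),
    transformation t -> net_interp t.

(* Tensor words in link ends, and the associativity, unit and symmetry
   isomorphisms between them. *)
Inductive word (T : Type) :=
  | WUnit
  | WLit of bool & T
  | WTens of word T & word T.
Arguments WUnit {T}.

Inductive struct (T : Type) : word T -> word T -> Type :=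
  | s_id v : struct v v
  | s_comp u v w : struct v w -> struct u v -> struct u w
  | s_tens v w v' w' :
      struct v w -> struct v' w' -> struct (WTens v v') (WTens w w')
  | s_assoc u v w : struct (WTens (WTens u v) w) (WTens u (WTens v w))
  | s_associ u v w : struct (WTens u (WTens v w)) (WTens (WTens u v) w)
  | s_lun v : struct (WTens WUnit v) v
  | s_luni v : struct v (WTens WUnit v)
  | s_run v : struct (WTens v WUnit) v
  | s_runi v : struct v (WTens v WUnit)
  | s_sym v w : struct (WTens v w) (WTens w v).

Fixpoint link_word (T : Type) (L : seq T) : word T :=
  if L is x :: L' then
    WTens (WTens (WLit true x) (WLit false x)) (link_word L')
  else WUnit.

Fixpoint formula_word (T : Type) (A : formula T) : word T :=
  match A with
  | Lit b x => WLit b x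
  | Tens A B | Par A B => WTens (formula_word A) (formula_word B)
  end.

Section CompactInterpretation.
Variable C : compact.

(* The isomorphism [A ⊗ B ≅ A ⅋ B]: the transpose of
   [(A ⊗ B) ⊗ (A^* ⊗ B^* ) ≅ (A ⊗ A^* ) ⊗ (B ⊗ B^* ) -> unit ⊗ unit ≅ unit]. *)
Definition middle_swap (A B X Y : C) :
    hom ((A ⊗ B) ⊗ (X ⊗ Y)) ((A ⊗ X) ⊗ (B ⊗ Y)) :=
  associ A X (B ⊗ Y) ∘
    (1 ⊠ (assoc X B Y ∘ (sym B X ⊠ 1) ∘ associ B X Y)) ∘ assoc A B (X ⊗ Y).

Definition mix (A B : C) : hom (A ⊗ B) (cdual (cdual A ⊗ cdual B)) :=
  ctr (lun unit ∘ ((eps A ∘ sym A (cdual A)) ⊠ (eps B ∘ sym B (cdual B)))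
    ∘ middle_swap A B (cdual A) (cdual B)).

Variables (N : nat) (R : 'I_N -> C).

Fixpoint wob (w : word (link N)) : C :=
  match w with
  | WUnit => unit
  | WLit b x => if b then R x.1 else cdual (R x.1)
  | WTens v w => wob v ⊗ wob w
  end.

Fixpoint wstruct v w (s : struct v w) : hom (wob v) (wob w) :=
  match s in struct v w return hom (wob v) (wob w) with
  | s_id v => 1
  | s_comp u v w s r => wstruct s ∘ wstruct r
  | s_tens v w v' w' s r => wstruct s ⊠ wstruct r
  | s_assoc u v w => assoc _ _ _
  | s_associ u v w => associ _ _ _
  | s_lun v => lun _
  | s_luni v => luni _
  | s_run v => run _
  | s_runi v => runi _
  | s_sym v w => sym _ _
  end.

Fixpoint units (L : seq (link N)) : hom unit (wob (link_word L)) :=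
  match L with
  | [::] => 1
  | x :: L' => (eta (R x.1) ⊠ units L') ∘ luni unit
  end.

Fixpoint mixify (A : formula (link N)) :
    hom (wob (formula_word A)) (fob (D := compact_star C) R R (erase A)) :=
  match A with
  | Lit true x => idm (R x.1)
  | Lit false x => idm (cdual (R x.1))
  | Tens A B => mixify A ⊠ mixify B
  | Par A B => mix _ _ ∘ (mixify A ⊠ mixify B)
  end.

Fixpoint mixify_seq A (G : seq (formula (link N))) :
    hom (wob (formula_word (parl A G)))
      (fob (D := compact_star C) R R (parl (erase A) (map (@erase N) G))) :=
  match G with
  | [::] => mixify A
  | B :: G' => mix _ _ ∘ (mixify A ⊠ mixify_seq B G')
  end.

End CompactInterpretation.

(* [t] is the interpretation of a proof structure.  The arrow [s] permutes the
   ends of the links [L] into their places in the sequent; the names force [L]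
   to list every link once, and by coherence [s] does not matter. *)
Inductive ps_interp (C : compact) (N : nat) :
    forall (A : formula 'I_N) G,
      family (compact_star C) (parl A G) -> Prop :=
  | PsInterp A G (L : seq (link N))
      (s : struct (link_word L) (formula_word (parl A G)))
      (t : family (compact_star C) (parl (erase A) (map (@erase N) G))) :
      proof_structure (A :: G) ->
      (forall R, t R = mixify_seq R A G ∘ wstruct R s ∘ units R L) ->
      ps_interp t.

Definition feeble_full_completeness (C : compact) (P : biproducts C) : Prop :=
  forall (N : nat) (A : formula 'I_N) (G : seq (formula 'I_N))
    (t : family (compact_star C) (parl A G)),
    transformation t ->
    exists (n : nat) (a : 'I_n -> hom (@unit C) unit)
      (u : 'I_n -> family (compact_star C) (parl A G)),
      (forall k, ps_interp (u k)) /\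
      forall R, t R = \big[addm P/zerom P _ _]_(k < n) scalem (a k) (u k R).

(* Main.v *)
From HB Require Import structures.
From mathcomp Require Import all_boot zify.
From Stdlib Require Import ProofIrrelevance Classical Program.Equality.
Require Import Defs.

(** By feeble full completeness, the arrow underlying a transformation [t] is
    a linear combination of proof structures.  The object [M] of [G1 C] on
    the biproduct [unit + unit], with the two injections as points and the
    codiagonal as only copoint, yields tests: arrows out of the formula,
    instantiated at [Rs = M ⊗ M^⊥], that read, feed or plug a constant into
    each literal.  A test into [M] sends [t] to one of the two points, so one
    of its two coordinates vanishes, and as [C] is zero-sum-free the same
    coordinate then vanishes on every proof structure that occurs in [t].
    Reading a single literal shows that only one proof structure occurs, with
    coefficients adding up to 1.  Running a test around a cycle alternating
    axiom links and pairs of leaves meeting at a tensor shows that this proof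
    structure has no chordless such cycle, and this suffices to sequentialize
    it: by induction on the size a tensor or a par can be detached, because
    two chordless paths obstructing the two ways to do so would compose to a
    chordless cycle.  The interpretation of the resulting derivation is a
    transformation as well, and evaluating it on the tests that read a single
    literal identifies its underlying proof structure with that of [t]. *)

Set Implicit Arguments.
Unset Strict Implicit.
Unset Printing Implicit Defensive.

(** * Leaves and their coherence *)

(** Zero-sum-freeness is needed because tests are not exact. At a par one argument has to be sent to
    [unit]; if it contains a part of the cycle, it is closed by evaluation [M ⊗ M^⊥ -> unit], a sum
    over both basis vectors, whereas the proof structure is evaluated at one of them. Tests
    therefore only dominate the product functional [theta] in the order [ge], and vanishing is the
    property that descends. Chords are excluded because every leaf left of a tensor meets every leaf
    right of it. Without chords, a tensor with active leaves on both sides has exactly one on either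
    side, and the test is formed there as a pair in [M ⊗ M^⊥]. A point of this object has one basis
    vector in its first factor, while a cycle in a proof structure has value 1 for both vectors.
    [Rs] has two factors because a cycle runs through some links from the positive end to the
    negative one and through others the opposite way, so either end must be readable and feedable.
    The passage to [C] rests on objects without points and copoints, between which every arrow of
    [C] is allowed. *)

Section Coherence.
Variable N : nat.
Local Notation leaf := (bool * link N)%type.
Implicit Types (A B : formula (link N)) (l m : leaf).

Definition conj l : leaf := (~~ l.1, l.2).

Lemma conjK : involutive conj.
Proof. by case=> b x; rewrite /conj /= negbK. Qed.

(** When no leaf is repeated this is the cograph of the formula: an edge means that the lowest
    connective above both leaves is a tensor. Associating and commuting connectives leave it
    unchanged, so such rewritings preserve the absence of chordless cycles. *)
Fixpoint coh A l m : bool :=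
  match A with
  | Lit _ _ => false
  | Tens A B => [|| coh A l m, coh B l m, (l \in leaves A) && (m \in leaves B)
                  | (l \in leaves B) && (m \in leaves A)]
  | Par A B => coh A l m || coh B l m
  end.

Lemma coh_mem A l m : coh A l m -> (l \in leaves A) /\ (m \in leaves A).
Proof.
elim: A => //= A IHA B IHB; rewrite !mem_cat.
  case/or4P=> [/IHA[-> ->]|/IHB[-> ->]|/andP[-> ->]|/andP[-> ->]];
  by rewrite ?orbT.
by case/orP=> [/IHA[-> ->]|/IHB[-> ->]]; rewrite ?orbT.
Qed.

Definition cyc_succ k i := if i.+1 == k then 0 else i.+1.

(* A chordless alternating cycle [x 0, conj (x 1), x 1, conj (x 2), ...]:
   coherent pairs [x i, conj (x i.+1)] joined by axiom links, without other
   coherences. *)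
Definition chordless (c : rel leaf) k (x : nat -> leaf) : Prop :=
  [/\ 0 < k,
      forall i, i < k -> c (x i) (conj (x (cyc_succ k i))),
      forall i j, i < k -> j < k -> ~~ c (x i) (x j),
      forall i j, i < k -> j < k -> ~~ c (conj (x i)) (conj (x j))
    & forall i j, i < k -> j < k -> c (x i) (conj (x j)) -> j = cyc_succ k i].

Definition cyclic (c : rel leaf) : Prop := exists k x, chordless c k x.

Lemma coh_sym A l m : coh A l m = coh A m l.
Proof.
elim: A => //= A -> B -> //.
by do 2!congr orb; rewrite orbC; congr orb; rewrite andbC.
Qed.

Definition cyc_pred k i := if i == 0 then k.-1 else i.-1.

Lemma cyc_succ_lt k i : i < k -> cyc_succ k i < k.
Proof. by rewrite /cyc_succ => h; case: eqP => [<-|/eqP ne] //; rewrite ltn_neqAle ne. Qed.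

Lemma cyc_pred_lt k i : i < k -> cyc_pred k i < k.
Proof. by rewrite /cyc_pred; case: i => [|i] /=; [case: k|apply: ltnW]. Qed.

Lemma cyc_succK k i : i < k -> cyc_pred k (cyc_succ k i) = i.
Proof. by rewrite /cyc_pred /cyc_succ; case: (i.+1 =P k) => [<-|]. Qed.

Lemma cyc_predK k i : i < k -> cyc_succ k (cyc_pred k i) = i.
Proof.
rewrite /cyc_pred /cyc_succ; case: i => [|i] /=; first by case: k => //= k; rewrite eqxx.
by move=> h; rewrite (ltn_eqF h).
Qed.

End Coherence.

Lemma cat_inj T (s1 s2 t1 t2 : seq T) :
  size s1 = size t1 -> s1 ++ s2 = t1 ++ t2 -> s1 = t1 /\ s2 = t2.
Proof.
by elim: s1 t1 => [|x s1 IH] [|y t1] //= [sz] [-> /(IH _ sz)[-> ->]].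
Qed.

(** * Proof structures over the same sequent, and renaming of links *)

Section Matching.
Variable N : nat.
Local Notation leaf := (bool * link N)%type.
Implicit Types (A B : formula (link N)) (l m : leaf).

Definition closed_leaves (s : seq leaf) := all (fun l => conj l \in s) s.
Definition linked A := uniq (leaves A) && closed_leaves (leaves A).

Lemma erase_size A B : erase A = erase B -> size (leaves A) = size (leaves B).
Proof.
elim: A B => [b x|A IHA A' IHA'|A IHA A' IHA'] [b' y|B B'|B B'] //=;
by case=> /IHA e /IHA' e'; rewrite !size_cat e e'.
Qed.

Lemma erase_leaves A B : erase A = erase B ->
  [seq (l.1, l.2.1) | l <- leaves A] = [seq (l.1, l.2.1) | l <- leaves B].
Proof.
elim: A B => [b x|A IHA A' IHA'|A IHA A' IHA'] [b' y|B B'|B B'] //=.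
- by case=> -> ->.
- by case=> /IHA e /IHA' e'; rewrite !map_cat e e'.
by case=> /IHA e /IHA' e'; rewrite !map_cat e e'.
Qed.

Lemma fmap_leaves A B (h : link N -> link N) : erase A = erase B ->
  leaves A = [seq (l.1, h l.2) | l <- leaves B] -> A = fmap h B.
Proof.
elim: A B => [b x|A IHA A' IHA'|A IHA A' IHA'] [b' y|B B'|B B'] //=.
- by move=> _ [-> ->].
- case=> e e'; rewrite map_cat => h1; have [|h2 h3] := cat_inj _ h1.
    by rewrite size_map (erase_size e).
  by rewrite (IHA B) // (IHA' B').
case=> e e'; rewrite map_cat => h1; have [|h2 h3] := cat_inj _ h1.
  by rewrite size_map (erase_size e).
by rewrite (IHA B) // (IHA' B').
Qed.

Section Two.
Variables A B : formula (link N).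
Hypotheses (lA : linked A) (lB : linked B) (e : erase A = erase B).

(** The leaf of [A] at the position that [l] has in [B]. The default is never reached for a leaf of
    [B], since equal erasures give equally many leaves. *)
Definition twin l : leaf := nth l (leaves A) (index l (leaves B)).

Lemma twin_shape l : l \in leaves B -> (twin l).1 = l.1 /\ (twin l).2.1 = l.2.1.
Proof.
move=> hl; have iB : index l (leaves B) < size (leaves B) by rewrite index_mem.
have iA : index l (leaves B) < size (leaves A) by rewrite (erase_size e).
have := congr1 (fun s => nth (l.1, l.2.1) s (index l (leaves B))) (erase_leaves e).
rewrite /= (nth_map l) // (nth_map l) // nth_index // => -[h1 h2].
by rewrite /twin h1 h2.
Qed.

Lemma twin_mem l : l \in leaves B -> twin l \in leaves A.
Proof. by move=> hl; rewrite mem_nth // (erase_size e) index_mem. Qed.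

Lemma twin_inj l m : l \in leaves B -> m \in leaves B -> twin l = twin m -> l = m.
Proof.
move=> hl hm; rewrite /twin (set_nth_default l m) ?(erase_size e) ?index_mem //.
case/andP: lA => uA _ /eqP.
rewrite nth_uniq ?(erase_size e) ?index_mem // => /eqP h.
by rewrite -(nth_index l hl) h nth_index.
Qed.

Lemma leaves_twin : leaves A = map twin (leaves B).
Proof.
case/andP: lB => uB _.
have sz := erase_size e; case hB : (leaves B) sz => [|l0 s] sz; first exact: size0nil.
rewrite -hB in sz *.
apply: (@eq_from_nth _ l0) => [|i iA]; first by rewrite size_map.
rewrite sz in iA; rewrite (nth_map l0) // /twin index_uniq //.
by apply: set_nth_default; rewrite sz.
Qed.

Definition rename (y : link N) : nat := (twin (true, y)).2.2.

(** When [twin] keeps the two ends of each link together, both proof structures have the same links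
    up to names, and the name found at the positive end defines the renaming. *)
Lemma rename_eq :
  (forall y, (true, y) \in leaves B -> (twin (true, y)).2 = (twin (false, y)).2) ->
  A = fmap (fun y => (y.1, rename y)) B.
Proof.
move=> h; apply: fmap_leaves => //; rewrite leaves_twin; apply/eq_in_map => -[b y] hy.
have ty : (true, y) \in leaves B.
  by case/andP: lB => _ /allP cB; case: b hy => // /cB.
have [s1 s2] := twin_shape hy; rewrite /= in s1 s2 *.
rewrite [LHS]surjective_pairing s1; congr (_, _).
by rewrite [LHS]surjective_pairing s2 /rename; case: b hy {s1 s2} => // _; rewrite h.
Qed.

End Two.

End Matching.

Lemma leaves_parl N (A : formula (link N)) L :
  leaves (parl A L) = flatten (map (@leaves _) (A :: L)).
Proof. by elim: L A => [|B L IH] A /=; rewrite ?cats0 // IH. Qed.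

Lemma proof_structure_linked N (A : formula (link N)) L :
  proof_structure (A :: L) = linked (parl A L).
Proof. by rewrite /linked leaves_parl. Qed.

(** * Sequentialization of proof structures without chordless cycles *)

Section FormulaEq.
Variable T : eqType.

Fixpoint formula_eq (A B : formula T) : bool :=
  match A, B with
  | Lit b x, Lit c y => (b == c) && (x == y)
  | Tens A1 A2, Tens B1 B2 | Par A1 A2, Par B1 B2 =>
      formula_eq A1 B1 && formula_eq A2 B2
  | _, _ => false
  end.

Lemma formula_eqP : Equality.axiom formula_eq.
Proof.
move=> A B; apply: (iffP idP) => [|<-{B}].
  elim: A B => [b x|A1 IH1 A2 IH2|A1 IH1 A2 IH2] [c y|B1 B2|B1 B2] //= /andP[].
  - by move=> /eqP -> /eqP ->.
  - by move=> /IH1 -> /IH2 ->.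
  by move=> /IH1 -> /IH2 ->.
by elim: A => [b x|A1 IH1 A2 IH2|A1 IH1 A2 IH2] /=; rewrite ?eqxx ?IH1 ?IH2.
Qed.

HB.instance Definition _ := hasDecEq.Build (formula T) formula_eqP.
End FormulaEq.

(** A permutation is an equality of the counts of every predicate, so such goals become linear
    arithmetic for an arbitrary [p]. *)
Ltac perm_lia := apply/permP; let p := fresh "p" in intro p;
  repeat match goal with
  | H : is_true (perm_eq _ _) |- _ =>
      move/permP/(_ p): H; rewrite /= ?count_cat /= => H
  end; rewrite /= ?count_cat /=; lia.

(** * Permutation and inversion in the sequent calculus *)

Section Derivations.
Variable N : nat.
Local Notation fm := (formula (link N)).
Local Notation leaf := (bool * link N)%type.
Implicit Types (A B : fm) (G H : seq fm).

Definition der G : Prop := inhabited (deriv G).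

Lemma der_ax x : der [:: Lit true x; Lit false x].
Proof. by constructor; apply: d_ax. Qed.

Lemma der_mix G H : der G -> der H -> der (G ++ H).
Proof. by move=> [d] [e]; constructor; apply: d_mix. Qed.

Lemma der_tens A B G H : der (A :: G) -> der (B :: H) -> der (Tens A B :: G ++ H).
Proof. by move=> [d] [e]; constructor; apply: d_tens. Qed.

Lemma der_par A B G : der (A :: B :: G) -> der (Par A B :: G).
Proof. by move=> [d]; constructor; apply: d_par. Qed.

(** Insertion sort by [d_ex]; the prefix [P] collects the formulae that are already in place. *)
Lemma der_perm G H : perm_eq G H -> der G -> der H.
Proof.
suff h P : perm_eq G H -> der (P ++ G) -> der (P ++ H) by apply: (h [::]).
elim: H G P => [|x H IH] G P pG; first by have /size0nil -> := perm_size pG.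
have xG : x \in G by rewrite (perm_mem pG) mem_head.
case/splitPr: xG pG => l1 l2 pG d.
have {}pG : perm_eq (l1 ++ l2) H by perm_lia.
rewrite -cat_rcons; apply: (IH (l1 ++ l2)) => //; rewrite cat_rcons.
elim/last_ind: l1 l2 d {pG} => [//|l1 y IHl] l2 d.
rewrite cat_rcons; apply: IHl; move: d; rewrite cat_rcons !catA.
by case=> d; constructor; apply: d_ex.
Qed.

Lemma perm_cons_cat x (l G H : seq fm) : perm_eq (G ++ H) (x :: l) ->
  (exists2 G', perm_eq G (x :: G') & perm_eq l (G' ++ H)) \/
  (exists2 H', perm_eq H (x :: H') & perm_eq l (G ++ H')).
Proof.
move=> p; have : x \in G ++ H by rewrite (perm_mem p) mem_head.
rewrite mem_cat => /orP[] h; [left; exists (rem x G)|right; exists (rem x H)];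
  have := perm_to_rem h => h'; by [|perm_lia].
Qed.

Lemma perm_cons_cons x y (l m : seq fm) : perm_eq (x :: l) (y :: m) ->
  (x = y /\ perm_eq l m) \/
  exists2 l', perm_eq l (y :: l') & perm_eq m (x :: l').
Proof.
move=> p; have : x \in y :: m by rewrite -(perm_mem p) mem_head.
rewrite inE => /orP[/eqP e|h]; [left|right].
  by subst y; split=> //; rewrite -(perm_cons x).
by exists (rem x m); have := perm_to_rem h => h'; perm_lia.
Qed.

(** The occurrence is followed up to the rule that introduces it, which exists because axioms
    introduce literals only. There [k] is used instead of that rule, and the rules below are
    replayed with [S] in place of [Tens A B]. This plays the part of a cut, without cut
    elimination. *)
Lemma tens_inv A B G : der G -> forall L, perm_eq G (Tens A B :: L) ->
  forall S, (forall L1 L2, der (A :: L1) -> der (B :: L2) -> der (S ++ L1 ++ L2)) ->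
  der (S ++ L).
Proof.
case=> d; elim: d => {G} [x|G C D H d IH|G H d IHd e IHe|C D G H d IHd e IHe|C D G d IH]
  L p S k.
- have : Tens A B \in [:: Lit true x; Lit false x] by rewrite (perm_mem p) mem_head.
  by rewrite !inE.
- by apply: IH => //; perm_lia.
- case: (perm_cons_cat p) => -[M p1 p2].
    have h := IHd _ p1 S k; apply: der_perm (der_mix h (inhabits e)); perm_lia.
  have h := IHe _ p1 S k; apply: der_perm (der_mix (inhabits d) h); perm_lia.
- case: (perm_cons_cons p) => [[[e1 e2] p1]|[L' p1 p2]].
    subst C D; apply: der_perm (k _ _ (inhabits d) (inhabits e)); perm_lia.
  case: (perm_cons_cat p1) => -[M p3 p4].
    have h : der (S ++ C :: M) by apply: IHd => //; perm_lia.
    have h' : der (C :: S ++ M) by apply: der_perm h; perm_lia.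
    apply: der_perm (der_tens h' (inhabits e)); perm_lia.
  have h : der (S ++ D :: M) by apply: IHe => //; perm_lia.
  have h' : der (D :: S ++ M) by apply: der_perm h; perm_lia.
  apply: der_perm (der_tens (inhabits d) h'); perm_lia.
case: (perm_cons_cons p) => [[//]|[L' p1 p2]].
have h : der (S ++ C :: D :: L') by apply: IH => //; perm_lia.
have h' : der (C :: D :: S ++ L') by apply: der_perm h; perm_lia.
apply: der_perm (der_par h'); perm_lia.
Qed.

(** The rule introducing the par is deleted, and all rules below it can be replayed with [A, B] in
    its place. *)
Lemma par_inv A B G : der G -> forall L, perm_eq G (Par A B :: L) -> der (A :: B :: L).
Proof.
case=> d; elim: d => {G} [x|G C D H d IH|G H d IHd e IHe|C D G H d IHd e IHe|C D G d IH]
  L p.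
- have : Par A B \in [:: Lit true x; Lit false x] by rewrite (perm_mem p) mem_head.
  by rewrite !inE.
- by apply: IH => //; perm_lia.
- case: (perm_cons_cat p) => -[M p1 p2].
    have h := IHd _ p1; apply: der_perm (der_mix h (inhabits e)); perm_lia.
  have h := IHe _ p1; apply: der_perm (der_mix (inhabits d) h); perm_lia.
- case: (perm_cons_cons p) => [[//]|[L' p1 p2]].
  case: (perm_cons_cat p1) => -[M p3 p4].
    have h : der (A :: B :: C :: M) by apply: IHd => //; perm_lia.
    have h' : der (C :: A :: B :: M) by apply: der_perm h; perm_lia.
    apply: der_perm (der_tens h' (inhabits e)); perm_lia.
  have h : der (A :: B :: D :: M) by apply: IHe => //; perm_lia.
  have h' : der (D :: A :: B :: M) by apply: der_perm h; perm_lia.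
  apply: der_perm (der_tens (inhabits d) h'); perm_lia.
case: (perm_cons_cons p) => [[[e1 e2] p1]|[L' p1 p2]].
  subst C D; apply: der_perm (inhabits d); perm_lia.
have h : der (A :: B :: C :: D :: L') by apply: IH => //; perm_lia.
have h' : der (C :: D :: A :: B :: L') by apply: der_perm h; perm_lia.
apply: der_perm (der_par h'); perm_lia.
Qed.

End Derivations.

(** * Surgery on chordless cycles *)

Section Cycles.
Variable N : nat.
Local Notation leaf := (bool * link N)%type.
Implicit Types (c : rel leaf) (P Q : pred leaf) (x y z : nat -> leaf).

Lemma chordless_ext c c' k x :
  (forall l m, (exists2 i, i < k & l = x i \/ l = conj (x i)) ->
     (exists2 i, i < k & m = x i \/ m = conj (x i)) -> c l m = c' l m) ->
  chordless c k x -> chordless c' k x.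
Proof.
move=> h [k0 hE hA hC hS]; have hx i : i < k -> exists2 j, j < k & x i = x j \/ x i = conj (x j).
  by move=> ik; exists i; [|left].
have cast i : i < k -> exists2 j, j < k & conj (x i) = x j \/ conj (x i) = conj (x j).
  by move=> ik; exists i; [|right].
split=> // [i ik|i j ik jk|i j ik jk|i j ik jk]; rewrite -h; auto.
- by apply: cast; apply: cyc_succ_lt.
Qed.

Lemma cyc_succE k i : i < k -> cyc_succ k i = i.+1 %% k.
Proof.
rewrite /cyc_succ; case: eqP => [<-|/eqP ne] ik; first by rewrite modnn.
by rewrite modn_small // ltn_neqAle ne.
Qed.

Lemma chordless_rot c k x d : chordless c k x -> chordless c k (fun t => x ((d + t) %% k)).
Proof.
move=> [k0 hE hA hC hS]; have lt t : (d + t) %% k < k by rewrite ltn_mod.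
have sE t : t < k -> (d + cyc_succ k t) %% k = cyc_succ k ((d + t) %% k).
  by move=> tk; rewrite !cyc_succE // modnDmr -[in RHS]addn1 modnDml addnS addn1.
split=> // [i ik|i j ik jk|i j ik jk|i j ik jk]; [by rewrite sE ?hE|exact: hA|exact: hC|].
move/(hS _ _ (lt i) (lt j)); rewrite -sE // => /eqP.
by rewrite eqn_modDl !modn_small ?cyc_succ_lt // => /eqP.
Qed.

(** Run backwards, the cycle meets each link from its other end, hence [conj]. *)
Lemma chordless_rev c k x : symmetric c -> chordless c k x ->
  chordless c k (fun t => conj (x (k.-1 - t))).
Proof.
move=> sc [k0 hE hA hC hS]; have lt t : k.-1 - t < k by lia.
have sE t : t < k -> k.-1 - cyc_succ k t = cyc_pred k (k.-1 - t).
  rewrite /cyc_succ /cyc_pred => tk; case: eqP => [<-|ne] /=; first by rewrite subnn eqxx subn0.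
  by case: eqP; lia.
split=> // [i ik|i j ik jk|i j ik jk|i j ik jk].
- rewrite conjK sE // sc -{2}(cyc_predK (lt i)); apply: hE.
  exact: cyc_pred_lt.
- by apply: hC.
- by rewrite !conjK; apply: hA.
rewrite conjK sc => /(hS _ _ (lt j) (lt i)) e.
have := congr1 (cyc_pred k) e; rewrite cyc_succK // -sE // => e'.
by have := cyc_succ_lt ik; lia.
Qed.

(* [c] after a tensor joins the leaves in [P] to those in [Q]. *)
Definition addp c P Q : rel leaf := fun l m => [|| c l m, P l && Q m | Q l && P m].

Lemma addp_sym c P Q : symmetric c -> symmetric (addp c P Q).
Proof. by move=> sc l m; rewrite /addp sc; congr orb; rewrite orbC; congr orb; rewrite andbC. Qed.

Section Mono.
Variables (c : rel leaf) (P Q : pred leaf).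
Hypothesis sc : symmetric c.
(** [P] stands for the leaves of a root formula, so it is closed under coherence. [Q] is either a
    root as well, or the factor [B] of a root [Tens D B]: a coherence that leaves it then ends in
    [D], whose leaves are coherent with all of [B]. *)
Hypothesis cP : forall l m, c l m -> P l -> P m.
Hypothesis cQ : forall l m, c l m -> Q l -> Q m \/ forall q, Q q -> c q m.
Hypothesis PQ : forall l, P l -> ~~ Q l.

(* A chordless path from [Q] to [P]; closing a shortest one with the new
   coherence gives a chordless cycle. *)
Definition chordless_path k y : Prop :=
  [/\ forall i, i < k -> c (y i) (conj (y i.+1)),
      forall i j, i <= k -> j <= k -> ~~ c (y i) (y j),
      forall i j, i <= k -> j <= k -> ~~ c (conj (y i)) (conj (y j))
    & forall i j, i <= k -> j <= k -> c (y i) (conj (y j)) -> j = i.+1].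

(** Induction on the length: an entry into [Q] after the start, or a leaf of [P] before the end,
    gives a shorter path. On a shortest path the added coherences relate only the two ends, and so
    close the cycle without a chord. *)
Lemma chordless_shortcut k y : chordless_path k y -> Q (conj (y 0)) -> P (y k) ->
  cyclic (addp c P Q).
Proof.
elim/ltn_ind: k y => k IH y [hE hA hC hS] q0 pk.
have [[t /andP[t0 tk] qt]|nQ] := classic (exists2 t, 0 < t <= k & Q (conj (y t))).
  apply: (IH (k - t) _ (fun i => y (i + t))); rewrite ?subnK ?add0n //; first by lia.
  split=> [i ik|i j ik jk|i j ik jk|i j ik jk].
  - by apply: hE; lia.
  - by apply: hA; lia.
  - by apply: hC; lia.
  by move=> h; have := hS (i + t) (j + t) _ _ h; lia.
have [[t tk pt]|nP] := classic (exists2 t, t < k & P (y t)).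
  apply: (IH t tk y) => //; split=> [i ik|i j ik jk|i j ik jk|i j ik jk].
  - by apply: hE; lia.
  - by apply: hA; lia.
  - by apply: hC; lia.
  by apply: hS; lia.
(* The second alternative of [cQ] would make [conj (y j.+1)] coherent with [conj (y 0)], a chord of
   the path. *)
have f1 j : j <= k -> ~~ Q (y j).
  rewrite leq_eqVlt => /orP[/eqP ->|jk]; first exact: PQ.
  apply/negP => qj; case: (cQ (hE j jk) qj) => [qj'|/(_ _ q0) h].
    by apply: nQ; exists j.+1.
  by have := hC 0 j.+1 (leq0n _) jk; rewrite h.
have f2 j : j <= k -> ~~ P (conj (y j)).
  case: j => [|j] jk; first by apply/negP => /PQ; rewrite q0.
  apply/negP => pj; apply: nP; exists j => //.
  by apply: cP pj; rewrite sc; apply: hE.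
have f3 j : j <= k -> P (y j) -> j = k.
  by move=> jk pj; apply/eqP; rewrite eqn_leq jk leqNgt; apply/negP => h; apply: nP; exists j.
have f4 j : j <= k -> Q (conj (y j)) -> j = 0.
  by case: j => // j jk qj; case: nQ; exists j.+1.
exists k.+1, y; split=> // [i ik|i j ik jk|i j ik jk|i j ik jk]; rewrite /addp.
- rewrite /cyc_succ; case: eqP => [[->]|ne]; first by rewrite pk q0 orbT.
  by rewrite hE //; lia.
- by rewrite (negbTE (hA _ _ ik jk)) (negbTE (f1 j jk)) (negbTE (f1 i ik)) andbF.
- by rewrite (negbTE (hC _ _ ik jk)) (negbTE (f2 j jk)) (negbTE (f2 i ik)) andbF.
rewrite (negbTE (f1 i ik)) orbF /cyc_succ => /orP[/(hS _ _ ik jk) ej|/andP[/(f3 i ik) -> /(f4 j jk) ->]].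
  by case: eqP; lia.
by rewrite eqxx.
Qed.

(** A cycle that avoids [P] or avoids [Q] acquires no chord. One that meets both contains, after a
    rotation and possibly a reversal, a chordless path from [Q] to [P]. *)
Lemma cyclic_addp : cyclic c -> cyclic (addp c P Q).
Proof.
move=> [k [x cx]].
have main x' : chordless c k x' -> (exists2 i, i < k & Q (conj (x' i))) ->
    (exists2 j, j < k & P (x' j)) -> cyclic (addp c P Q).
  move=> cx' [d dk qd] [j jk pj]; have [k0 hE hA hC hS] := chordless_rot d cx'.
  pose e := (j + (k - d)) %% k; have ek : e < k by rewrite ltn_mod.
  have pe : P (x' ((d + e) %% k)).
    by rewrite modnDmr addnCA subnKC 1?ltnW // modnDr modn_small.
  have q0 : Q (conj (x' ((d + 0) %% k))) by rewrite addn0 modn_small.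
  apply: (@chordless_shortcut e (fun t => x' ((d + t) %% k))) => //.
  split=> [a ae|a b ae be|a b ae be|a b ae be]; try (by [apply: hA; lia|apply: hC; lia]).
    by have := hE a; rewrite /cyc_succ; case: eqP => [|_]; [lia|apply; lia].
  move=> h; have ak : a < k by lia.
  have := hS a b ak _ h; rewrite /cyc_succ; case: eqP => [a1|_]; last by apply; lia.
  move=> b0; have {}b0 : b = 0 by apply: b0; lia.
  have {}a1 : a = e by lia.
  by subst a b; have := PQ (cP h pe); rewrite q0.
have [k0 hE hA hC hS] := cx.
have [[j jk pj]|nP] := classic (exists2 j, j < k & P (x j)); last first.
  exists k, x; apply: chordless_ext cx => l m [i ik hl] [j jk hm].
  have nPx i' : i' < k -> ~~ P (x i') by move=> ?; apply/negP => ?; apply: nP; exists i'.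
  have nPc i' : i' < k -> ~~ P (conj (x i')).
    move=> ik'; apply/negP => p; have := nPx _ (cyc_pred_lt ik'); case/negP.
    apply: cP p; rewrite sc -{2}(cyc_predK ik'); apply: hE.
    exact: cyc_pred_lt.
  have pl : P l = false by case: hl => ->; apply/negbTE; auto.
  have pm : P m = false by case: hm => ->; apply/negbTE; auto.
  by rewrite /addp pl pm andbF !orbF.
have [[i ik qi]|nQ] := classic (exists2 i, i < k & Q (conj (x i))).
  by apply: (main x cx); [exists i|exists j].
have [[i ik qi]|nQ'] := classic (exists2 i, i < k & Q (x i)).
  apply: (main _ (chordless_rev sc cx)).
    by exists (k.-1 - i); [lia|rewrite conjK subKn //; lia].
  exists (k.-1 - cyc_succ k j); first by lia.
  rewrite subKn; first by apply: cP pj; apply: hE.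
  by have := cyc_succ_lt jk; lia.
exists k, x; apply: chordless_ext cx => l m [a ak hl] [b bk hm].
have qf l' a' : a' < k -> l' = x a' \/ l' = conj (x a') -> Q l' = false.
  by move=> ak' [] ->; apply/negP => q; [apply: nQ'|apply: nQ]; exists a'.
by rewrite /addp (qf l a) // (qf m b) // andbF !orbF.
Qed.

End Mono.

(** As [c] alone has no chordless cycle, some coherent pair of the cycle is a new one; up to
    reversal and rotation it is the pair that closes the cycle. *)
Lemma cyclic_addp_path c P Q : symmetric c -> cyclic (addp c P Q) -> ~ cyclic c ->
  exists k y, [/\ chordless (addp c P Q) k.+1 y, P (y k) & Q (conj (y 0))].
Proof.
move=> sc [k [x cx]] nc.
have main x' : chordless (addp c P Q) k x' ->
    (exists2 i, i < k & P (x' i) /\ Q (conj (x' (cyc_succ k i)))) ->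
    exists k y, [/\ chordless (addp c P Q) k.+1 y, P (y k) & Q (conj (y 0))].
  move=> cx' [i ik [pi qi]]; exists k.-1, (fun t => x' ((i.+1 + t) %% k)).
  have k0 : 0 < k by lia.
  rewrite prednK //; split; first exact: chordless_rot.
    by rewrite addSnnS prednK // modnDr modn_small.
  by rewrite addn0 -cyc_succE.
have [k0 hE hA hC hS] := cx.
have [[i ik /andP[pi qi]]|n1] := classic (exists2 i, i < k & P (x i) && Q (conj (x (cyc_succ k i)))).
  by apply: (main x cx); exists i.
have [[i ik /andP[qi pi]]|n2] := classic (exists2 i, i < k & Q (x i) && P (conj (x (cyc_succ k i)))).
  apply: (main _ (chordless_rev (addp_sym _ _ sc) cx)).
  have sk := cyc_succ_lt ik.
  exists (k.-1 - cyc_succ k i); first by lia.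
  rewrite subKn; last by lia.
  split=> //; rewrite conjK; suff -> : k.-1 - cyc_succ k (k.-1 - cyc_succ k i) = i by [].
  by move: sk; rewrite /cyc_succ; case: eqP => ?; case: eqP; lia.
case: nc; exists k, x; split=> // [i ik|i j ik jk|i j ik jk|i j ik jk].
- have := hE i ik; rewrite /addp => /or3P[//|h|h].
    by case: n1; exists i.
  by case: n2; exists i.
- by apply: contra (hA i j ik jk) => h; rewrite /addp h.
- by apply: contra (hC i j ik jk) => h; rewrite /addp h.
by move=> h; apply: hS => //; rewrite /addp h.
Qed.

(** Any further leaf of [P] or [Q] on the cycle would form a chord with one of the two ends. *)
Lemma path_facts c P Q k y : symmetric c ->
  (forall l m, P l -> Q m -> ~~ c l m) ->
  chordless (addp c P Q) k.+1 y -> P (y k) -> Q (conj (y 0)) ->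
  chordless_path c k y /\
  forall s, s <= k -> [/\ P (y s) = (s == k), P (conj (y s)) = false,
    Q (y s) = false & Q (conj (y s)) = (s == 0)].
Proof.
move=> sc nPQ [_ hE hA hC hS] pk q0.
have facts s : s <= k -> [/\ P (y s) = (s == k), P (conj (y s)) = false,
    Q (y s) = false & Q (conj (y s)) = (s == 0)].
  move=> sk; split.
  - apply/idP/eqP => [ps|-> //].
    have := hS s 0 sk isT; rewrite /addp ps q0 orbT => /(_ isT).
    by rewrite /cyc_succ; case: eqP => // -[].
  - by apply/negP => ps; have := hC s 0 sk isT; rewrite /addp ps q0 orbT.
  - by apply/negP => qs; have := hA s k sk (leqnn _); rewrite /addp pk qs !orbT.
  apply/idP/eqP => [qs|-> //].
  have := hS k s (leqnn _) sk; rewrite /addp pk qs orbT => /(_ isT).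
  by rewrite /cyc_succ eqxx.
split=> //; split=> [s sk|s t sk tk|s t sk tk|s t sk tk].
- have [e1 _ e2 _] := facts s (ltnW sk); have := hE s (ltnW sk).
  by rewrite /addp e1 e2 (ltn_eqF sk) /cyc_succ eqSS (ltn_eqF sk) !orbF.
- by apply: contra (hA s t sk tk) => h; rewrite /addp h.
- by apply: contra (hC s t sk tk) => h; rewrite /addp h.
move=> h; have := hS s t sk tk; rewrite /addp h => /(_ isT); rewrite /cyc_succ.
case: eqP => // -[sk'] t0; subst s t.
by have := nPQ _ _ pk q0; rewrite h.
Qed.

(* Closing [y] with the pair in [P1 × Q1] and [z] with the one in [P2 × Q2]
   gives cycles of the parts; closing each with the other, through [P1 × Q2]
   and [Q1 × P2], gives one of the whole. *)
Lemma cyclic_join c (c1 c2 : rel leaf) (P1 Q1 P2 Q2 D1 D2 : pred leaf) k y k' z :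
  symmetric c -> symmetric c1 -> symmetric c2 ->
  (forall l m, P1 l -> Q1 m -> ~~ c1 l m) -> (forall l m, P2 l -> Q2 m -> ~~ c2 l m) ->
  (forall l m, addp c1 P1 Q1 l m -> D1 l /\ D1 m) ->
  (forall l m, addp c2 P2 Q2 l m -> D2 l /\ D2 m) ->
  (forall l m, D1 l -> D1 m -> c l m = c1 l m) ->
  (forall l m, D2 l -> D2 m -> c l m = c2 l m) ->
  (forall l m, D1 l -> D2 m -> c l m = (P1 l && Q2 m) || (Q1 l && P2 m)) ->
  chordless (addp c1 P1 Q1) k.+1 y -> P1 (y k) -> Q1 (conj (y 0)) ->
  chordless (addp c2 P2 Q2) k'.+1 z -> P2 (z k') -> Q2 (conj (z 0)) ->
  cyclic c.
Proof.
move=> sc s1 s2 n1 n2 d1 d2 e11 e22 e12 cy py qy cz pz qz.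
have [[E1 A1 C1 S1] f1] := path_facts s1 n1 cy py qy.
have [[E2 A2 C2 S2] f2] := path_facts s2 n2 cz pz qz.
have Dy s : s <= k -> D1 (y s) /\ D1 (conj (y s)).
  have [_ hE _ _ _] := cy => sk; have [d _] := d1 _ _ (hE s sk).
  have [_] := d1 _ _ (hE _ (@cyc_pred_lt k.+1 s sk)); rewrite cyc_predK //.
have Dz s : s <= k' -> D2 (z s) /\ D2 (conj (z s)).
  have [_ hE _ _ _] := cz => sk; have [d _] := d2 _ _ (hE s sk).
  have [_] := d2 _ _ (hE _ (@cyc_pred_lt k'.+1 s sk)); rewrite cyc_predK //.
pose w t := if t <= k then y t else z (t - k.+1).
have wy t : t <= k -> w t = y t by rewrite /w => ->.
have wz t : w (k.+1 + t) = z t.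
  by rewrite /w addKn; case: leqP => //; rewrite addSn ltnNge leq_addr.
have wP t : t < k.+1 + k'.+1 ->
    (t <= k) \/ exists2 s, s <= k' & t = k.+1 + s.
  by case: (leqP t k) => h h'; [left|right; exists (t - k.+1); lia].
exists (k.+1 + k'.+1), w; split=> // [i ik|i j ik jk|i j ik jk|i j ik jk].
- case: (wP i ik) => [h|[s h ei]].
    case: (ltngtP i k) h => [h|//|->] _.
      have -> : cyc_succ (k.+1 + k'.+1) i = i.+1 by rewrite /cyc_succ; case: eqP => //; lia.
      rewrite !wy ?(ltnW h) // e11 ?E1 //; first by case: (Dy i (ltnW h)).
      by case: (Dy i.+1 h).
    have -> : cyc_succ (k.+1 + k'.+1) k = k.+1 + 0 by rewrite /cyc_succ; case: eqP; lia.
    have [Dk _] := Dy k (leqnn _); have [_ D0] := Dz 0 (leq0n _).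
    by rewrite wy // wz e12 // py qz.
  case: (ltngtP s k') h => [h|//|es] _.
    have -> : cyc_succ (k.+1 + k'.+1) i = k.+1 + s.+1 by rewrite /cyc_succ; case: eqP; lia.
    rewrite ei !wz // e22 ?E2 //; first by case: (Dz s (ltnW h)).
    by case: (Dz s.+1 h).
  have -> : cyc_succ (k.+1 + k'.+1) i = 0 by rewrite /cyc_succ; case: eqP; lia.
  have [Dk _] := Dz k' (leqnn _); have [_ D0] := Dy 0 (leq0n _).
  by rewrite ei es wz wy // sc e12 // qy pz orbT.
- case: (wP i ik) => [hi|[s hs ->]]; case: (wP j jk) => [hj|[t ht ->]];
    rewrite ?wz ?wy //.
  + have [? _] := Dy i hi; have [? _] := Dy j hj; by rewrite e11 ?A1.
  + have [? _] := Dy i hi; have [? _] := Dz t ht; rewrite e12 //.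
    by have [_ _ -> _] := f2 t ht; have [_ _ -> _] := f1 i hi; rewrite andbF.
  + have [? _] := Dz s hs; have [? _] := Dy j hj; rewrite sc e12 //.
    by have [_ _ -> _] := f2 s hs; have [_ _ -> _] := f1 j hj; rewrite andbF.
  have [? _] := Dz s hs; have [? _] := Dz t ht; by rewrite e22 ?A2.
- case: (wP i ik) => [hi|[s hs ->]]; case: (wP j jk) => [hj|[t ht ->]];
    rewrite ?wz ?wy //.
  + have [_ ?] := Dy i hi; have [_ ?] := Dy j hj; by rewrite e11 ?C1.
  + have [_ ?] := Dy i hi; have [_ ?] := Dz t ht; rewrite e12 //.
    by have [_ -> _ _] := f2 t ht; have [_ -> _ _] := f1 i hi; rewrite andbF.
  + have [_ ?] := Dz s hs; have [_ ?] := Dy j hj; rewrite sc e12 //.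
    by have [_ -> _ _] := f2 s hs; have [_ -> _ _] := f1 j hj; rewrite andbF.
  have [_ ?] := Dz s hs; have [_ ?] := Dz t ht; by rewrite e22 ?C2.
case: (wP i ik) => [hi|[s hs ei]]; case: (wP j jk) => [hj|[t ht ej]];
  rewrite ?ei ?ej ?wz ?wy // => h.
- have [? _] := Dy i hi; have [_ ?] := Dy j hj; move: h; rewrite e11 //.
  by move/(S1 i j hi hj) => e; rewrite /cyc_succ; case: eqP; lia.
- have [? _] := Dy i hi; have [_ ?] := Dz t ht; move: h; rewrite e12 //.
  have [_ _ _ ->] := f2 t ht; have [-> _ -> _] := f1 i hi; rewrite orbF.
  by move=> /andP[/eqP ? /eqP ?]; rewrite /cyc_succ; case: eqP; lia.
- have [? _] := Dz s hs; have [_ ?] := Dy j hj; move: h; rewrite sc e12 //.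
  have [-> _ _ _] := f2 s hs; have [_ -> _ ->] := f1 j hj => /=.
  by move=> /andP[/eqP ? /eqP ?]; rewrite /cyc_succ; case: eqP; lia.
have [? _] := Dz s hs; have [_ ?] := Dz t ht; move: h; rewrite e22 //.
by move/(S2 s t hs ht) => e; rewrite /cyc_succ; case: eqP; lia.
Qed.

End Cycles.

(** * Coherence and correctness of sequents *)

Section Sequents.
Variable N : nat.
Local Notation fm := (formula (link N)).
Local Notation leaf := (bool * link N)%type.
Implicit Types (A B C D E F X : fm) (G H K : seq fm) (l m : leaf).

Definition sleaves G : seq leaf := flatten (map (@leaves _) G).
Definition scoh G : rel leaf := fun l m => has (fun A => coh A l m) G.

Lemma sleaves_cons A G : sleaves (A :: G) = leaves A ++ sleaves G.
Proof. by []. Qed.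

Lemma sleaves_cat G H : sleaves (G ++ H) = sleaves G ++ sleaves H.
Proof. by rewrite /sleaves map_cat flatten_cat. Qed.

Lemma scoh_cons A G l m : scoh (A :: G) l m = coh A l m || scoh G l m.
Proof. by []. Qed.

Lemma scoh_cat G H l m : scoh (G ++ H) l m = scoh G l m || scoh H l m.
Proof. exact: has_cat. Qed.

Lemma sleaves_perm G H : perm_eq G H -> perm_eq (sleaves G) (sleaves H).
Proof. by move=> p; apply: perm_flatten; apply: perm_map. Qed.

Lemma scoh_perm G H : perm_eq G H -> scoh G =2 scoh H.
Proof. by move=> p l m; apply: perm_has. Qed.

Lemma scoh_sym G : symmetric (scoh G).
Proof. by move=> l m; apply: eq_has => A; apply: coh_sym. Qed.

Lemma scoh_mem G l m : scoh G l m -> (l \in sleaves G) /\ (m \in sleaves G).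
Proof.
elim: G => //= A G IH /orP[/coh_mem[]|/IH[]]; rewrite !mem_cat => -> -> //.
by rewrite !orbT.
Qed.

Lemma coh_outl A l : l \notin leaves A -> forall m, coh A l m = false.
Proof. by move=> h m; apply/negP => /coh_mem[]; rewrite (negbTE h). Qed.

Lemma coh_outr A l : l \notin leaves A -> forall m, coh A m l = false.
Proof. by move=> h m; apply/negP => /coh_mem[_]; rewrite (negbTE h). Qed.

Lemma scoh_outl G l : l \notin sleaves G -> forall m, scoh G l m = false.
Proof. by move=> h m; apply/negP => /scoh_mem[]; rewrite (negbTE h). Qed.

Lemma scoh_outr G l : l \notin sleaves G -> forall m, scoh G m l = false.
Proof. by move=> h m; apply/negP => /scoh_mem[_]; rewrite (negbTE h). Qed.

Lemma cyclic_eq (c c' : rel leaf) : c =2 c' -> cyclic c -> cyclic c'.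
Proof. by move=> e [k [x cx]]; exists k, x; apply: chordless_ext cx => l m _ _. Qed.

Lemma notin_perm (s s1 s2 : seq leaf) l :
  uniq s -> perm_eq s (s1 ++ s2) -> l \in s1 -> l \notin s2.
Proof.
move=> u p h; rewrite (perm_uniq p) cat_uniq in u; case/and3P: u => _ /hasPn d _.
by apply/negP => /d; rewrite /= h.
Qed.

Lemma cyclic_sub G H K : uniq (sleaves G) -> perm_eq (sleaves G) (sleaves H ++ sleaves K) ->
  (forall l m, l \notin sleaves K -> m \notin sleaves K -> scoh H l m = scoh G l m) ->
  cyclic (scoh H) -> cyclic (scoh G).
Proof.
move=> u p e [k [x cx]]; exists k, x; have [_ hE _ _ _] := cx.
have out l : (exists2 i, i < k & l = x i \/ l = conj (x i)) -> l \notin sleaves K.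
  case=> i ik [] ->; apply: (notin_perm u p).
    by case: (scoh_mem (hE i ik)).
  have := hE _ (cyc_pred_lt ik); rewrite cyc_predK //.
  by case/scoh_mem.
by apply: chordless_ext cx => l m /out hl /out hm; apply: e.
Qed.

Lemma closed_perm (s t : seq leaf) : perm_eq s t -> closed_leaves s -> closed_leaves t.
Proof.
move=> p /allP h; apply/allP => l; rewrite -(perm_mem p) => /h.
by rewrite (perm_mem p).
Qed.

Lemma closed_cat (s t : seq leaf) :
  closed_leaves s -> closed_leaves t -> closed_leaves (s ++ t).
Proof.
move=> /allP h /allP h'; apply/allP => l; rewrite !mem_cat.
by case/orP => [/h ->|/h' ->]; rewrite ?orbT.
Qed.

Lemma der_closed G : der G -> closed_leaves (sleaves G).
Proof.
case=> d; elim: d => {G} [x|G A B H d IH|G H d IHd e IHe|A B G H d IHd e IHe|A B G d IH].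
- by rewrite /closed_leaves /= !inE !eqxx.
- by apply: closed_perm IH; apply: sleaves_perm; perm_lia.
- by rewrite sleaves_cat; apply: closed_cat.
- apply: closed_perm (closed_cat IHd IHe).
  by rewrite !sleaves_cons sleaves_cat; perm_lia.
by apply: closed_perm IH; rewrite !sleaves_cons /=; perm_lia.
Qed.

Lemma leaves_nonempty A : 0 < size (leaves A).
Proof. by elim: A => //= A IHA B IHB; rewrite size_cat; lia. Qed.

Lemma sleaves_nonempty G : G != [::] -> 0 < size (sleaves G).
Proof. by case: G => // A G _; rewrite sleaves_cons size_cat; have := leaves_nonempty A; lia. Qed.

Lemma der_nonempty G : der G -> G != [::].
Proof.
case=> d; elim: d => {G} [x|G A B H d|G H d IHd e IHe|A B G H d IHd e IHe|A B G d IH] //.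
- by case: G d.
by case: G IHd {d}.
Qed.

(** Tensor up to commutativity, so that the mirror images of a last rule form one case. *)
Definition tens_of X A B := X = Tens A B \/ X = Tens B A.

Lemma tens_ofC X A B : tens_of X A B -> tens_of X B A.
Proof. by case; [right|left]. Qed.

Lemma der_tens_of X A B G H : tens_of X A B ->
  der (A :: G) -> der (B :: H) -> der (X :: G ++ H).
Proof.
case=> -> d e; first exact: der_tens.
apply: der_perm (der_tens e d); perm_lia.
Qed.

Lemma leaves_tens_of X A B : tens_of X A B -> perm_eq (leaves X) (leaves A ++ leaves B).
Proof. by case=> -> //=; rewrite perm_catC. Qed.

Lemma mem_tens_of X A B l : tens_of X A B ->
  (l \in leaves X) = (l \in leaves A) || (l \in leaves B).
Proof. by move=> t; rewrite (perm_mem (leaves_tens_of t)) mem_cat. Qed.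

Lemma coh_tens_of X A B : tens_of X A B -> forall l m,
  coh X l m = [|| coh A l m, coh B l m, (l \in leaves A) && (m \in leaves B)
    | (l \in leaves B) && (m \in leaves A)].
Proof.
case=> -> l m //=; case: (coh A l m); case: (coh B l m) => //=.
by rewrite orbC.
Qed.

Definition is_par A := if A is Par _ _ then true else false.

(** Exchanges are absorbed into the permutations, which exposes the last rule that is not an
    exchange. *)
Lemma der_last G : der G ->
  [\/ exists x, perm_eq G [:: Lit true x; Lit false x],
      exists H K, [/\ perm_eq G (H ++ K), der H & der K],
      exists X A B H K, [/\ tens_of X A B, perm_eq G (X :: H ++ K), der (A :: H) & der (B :: K)]
    | exists A B H, perm_eq G (Par A B :: H) /\ der (A :: B :: H)].
Proof.
case=> d; elim: d => {G} [x|G A B H d IH|G H d IHd e IHe|A B G H d IHd e IHe|A B G d IH].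
- by apply: Or41; exists x.
- have p : perm_eq (G ++ B :: A :: H) (G ++ A :: B :: H) by perm_lia.
  case: IH => [[x q]|[H' [K [q h h']]]|[X [A' [B' [H' [K [t q h h']]]]]]|[A' [B' [H' [q h]]]]].
  + by apply: Or41; exists x; apply: perm_trans p q.
  + by apply: Or42; exists H', K; split=> //; apply: perm_trans p q.
  + by apply: Or43; exists X, A', B', H', K; split=> //; apply: perm_trans p q.
  by apply: Or44; exists A', B', H'; split=> //; apply: perm_trans p q.
- by apply: Or42; exists G, H; split=> //.
- by apply: Or43; exists (Tens A B), A, B, G, H; split=> //; left.
by apply: Or44; exists A, B, G; split=> //.
Qed.

Fixpoint fsize A : nat :=
  match A with
  | Lit _ _ => 1
  | Tens A B | Par A B => (fsize A + fsize B).+1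
  end.
Definition ssize G := sumn (map fsize G).

Lemma ssize_perm G H : perm_eq G H -> ssize G = ssize H.
Proof. by move=> p; apply: perm_sumn; apply: perm_map. Qed.

Lemma ssize_cat G H : ssize (G ++ H) = ssize G + ssize H.
Proof. by rewrite /ssize map_cat sumn_cat. Qed.

Lemma ssize_cons A G : ssize (A :: G) = fsize A + ssize G.
Proof. by []. Qed.

Lemma fsize_tens_of X A B : tens_of X A B -> fsize X = (fsize A + fsize B).+1.
Proof. by case=> -> //=; rewrite addnC. Qed.

Lemma fsize_gt0 A : 0 < fsize A.
Proof. by case: A. Qed.

Lemma ssize_gt0 G : 0 < size (sleaves G) -> 0 < ssize G.
Proof. by case: G => //= A G _; rewrite /ssize /=; have := fsize_gt0 A; lia. Qed.

(** Unlike acyclicity of switchings, this condition speaks of leaves alone, so it can be compared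
    between sequents that share leaves but not connectives. *)
Definition correct G := [/\ uniq (sleaves G), closed_leaves (sleaves G) & ~ cyclic (scoh G)].

Lemma correct_leaves G H : correct G -> perm_eq (sleaves G) (sleaves H) ->
  (cyclic (scoh H) -> cyclic (scoh G)) -> correct H.
Proof.
move=> [u c nb] p b; split; [by rewrite -(perm_uniq p)|exact: closed_perm p c|].
exact: contra_not nb.
Qed.

Lemma correct_perm G H : perm_eq G H -> correct G -> correct H.
Proof.
move=> p g; apply: correct_leaves g (sleaves_perm p) _.
by apply: cyclic_eq => l m; rewrite (scoh_perm p).
Qed.

End Sequents.

Arguments sleaves : simpl never.
Arguments scoh : simpl never.
Arguments ssize : simpl never.

Ltac sperm :=
  repeat match goal with
  | H : is_true (perm_eq _ _) |- _ => move/sleaves_perm: H => H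
  | t : tens_of _ _ _ |- _ => move/leaves_tens_of: t => t
  end;
  apply/permP; let p := fresh "p" in intro p;
  repeat match goal with
  | H : is_true (perm_eq _ _) |- _ =>
      move/permP/(_ p): H; rewrite ?(sleaves_cons, sleaves_cat) /= ?count_cat /= => H
  end; rewrite ?(sleaves_cons, sleaves_cat) /= ?count_cat /=; lia.

Ltac ssize_lia :=
  repeat match goal with
  | H : is_true (perm_eq _ _) |- _ =>
      move/ssize_perm: H; rewrite ?(ssize_cons, ssize_cat) /= => H
  | t : tens_of _ _ _ |- _ => move/fsize_tens_of: t => /= t
  end; rewrite ?(ssize_cons, ssize_cat) /=; lia.

Ltac bool_cases := rewrite /= ?(orbF, orbT, andbF, andbT);
  first [ done | match goal with
  | |- context [coh ?A ?l ?m] => case: (coh A l m); bool_cases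
  | |- context [scoh ?A ?l ?m] => case: (scoh A l m); bool_cases
  | |- context [?l \in ?A] => case: (l \in A); bool_cases
  end ].

Ltac out_all :=
  repeat match goal with
  | H : is_true (_ && _) |- _ => let H' := fresh "nn" in case/andP: H => H H'
  end;
  rewrite ?(scoh_cons, scoh_cat);
  repeat match goal with
  | p : is_true (perm_eq ?G _) |- context [scoh ?G _ _] =>
      rewrite (scoh_perm p) ?(scoh_cons, scoh_cat)
  end;
  rewrite ?(scoh_cons, scoh_cat);
  rewrite /= ?mem_cat;
  repeat match goal with
  | t : tens_of ?X _ _ |- context [coh ?X _ _] => rewrite (coh_tens_of t)
  end;
  repeat match goal with
  | t : tens_of ?X _ _ |- context [_ \in leaves ?X] => rewrite !(mem_tens_of _ t)
  end;
  repeat match goal with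
  | h : is_true (?l \notin leaves ?A) |- _ =>
     rewrite ?(coh_outl h) ?(coh_outr h) ?(negbTE h); clear h
  | h : is_true (?l \notin sleaves ?A) |- _ =>
     rewrite ?(scoh_outl h) ?(scoh_outr h) ?(negbTE h); clear h
  end.

(** Compares two coherence relations off a set of discarded leaves: whatever touches a discarded
    leaf is erased, and a truth table settles the rest. *)
Ltac agree := let l := fresh "l" in let m := fresh "m" in
  let nl := fresh "nl" in let nm := fresh "nm" in
  intros l m; rewrite ?(sleaves_cons, sleaves_cat) /= ?(mem_cat, negb_or); intros nl nm;
  out_all; bool_cases.

(** * Detaching tensors and pars by induction on the size *)

Section Sequentialization.
Variable N : nat.
Local Notation fm := (formula (link N)).
Local Notation leaf := (bool * link N)%type.
Implicit Types (A B C D E F X Y : fm) (G H K : seq fm) (l m : leaf).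

Lemma correct_part G H K : correct G -> perm_eq (sleaves G) (sleaves H ++ sleaves K) ->
  closed_leaves (sleaves H) ->
  (forall l m, l \notin sleaves K -> m \notin sleaves K -> scoh H l m = scoh G l m) ->
  correct H.
Proof.
move=> [u _ nb] p c e; split=> //.
  by move: u; rewrite (perm_uniq p) cat_uniq => /and3P[].
by move=> b; apply: nb; apply: cyclic_sub u p e b.
Qed.

(** If both additions created a chordless cycle, each of these would be a path closed by a new pair,
    and [cyclic_join] would link the two paths through the pairs in [A × Q2] and [Q1 × F], which are
    coherent in [G]. *)
Lemma correct_split G A K1 (Q1 : pred leaf) F K2 (Q2 : pred leaf) : correct G ->
  perm_eq (sleaves G) (sleaves (A :: K1) ++ sleaves (F :: K2)) ->
  (forall m, Q1 m -> m \in sleaves K1) -> (forall m, Q2 m -> m \in sleaves K2) ->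
  ~ cyclic (scoh (A :: K1)) -> ~ cyclic (scoh (F :: K2)) ->
  (forall l m, l \notin sleaves (F :: K2) -> m \notin sleaves (F :: K2) ->
     scoh (A :: K1) l m = scoh G l m) ->
  (forall l m, l \notin sleaves (A :: K1) -> m \notin sleaves (A :: K1) ->
     scoh (F :: K2) l m = scoh G l m) ->
  (forall l m, l \notin sleaves (F :: K2) -> m \notin sleaves (A :: K1) ->
     scoh G l m = (l \in leaves A) && Q2 m || Q1 l && (m \in leaves F)) ->
  ~ cyclic (addp (scoh (A :: K1)) (mem (leaves A)) Q1) \/
  ~ cyclic (addp (scoh (F :: K2)) (mem (leaves F)) Q2).
Proof.
move=> [u _ nb] p q1 q2 nb1 nb2 e1 e2 e12.
have [b1|] := classic (cyclic (addp (scoh (A :: K1)) (mem (leaves A)) Q1)); last by left.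
have [b2|] := classic (cyclic (addp (scoh (F :: K2)) (mem (leaves F)) Q2)); last by right.
have [k [y [cy py qy]]] := cyclic_addp_path (@scoh_sym _ _) b1 nb1.
have [k' [z [cz pz qz]]] := cyclic_addp_path (@scoh_sym _ _) b2 nb2.
case: nb; have p' := p; rewrite perm_sym perm_catC perm_sym in p'.
have o1 l : l \in sleaves (A :: K1) -> l \notin sleaves (F :: K2) by apply: notin_perm u p.
have o2 l : l \in sleaves (F :: K2) -> l \notin sleaves (A :: K1) by apply: notin_perm u p'.
have nc A' K' (Q' : pred leaf) S : uniq (sleaves (A' :: K') ++ S) -> (forall m, Q' m -> m \in sleaves K') ->
    forall l m, l \in leaves A' -> Q' m -> ~~ scoh (A' :: K') l m.
  rewrite cat_uniq sleaves_cons cat_uniq => /andP[/and3P[_ /hasPn h _] _] q l m lA /q mK.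
  have /= mA := h _ mK; have lK : l \notin sleaves K' by apply: contraL lA => /h.
  by rewrite scoh_cons (coh_outr mA) (scoh_outl lK).
have in_addp A' K' (Q' : pred leaf) : (forall m, Q' m -> m \in sleaves K') -> forall l m,
    addp (scoh (A' :: K')) (mem (leaves A')) Q' l m ->
    (l \in sleaves (A' :: K')) /\ (m \in sleaves (A' :: K')).
  move=> q l m /or3P[/scoh_mem//|/andP[/= h /q h']|/andP[/q h /= h']];
    by rewrite !sleaves_cons !mem_cat h h' ?orbT.
apply: (cyclic_join (c := scoh G) (c1 := scoh (A :: K1)) (c2 := scoh (F :: K2))
   (P1 := mem (leaves A)) (Q1 := Q1) (P2 := mem (leaves F)) (Q2 := Q2)
   (D1 := mem (sleaves (A :: K1))) (D2 := mem (sleaves (F :: K2)))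
   (@scoh_sym _ _) (@scoh_sym _ _) (@scoh_sym _ _) _ _ (in_addp _ _ _ q1) (in_addp _ _ _ q2)
   _ _ _ cy py qy cz pz qz).
- by apply: (nc _ _ _ (sleaves (F :: K2))) q1; rewrite -(perm_uniq p).
- by apply: (nc _ _ _ (sleaves (A :: K1))) q2; rewrite -(perm_uniq p').
- by move=> l m /= /o1 h /o1 h'; rewrite e1.
- by move=> l m /= /o2 h /o2 h'; rewrite e2.
by move=> l m /= /o1 h /o2 h'; rewrite e12.
Qed.

(** By [cyclic_addp], dropping the coherences between [P] and [Q] cannot create a chordless
    cycle. *)
Lemma correct_addp G G' (P Q : pred leaf) : correct G -> perm_eq (sleaves G) (sleaves G') ->
  addp (scoh G') P Q =2 scoh G ->
  (forall l m, scoh G' l m -> P l -> P m) ->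
  (forall l m, scoh G' l m -> Q l -> Q m \/ forall q, Q q -> scoh G' q m) ->
  (forall l, P l -> ~~ Q l) -> correct G'.
Proof.
move=> g p e hP hQ hPQ; apply: correct_leaves g p _ => b.
by apply: cyclic_eq e _; apply: cyclic_addp b => //; apply: scoh_sym.
Qed.

Lemma perm_split2 A B G (R : seq fm -> seq fm -> Prop) :
  (forall H K, R H K -> R K H) ->
  forall H K, perm_eq (A :: B :: G) (H ++ K) -> R H K -> exists H K, R H K /\
    ((exists M, perm_eq H (A :: B :: M) /\ perm_eq G (M ++ K)) \/
     (exists M M', [/\ perm_eq H (A :: M), perm_eq K (B :: M') & perm_eq G (M ++ M')])).
Proof.
move=> sR H K; rewrite perm_sym => p r.
wlog [M p1 p2] : H K p r / exists2 M, perm_eq H (A :: M) & perm_eq (B :: G) (M ++ K).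
  move=> h; case: (perm_cons_cat p) => -[M p1 p2]; first by apply: h p r _; exists M.
  by apply: (h K H); [perm_lia|exact: sR|exists M => //; perm_lia].
exists H, K; split=> //; rewrite perm_sym in p2.
case: (perm_cons_cat p2) => -[M' p3 p4]; [left; exists M'|right; exists M, M'];
  split=> //; perm_lia.
Qed.

Definition provable_below n := forall G, G != [::] -> ssize G < n -> correct G -> der G.
Definition parfree G := all (fun A => ~~ is_par A) G.

Lemma parfree_par G A B H : perm_eq G (Par A B :: H) -> ~~ parfree G.
Proof. by move=> p; rewrite /parfree (perm_all _ p). Qed.

Lemma scoh_root A G l m : uniq (sleaves G) -> A \in G -> scoh G l m ->
  l \in leaves A -> m \in leaves A.
Proof.
move=> u /perm_to_rem p; rewrite (scoh_perm p) scoh_cons => /orP[/coh_mem[]//|c] lA.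
move: u; rewrite (perm_uniq (sleaves_perm p)) sleaves_cons cat_uniq => /and3P[_ /hasPn h _].
by case/scoh_mem: c => /h; rewrite /= lA.
Qed.

Lemma sleaves_disjoint A B G l : uniq (sleaves (A :: B :: G)) ->
  l \in leaves A -> l \notin leaves B.
Proof.
rewrite !sleaves_cons cat_uniq => /and3P[_ /hasPn h _] lA; apply: contraL lA => lB.
by apply: h; rewrite mem_cat lB.
Qed.

Ltac part_of IH g K d :=
  apply: IH; [by [] | ssize_lia | apply: (correct_part (K := K) g);
    [ sperm | apply: closed_perm (der_closed d); sperm | agree ]].

Lemma conj_sym (S T : Prop) : S /\ T -> T /\ S. Proof. by case. Qed.

(** The cycle has length 1: the two ends of a link are themselves coherent. *)
Lemma cyclic_axiom b x Y : tens_of Y (Lit b x) (Lit (~~ b) x) -> cyclic (scoh [:: Y]).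
Proof.
move=> tY; have c l m : scoh [:: Y] l m =
    (l == (b, x)) && (m == (~~ b, x)) || (l == (~~ b, x)) && (m == (b, x)).
  by rewrite scoh_cons (coh_tens_of tY) /= !inE orbF.
exists 1, (fun=> (b, x)); split=> // [i|i j|i j|[|i] [|j]] //; rewrite ?c /conj /=.
- by rewrite !eqxx.
- by move=> _ _; rewrite !xpair_eqE !eqxx; case: b {c tY}.
by move=> _ _; rewrite !xpair_eqE !eqxx; case: b {c tY}.
Qed.

(** The last rule produces [A] from [E] and [F], say with [B] on the side of [E]. The smaller tensor
    [Tens E B] is derivable there, and replacing its introduction by those of [A] and [Y] puts [F]
    back. *)
Lemma base_root Y A B G E F H K : provable_below (ssize (Y :: G)) -> correct (Y :: G) ->
  tens_of Y A B -> tens_of A E F -> perm_eq (B :: G) (H ++ K) ->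
  der (E :: H) -> der (F :: K) -> der (Y :: G).
Proof.
move=> IH g tY tA; rewrite perm_sym => p dE dF.
wlog [M p1 p2] : E F H K tA p dE dF / exists2 M, perm_eq H (B :: M) & perm_eq G (M ++ K).
  move=> h; case: (perm_cons_cat p) => -[M p1 p2]; first by apply: h tA p dE dF _; exists M.
  by apply: (h F E K H) => //; [exact: tens_ofC|perm_lia|exists M => //; perm_lia].
have d : der (Tens E B :: M) by part_of IH g (F :: K) dE.
have h : der ([:: Y & K] ++ M).
  apply: (tens_inv d) (perm_refl _) _ _ => L1 L2 d1 d2.
  have d3 := der_tens_of tA d1 dF.
  apply: der_perm (der_tens_of tY d3 d2); perm_lia.
apply: der_perm h; perm_lia.
Qed.

Lemma correct_tens A B G : correct (A :: B :: G) ->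
  ~ cyclic (addp (scoh (A :: B :: G)) (mem (leaves A)) (mem (leaves B))) ->
  correct (Tens A B :: G).
Proof.
move=> g nb; apply: correct_leaves g _ _; first by sperm.
by move=> b; case: nb; apply: cyclic_eq b => l m; rewrite /addp !scoh_cons /=; bool_cases.
Qed.

Definition splits X H K := exists E F, [/\ tens_of X E F, der (E :: H) & der (F :: K)].

Lemma splits_sym X H K : splits X H K -> splits X K H.
Proof. by case=> E [F [t d e]]; exists F, E; split=> //; apply: tens_ofC. Qed.

Variant last_rule A B G : Prop :=
  | LastAxiom x of perm_eq (A :: B :: G) [:: Lit true x; Lit false x]
  | LastMixL M K of perm_eq G (M ++ K) & der (A :: B :: M) & der K
  | LastMix M K of perm_eq G (M ++ K) & der (A :: M) & der (B :: K)
  | LastTensA E F H K of tens_of A E F & perm_eq (B :: G) (H ++ K)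
      & der (E :: H) & der (F :: K)
  | LastTensB E F H K of tens_of B E F & perm_eq (A :: G) (H ++ K)
      & der (E :: H) & der (F :: K)
  | LastTensL X E F M K of tens_of X E F & perm_eq G (X :: M ++ K)
      & der (E :: A :: B :: M) & der (F :: K)
  | LastTens X E F M K of tens_of X E F & perm_eq G (X :: M ++ K)
      & der (E :: A :: M) & der (F :: B :: K).

Lemma der_last2 A B G : parfree (A :: B :: G) -> der (A :: B :: G) -> last_rule A B G.
Proof.
move=> nP /der_last[[x]|[H [K [q dH dK]]]|[X [E [F [H [K [tX q dE dF]]]]]]|[C [D [H [q _]]]]].
- exact: LastAxiom.
- have [H1 [K1 [[{}dH {}dK] [[M [p1 p2]]|[M [M' [p1 p2 p3]]]]]]] :=
    perm_split2 (R := fun H K => der H /\ der K)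
      (fun H K => @conj_sym _ _) q (Logic.conj dH dK).
    exact: LastMixL p2 (der_perm p1 dH) dK.
  exact: LastMix p3 (der_perm p1 dH) (der_perm p2 dK).
- case: (perm_cons_cons q) => [[e q']|[l q' q'']].
    by subst X; apply: LastTensA tX q' dE dF.
  case: (perm_cons_cons q') => [[e q2]|[G' q2 q3]].
    subst X; apply: LastTensB tX _ dE dF; perm_lia.
  have q4 : perm_eq (A :: B :: G') (H ++ K) by perm_lia.
  have [H1 [K1 [[E1 [F1 [t d e]]] [[M [p1 p2]]|[M [M' [p1 p2 p3]]]]]]] :=
    perm_split2 (R := splits X) (@splits_sym X) q4
      (ex_intro _ E (ex_intro _ F (And3 tX dE dF))).
    by apply: (LastTensL (M := M) t _ _ e); [|apply: der_perm d]; perm_lia.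
  apply: (LastTens (M := M) (K := M') t _ (der_perm _ d) (der_perm _ e)); perm_lia.
by have := parfree_par q; rewrite nP.
Qed.

(** Without the tensor, [A] and [B] belong to a smaller correct sequent, and the last rule of a
    derivation of it is examined. The hard case is a root tensor [X] that separates [A] from [B]: by
    [correct_split] one of [Tens A E] and [Tens F B] may be formed, and [tens_inv] trades its
    introduction for those of [X] and [Y]. *)
Lemma base_case Y A B G : provable_below (ssize (Y :: G)) -> tens_of Y A B ->
  parfree (A :: B :: G) -> correct (Y :: G) -> der (Y :: G).
Proof.
move=> IH tY nP g; have [u cl nb] := g.
have p : perm_eq (sleaves (Y :: G)) (sleaves (A :: B :: G)) by sperm.
have u' : uniq (sleaves (A :: B :: G)) by rewrite -(perm_uniq p).
have g' : correct (A :: B :: G).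
  apply: (correct_addp (P := mem (leaves A)) (Q := mem (leaves B)) g p).
  - by move=> l m; rewrite /addp ?scoh_cons (coh_tens_of tY) /=; bool_cases.
  - by move=> l m; apply: scoh_root u' _; rewrite mem_head.
  - by move=> l m c lB; left; apply: scoh_root u' _ c lB; rewrite !inE eqxx orbT.
  by move=> l; apply: sleaves_disjoint u'.
have dAB : der (A :: B :: G) by apply: IH => //; ssize_lia.
case: (der_last2 nP dAB) => [x q|M K q dH dK|M K q dH dK|E F H K tA q dE dF
  |E F H K tB q dE dF|X E F M K tX q dE dF|X E F M K tX q dE dF].
- have G0 : G = [::] by have := perm_size q; case: (G).
  subst G; case: nb; case: (perm_cons_cons q) => [[e q']|[l q' q'']].
    have [e'|[? _ /perm_size //]] := perm_cons_cons q'.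
    by subst A; case: e' => e' _; subst B; apply: cyclic_axiom tY.
  have l0 : l = [::] by have := perm_size q''; case: (l).
  subst l; have [[e _]|[? _ /perm_size //]] := perm_cons_cons q''.
  have [[e' _]|[? _ /perm_size //]] := perm_cons_cons q'.
  by subst A B; apply: cyclic_axiom tY.
- have k0 := ssize_gt0 (sleaves_nonempty (der_nonempty dK)).
  have h : der (Y :: M) by part_of IH g K dH.
  apply: der_perm (der_mix h dK); perm_lia.
- apply: der_perm (der_tens_of tY dH dK); perm_lia.
- exact: base_root IH g tY tA q dE dF.
- exact: base_root IH g (tens_ofC tY) tB q dE dF.
- have h : der (Y :: E :: M) by part_of IH g (F :: K) dE.
  have h' : der (E :: Y :: M) by apply: der_perm h; perm_lia.
  apply: der_perm (der_tens_of tX h' dF); perm_lia.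
have gA : correct (A :: E :: M).
  apply: (correct_part (K := F :: B :: K) g);
    [sperm|apply: closed_perm (der_closed dE); sperm|agree].
have gB : correct (F :: B :: K).
  apply: (correct_part (K := A :: E :: M) g);
    [sperm|apply: closed_perm (der_closed dF); sperm|agree].
have [] : ~ cyclic (addp (scoh (A :: E :: M)) (mem (leaves A)) (mem (leaves E))) \/
          ~ cyclic (addp (scoh (F :: B :: K)) (mem (leaves F)) (mem (leaves B))).
  apply: (correct_split g); [sperm| | |by case: gA|by case: gB|agree|agree|agree].
  + by move=> m /= h; rewrite sleaves_cons mem_cat h.
  + by move=> m /= h; rewrite sleaves_cons mem_cat h.
- move=> nbad; have d : der (Tens A E :: M).
    apply: IH => //; first by ssize_lia.
    exact: correct_tens gA nbad.
  have h : der ([:: X, Y & K] ++ M).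
    apply: (tens_inv d) (perm_refl _) _ _ => L1 L2 d1 d2.
    have d3 := der_tens_of tX d2 dF.
    have d4 : der (B :: X :: L2 ++ K) by apply: der_perm d3; perm_lia.
    apply: der_perm (der_tens_of tY d1 d4); perm_lia.
  apply: der_perm h; perm_lia.
move=> nbad; have d : der (Tens F B :: K).
  apply: IH => //; first by ssize_lia.
  exact: correct_tens gB nbad.
have h : der ([:: X, Y & M] ++ K).
  apply: (tens_inv d) (perm_refl _) _ _ => L1 L2 d1 d2.
  have d3 := der_tens_of tX dE d1.
  have d4 : der (A :: X :: M ++ L1) by apply: der_perm d3; perm_lia.
  apply: der_perm (der_tens_of tY d4 d2); perm_lia.
apply: der_perm h; perm_lia.
Qed.

Lemma par_left C D B G E F H K :
  provable_below (ssize (Tens (Par C D) B :: G)) -> correct (Tens (Par C D) B :: G) ->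
  tens_of C E F -> perm_eq (Tens D B :: G) (H ++ K) ->
  der (E :: H) -> der (F :: K) -> der (Tens (Par C D) B :: G).
Proof.
move=> IH g tC; rewrite perm_sym => p dE dF.
wlog [M p1 p2] : E F H K tC p dE dF /
    exists2 M, perm_eq H (Tens D B :: M) & perm_eq G (M ++ K).
  move=> h; case: (perm_cons_cat p) => -[M p1 p2]; first by apply: h tC p dE dF _; exists M.
  by apply: (h F E K H) => //; [exact: tens_ofC|perm_lia|exists M => //; perm_lia].
have d : der (Tens (Par E D) B :: M) by part_of IH g (F :: K) dE.
have h : der ([:: Tens (Par C D) B & K] ++ M).
  apply: (tens_inv d) (perm_refl _) _ _ => L1 L2 d1 d2.
  have d3 := der_tens_of tC (par_inv d1 (perm_refl _)) dF.
  apply: der_perm (der_tens (der_par d3) d2); perm_lia.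
apply: der_perm h; perm_lia.
Qed.

Lemma par_right C D B G E F H K :
  provable_below (ssize (Tens (Par C D) B :: G)) -> correct (Tens (Par C D) B :: G) ->
  tens_of (Tens D B) E F -> perm_eq (C :: G) (H ++ K) ->
  der (E :: H) -> der (F :: K) -> der (Tens (Par C D) B :: G).
Proof.
move=> IH g t; rewrite perm_sym => p dE dF.
wlog [eE eF] : E F H K p dE dF {t} / E = D /\ F = B.
  move=> h; case: t => -[eD eB]; subst E F; first exact: h p dE dF _.
  apply: (h D B K H) => //; perm_lia.
subst E F; case: (perm_cons_cat p) => -[M p1 p2].
  have d : der (C :: D :: M) by apply: der_perm dE; perm_lia.
  apply: der_perm (der_tens (der_par d) dF); perm_lia.
(* [C] went to the side of [B]. The two are coherent in the goal, so [Tens B C :: M] is correct as a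
   part of it; [D] is then brought in by mix. *)
have d : der (Tens B C :: M).
  by apply: IH; [by [] | ssize_lia | apply: (correct_part (K := D :: H) g);
    [ sperm | apply: closed_perm (der_closed dF); sperm | agree ]].
have h : der ((Tens (Par C D) B :: H) ++ M).
  apply: (tens_inv d) (perm_refl _) _ _ => L1 L2 d1 d2.
  have d3 : der (C :: D :: L2 ++ H) by apply: der_perm (der_mix d2 dE); perm_lia.
  apply: der_perm (der_tens (der_par d3) d1); perm_lia.
apply: der_perm h; perm_lia.
Qed.

(** Relies on the linear distribution of [(C ⅋ D) ⊗ B] into [C ⅋ (D ⊗ B)]: the sequent with [C] and
    [D ⊗ B] has one connective less and loses just the coherences between [C] and [B]. The last rule
    of its derivation decides how the par is restored. *)
Lemma par_base C D B G : provable_below (ssize (Tens (Par C D) B :: G)) ->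
  parfree (C :: G) -> correct (Tens (Par C D) B :: G) -> der (Tens (Par C D) B :: G).
Proof.
move=> IH nP g; have [u cl nb] := g.
have dCT : der (C :: Tens D B :: G).
  apply: IH => //; first by ssize_lia.
  have p : perm_eq (sleaves (Tens (Par C D) B :: G)) (sleaves (C :: Tens D B :: G)) by sperm.
  have u' : uniq (sleaves (C :: Tens D B :: G)) by rewrite -(perm_uniq p).
  apply: (correct_addp (P := mem (leaves C)) (Q := mem (leaves B)) g p).
  - by move=> l m; rewrite /addp ?scoh_cons /= !mem_cat; bool_cases.
  - by move=> l m; apply: scoh_root u' _; rewrite mem_head.
  - move=> l m c /= lB; have : m \in leaves (Tens D B).
      by apply: scoh_root u' _ c _; rewrite ?inE ?eqxx ?orbT //= mem_cat lB orbT.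
    rewrite /= mem_cat => /orP[mD|]; [right|by left].
    by move=> q qB; rewrite !scoh_cons /= mD qB !orbT.
  move=> l lC; apply/negP => /= lB; have := sleaves_disjoint u' lC.
  by rewrite /= mem_cat lB orbT.
case: (der_last2 (nP : parfree (C :: Tens D B :: G)) dCT) => [x q|M K q dH dK|M K q dH dK
  |E F H K tC q dE dF|E F H K tT q dE dF|X E F M K tX q dE dF|X E F M K tX q dE dF].
- by have := perm_mem q (Tens D B); rewrite !inE eqxx orbT.
- have k0 := ssize_gt0 (sleaves_nonempty (der_nonempty dK)).
  have h : der (Tens (Par C D) B :: M) by part_of IH g K dH.
  apply: der_perm (der_mix h dK); perm_lia.
- have h : der ((Tens (Par C D) B :: M) ++ K).
    apply: (tens_inv dK) (perm_refl _) _ _ => L1 L2 d1 d2.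
    have d3 : der (C :: D :: M ++ L1) by apply: der_perm (der_mix dH d1); perm_lia.
    apply: der_perm (der_tens (der_par d3) d2); perm_lia.
  apply: der_perm h; perm_lia.
- exact: par_left IH g tC q dE dF.
- exact: par_right IH g tT q dE dF.
- have h : der (Tens (Par C D) B :: E :: M) by part_of IH g (F :: K) dE.
  have h' : der (E :: Tens (Par C D) B :: M) by apply: der_perm h; perm_lia.
  apply: der_perm (der_tens_of tX h' dF); perm_lia.
have gC : correct (C :: E :: M).
  apply: (correct_part (K := F :: Tens D B :: K) g);
    [sperm|apply: closed_perm (der_closed dE); sperm|agree].
have gT : correct (F :: Tens D B :: K).
  apply: (correct_part (K := C :: E :: M) g);
    [sperm|apply: closed_perm (der_closed dF); sperm|agree].
have [] : ~ cyclic (addp (scoh (C :: E :: M)) (mem (leaves C)) (mem (leaves E))) \/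
          ~ cyclic (addp (scoh (F :: Tens D B :: K)) (mem (leaves F)) (mem (leaves B))).
  apply: (correct_split g); [sperm| | |by case: gC|by case: gT|agree|agree|agree].
  + by move=> m /= h; rewrite sleaves_cons mem_cat h.
  + by move=> m /= h; rewrite sleaves_cons mem_cat /= mem_cat h orbT.
- move=> nbad; have d : der (Tens C E :: M).
    apply: IH => //; first by ssize_lia.
    exact: correct_tens gC nbad.
  have h : der ([:: X, Tens (Par C D) B & K] ++ M).
    apply: (tens_inv d) (perm_refl _) _ _ => L1 L2 d1 d2.
    have d3 := der_tens_of tX d2 dF.
    have h : der ((Tens (Par C D) B :: L1) ++ (X :: L2 ++ K)).
      apply: (tens_inv d3); first by perm_lia.
      move=> M1 M2 d4 d5.
      have d6 : der (C :: D :: L1 ++ M1) by apply: der_perm (der_mix d1 d4); perm_lia.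
      apply: der_perm (der_tens (der_par d6) d5); perm_lia.
    apply: der_perm h; perm_lia.
  apply: der_perm h; perm_lia.
move=> nbad; have d : der (Tens (Par F D) B :: K).
  apply: IH => //; first by ssize_lia.
  apply: correct_leaves gT _ _; [by sperm|move=> b; case: nbad; apply: cyclic_eq b => l m].
  by rewrite /addp !scoh_cons /= !mem_cat; bool_cases.
have h : der ([:: X, Tens (Par C D) B & M] ++ K).
  apply: (tens_inv d) (perm_refl _) _ _ => L1 L2 d1 d2.
  have d3 := der_tens_of tX dE (par_inv d1 (perm_refl _)).
  have d4 : der (C :: D :: X :: M ++ L1) by apply: der_perm d3; perm_lia.
  apply: der_perm (der_tens (der_par d4) d2); perm_lia.
apply: der_perm h; perm_lia.
Qed.

(* Reassociating [Par (Par E F) D] to [Par E (Par F D)] keeps the size, so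
   [C] is decomposed by an induction inside the one on the size. *)
Lemma par_case n C : provable_below n -> forall D B G,
  ssize (Tens (Par C D) B :: G) = n -> parfree G -> correct (Tens (Par C D) B :: G) ->
  der (Tens (Par C D) B :: G).
Proof.
move=> IH; elim: C => [b x|E _ F _|E IHE F _] D B G sz nG g.
- by apply: par_base => //; rewrite sz.
- by apply: par_base => //; rewrite sz.
have d : der (Tens (Par E (Par F D)) B :: G).
  apply: IHE => //; first by move: sz; rewrite !ssize_cons /=; lia.
  apply: correct_leaves g _ _; first by sperm.
  by apply: cyclic_eq => l m; rewrite !scoh_cons /= !mem_cat !orbA.
have h : der ([:: Tens (Par (Par E F) D) B] ++ G).
  apply: (tens_inv d) (perm_refl _) _ _ => L1 L2 d1 d2.
  have d3 : der (F :: D :: E :: L1).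
    apply: (par_inv (par_inv d1 (perm_refl _))); perm_lia.
  have d4 : der (E :: F :: D :: L1) by apply: der_perm d3; perm_lia.
  apply: der_perm (der_tens (der_par (der_par d4)) d2); perm_lia.
exact: h.
Qed.

Lemma tens_case A B G : provable_below (ssize (Tens A B :: G)) -> parfree G ->
  correct (Tens A B :: G) -> der (Tens A B :: G).
Proof.
move=> IH nG g; have [/negPf nA|] := boolP (~~ is_par A); last first.
  by rewrite negbK; case: A IH g => // C D IH g _; apply: par_case IH _ _ _ erefl nG g.
have [/negPf nB|] := boolP (~~ is_par B); last first.
  rewrite negbK; case: B IH g => // C D IH g _.
  have d : der (Tens (Par C D) A :: G).
    apply: (par_case IH) nG _; first by rewrite !ssize_cons /=; lia.
    apply: correct_leaves g _ _; first by sperm.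
    by apply: cyclic_eq => l m; rewrite !scoh_cons /= !mem_cat; bool_cases.
  have h : der ([:: Tens A (Par C D)] ++ G).
    apply: (tens_inv d) (perm_refl _) _ _ => L1 L2 d1 d2.
    apply: der_perm (der_tens d2 d1); perm_lia.
  exact: h.
by apply: base_case IH (or_introl erefl) _ g; rewrite /parfree /= nA nB.
Qed.

Definition is_tens A := if A is Tens _ _ then true else false.

Lemma literal_leaves G : parfree G -> ~~ has is_tens G ->
  G = [seq Lit l.1 l.2 | l <- sleaves G].
Proof. by elim: G => //= -[b x||] //= G IH nP nT; rewrite {1}IH. Qed.

Theorem sequentialization G : G != [::] -> correct G -> der G.
Proof.
move: {2}(ssize G).+1 (ltnSn (ssize G)) => n; elim: n G => // n IHn G sz G0 g.
have IH : provable_below (ssize G).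
  by move=> H H0 szH gH; apply: IHn => //; apply: leq_trans szH _.
have [nP|] := boolP (parfree G); last first.
  case/allPn => -[||A B] // /perm_to_rem p _; set H := rem _ _ in p.
  have d : der (A :: B :: H).
    apply: IH => //; first by ssize_lia.
    apply: correct_leaves g _ _; first by sperm.
    by apply: cyclic_eq => l m; rewrite (scoh_perm p) !scoh_cons /= orbA.
  by apply: der_perm (der_par d); rewrite perm_sym.
have [|nT] := boolP (has is_tens G).
  case/hasP => -[|A B|] // /perm_to_rem p _; set H := rem _ _ in p.
  apply: (der_perm (G := Tens A B :: H)); first by rewrite perm_sym.
  apply: tens_case; [by rewrite -(ssize_perm p)| |exact: correct_perm p g].
  by move: nP; rewrite /parfree (perm_all _ p).
(* Only literals are left, so one link is split off as an axiom and mixed with the rest. *)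
have eG := literal_leaves nP nT; have [u c nb] := g.
have mG l : l \in sleaves G -> Lit l.1 l.2 \in G by move=> h; rewrite eG; apply: map_f.
have [x xG] : exists x, (true, x) \in sleaves G.
  have: 0 < size (sleaves G) by apply: sleaves_nonempty.
  case e : (sleaves G) => [//|[b x] s] _; exists x.
  have h : (b, x) \in sleaves G by rewrite e mem_head.
  by rewrite -e; case: b h {e} => // h; have := allP c _ h.
have xG' : (false, x) \in sleaves G by have := allP c _ xG.
have p1 := perm_to_rem (mG _ xG); set H1 := rem _ _ in p1.
have p2 : perm_eq H1 (Lit false x :: rem (Lit false x) H1).
  by apply: perm_to_rem; have := mG _ xG'; rewrite (perm_mem p1) inE.
set H := rem _ _ in p2.
have p : perm_eq G ([:: Lit true x; Lit false x] ++ H) by perm_lia.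
have [H0|H0] := eqVneq H [::].
  by apply: der_perm (der_ax x); rewrite perm_sym; rewrite H0 in p.
have dH : der H.
  apply: IH => //; first by ssize_lia.
  have pl : perm_eq (sleaves G) (sleaves H ++ sleaves [:: Lit true x; Lit false x]).
    by sperm.
  apply: (correct_part g pl); last by agree.
  apply/allP => l lH; have lG : l \in sleaves G by rewrite (perm_mem pl) mem_cat lH.
  have := allP c _ lG; rewrite (perm_mem pl) mem_cat => /orP[//|h].
  have := notin_perm u pl lH; case: l h {lH lG} => b y; rewrite /sleaves /= !inE /conj /=.
  by rewrite !xpair_eqE; case: b => /=; rewrite ?orbF => -> //; rewrite orbT.
apply: der_perm (der_mix (der_ax x) dH); perm_lia.
Qed.

End Sequentialization.

Lemma coh_parl N (A : formula (link N)) G : coh (parl A G) =2 scoh (A :: G).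
Proof.
elim: G A => [|B G IH] A l m /=; first by rewrite scoh_cons orbF.
by rewrite IH.
Qed.

(** * Derivations are acyclic under every switching *)

Section Graphs.
Implicit Types (e : rel vertex) (c : seq vertex) (S : pred vertex).

Lemma cycle_class e S c : cycle e c ->
  (forall v w, v \in c -> w \in c -> e v w -> S v = S w) ->
  all S c \/ all (predC S) c.
Proof.
case: c => [|x c] /=; first by left.
rewrite rcons_path => /andP[p _] h.
have {}h : all (fun v => S v == S x) c.
  have {h}: forall v w, v \in x :: c -> w \in x :: c -> e v w -> S v = S w by [].
  elim: c x p => //= y c IH x /andP[xy p] h.
  have exy : S y = S x by symmetry; apply: h xy; rewrite ?inE ?eqxx ?orbT.
  rewrite exy eqxx /=; rewrite -exy; apply: IH => // v w vc wc.
  by apply: h; rewrite inE ?vc ?wc orbT.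
case Sx : (S x); [left|right]; apply/andP; split=> //;
  by apply: sub_all h => v /eqP; rewrite /= Sx => ->.
Qed.

Lemma acyclic_root e r S : symmetric e ->
  (forall v w, v != r -> w != r -> e v w -> S v = S w) ->
  (forall u w, e r u -> e r w -> S u = S w -> u = w) ->
  (forall c, 2 < size c -> cycle e c -> uniq c -> r \notin c ->
     all S c \/ all (predC S) c -> False) ->
  acyclic e.
Proof.
move=> sym eS er h c sz; apply/negP => /andP[cyc u].
have [rc|rc] := boolP (r \in c); last first.
  apply: (h c) => //; apply: cycle_class cyc _ => v w vc wc; apply: eS.
    by apply: contraNneq rc => <-.
  by apply: contraNneq rc => <-.
have [i c' ec] := rot_to rc.
have {}cyc : cycle e (r :: c') by rewrite -ec rot_cycle.
have {}u : uniq (r :: c') by rewrite -ec rot_uniq.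
have {}sz : 1 < size c' by rewrite -ltnS -[(size c').+1]/(size (r :: c')) -ec size_rot.
case: c' cyc u sz {ec} => [//|a c'] /=; rewrite rcons_path => /and3P[ra p lr] /and3P[nr na uc] sz.
have nr' v : v \in a :: c' -> v != r by apply: contraTneq => ->.
have {h p}Sl : S (last a c') = S a.
  have {h}: forall v w, v \in a :: c' -> w \in a :: c' -> e v w -> S v = S w.
    by move=> v w /nr' hv /nr' hw; apply: eS.
  elim: c' a p {nr na uc sz ra lr nr'} => //= b c' IH a /andP[ab p] h.
  rewrite IH //; first by symmetry; apply: h ab; rewrite !inE eqxx ?orbT.
  by move=> v w hv hw; apply: h; rewrite inE ?hv ?hw orbT.
have e' : last a c' = a by apply: er Sl => //; rewrite sym.
case: c' na sz e' {uc nr lr nr' Sl} => // b c' na _ /= e'.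
by move: na; rewrite -e' mem_last.
Qed.

End Graphs.

Section Vertices.
Variable N : nat.
Local Notation fm := (formula (link N)).
Implicit Types (A B : fm) (G H : seq fm) (u v w : vertex) (s : vertex -> bool).

Lemma axiom_edge_sym G : symmetric (axiom_edge G).
Proof.
move=> v w; rewrite /axiom_edge.
case: (at_vertex G v) => [[b x||]|]; case: (at_vertex G w) => [[c y||]|] //.
by rewrite eq_sym [x == y]eq_sym; case: b; case: c.
Qed.

Lemma switching_edge_sym s G : symmetric (switching_edge s G).
Proof. by move=> v w; rewrite /switching_edge axiom_edge_sym !orbA [arg_edge _ _ _ _ || _]orbC. Qed.

Lemma at_vertex_lt G v A : at_vertex G v = Some A -> v.1 < size G.
Proof.
rewrite /at_vertex; case: v => i p /=.
by elim: G i => [|B G IH] [|i] //=; apply: IH.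
Qed.

Lemma switching_edge_lt s G v w : switching_edge s G v w -> v.1 < size G.
Proof.
have arg v' w' : arg_edge s G v' w' -> v'.1 < size G /\ w'.1 = v'.1.
  rewrite /arg_edge; case e : (at_vertex G v') => [[|A B|A B]|] //; have := at_vertex_lt e.
    by move=> l /orP[] /eqP ->.
  by move=> l /eqP ->.
case/or3P=> [/arg[]//|/arg[l ->]//|].
by rewrite /axiom_edge; case e : (at_vertex G v) => [[]|] // _; apply: at_vertex_lt e.
Qed.

(** A root of [G] may become an inner vertex of [G'], which is why paths are required only to extend
    in the same way. *)
Definition embeds G G' (g : vertex -> vertex) : Prop :=
  [/\ injective g,
      forall u b, g (u.1, rcons u.2 b) = ((g u).1, rcons (g u).2 b)
    & forall u, u.1 < size G -> at_vertex G' (g u) = at_vertex G u].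

Lemma embeds_edge G G' g s u w : embeds G G' g -> u.1 < size G -> w.1 < size G ->
  switching_edge s G' (g u) (g w) = switching_edge (s \o g) G u w.
Proof.
move=> [gI gr ga] hu hw; rewrite /switching_edge /arg_edge /axiom_edge !ga //.
rewrite -!gr !(inj_eq gI).
by case: (at_vertex G u) => [[]|] //; case: (at_vertex G w) => [[]|].
Qed.

Lemma embeds_acyclic G G' g s c : embeds G G' g -> acyclic (switching_edge (s \o g) G) ->
  2 < size c -> cycle (switching_edge s G') c -> uniq c ->
  (forall v, v \in c -> exists2 u, u.1 < size G & v = g u) -> False.
Proof.
move=> gE ac sz cyc uc im; have [gI _ _] := gE.
have [c' ec ac'] : exists2 c', c = map g c' & all (fun u => u.1 < size G) c'.
  elim: c im {sz cyc uc} => [|v c IH] im; first by exists [::].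
  have [u hu ->] := im v (mem_head _ _).
  case: IH => [w wc|c' -> hc']; first by apply: im; rewrite inE wc orbT.
  by exists (u :: c') => //=; rewrite hu.
subst c; have := ac c'; rewrite size_map in sz => /(_ sz).
rewrite -(map_inj_uniq gI) uc andbT; case/negP.
rewrite cycle_map in cyc.
by apply: (sub_in_cycle _ ac' cyc) => u w hu hw /=; rewrite /= (embeds_edge _ gE).
Qed.

Lemma subformula_leaves A p B : subformula A p = Some B -> {subset leaves B <= leaves A}.
Proof.
elim: A p => [b x|A1 IH1 A2 IH2|A1 IH1 A2 IH2] [|c p] //=; try by case=> <-.
  by case: c => /= [/IH2|/IH1] h l /h; rewrite mem_cat => ->; rewrite ?orbT.
by case: c => /= [/IH2|/IH1] h l /h; rewrite mem_cat => ->; rewrite ?orbT.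
Qed.

Lemma at_vertex_leaves G v A : at_vertex G v = Some A -> {subset leaves A <= sleaves G}.
Proof.
rewrite /at_vertex; case: v => i p /=.
elim: G i => [|B G IH] [|i] //=; rewrite ?sleaves_cons.
  by move=> /subformula_leaves h l /h; rewrite mem_cat => ->.
by move=> /IH h l /h; rewrite mem_cat => ->; rewrite orbT.
Qed.

Lemma onth_cat_l G H i : i < size G -> onth (G ++ H) i = onth G i.
Proof. by elim: G i => [|A G IH] [|i] //=; apply: IH. Qed.

Lemma onth_cat_r G H i : onth (G ++ H) (size G + i) = onth H i.
Proof. by elim: G. Qed.

Section Join.
(** [r] is the vertex created by the rule and [S] tells the two premises apart. As the links of [G1]
    stay inside [G1], the premises can be connected through [r] only. *)
Variables (G1 G2 G : seq fm) (g1 g2 : vertex -> vertex) (r : vertex) (S : pred vertex).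
Variable s : vertex -> bool.
Hypotheses (E1 : embeds G1 G g1) (E2 : embeds G2 G g2).
Hypothesis S1 : forall u, u.1 < size G1 -> S (g1 u).
Hypothesis S2 : forall u, u.1 < size G2 -> S (g2 u) = false.
Hypothesis cover : forall v, v.1 < size G -> v != r ->
  (exists2 u, u.1 < size G1 & v = g1 u) \/ (exists2 u, u.1 < size G2 & v = g2 u).
Hypothesis uG : uniq (sleaves G1 ++ sleaves G2).
Hypothesis cG1 : closed_leaves (sleaves G1).

Lemma join_separate u w : u.1 < size G1 -> w.1 < size G2 ->
  switching_edge s G (g1 u) (g2 w) = false.
Proof.
move=> hu hw; have [gI1 gr1 ga1] := E1; have [gI2 gr2 ga2] := E2.
have ne u' w' : u'.1 < size G1 -> w'.1 < size G2 -> (g1 u' == g2 w') = false.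
  by move=> h1 h2; apply/eqP => e; have := S2 h2; rewrite -e S1.
apply/negP => /or3P[].
- rewrite /arg_edge; case: (at_vertex _ _) => [[|A B|A B]|] //.
    by rewrite -!gr1 => /orP[]; rewrite eq_sym ne.
  by rewrite -!gr1; rewrite eq_sym ne.
- rewrite /arg_edge; case: (at_vertex _ _) => [[|A B|A B]|] //.
    by rewrite -!gr2 => /orP[]; rewrite ne.
  by rewrite -!gr2; rewrite ne.
rewrite /axiom_edge ga1 // ga2 //.
case e1 : (at_vertex G1 u) => [[b x||]|] //; case e2 : (at_vertex G2 w) => [[c y||]|] //.
case/andP=> /eqP ec /eqP ey; subst c y.
have h1 : (b, x) \in sleaves G1 by apply: (at_vertex_leaves e1); rewrite mem_head.
have h2 : (~~ b, x) \in sleaves G2 by apply: (at_vertex_leaves e2); rewrite mem_head.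
have h3 : (~~ b, x) \in sleaves G1 by have := allP cG1 _ h1.
by have := notin_perm uG (perm_refl _) h3; rewrite h2.
Qed.

Lemma acyclic_join : acyclic (switching_edge (s \o g1) G1) ->
  acyclic (switching_edge (s \o g2) G2) ->
  (forall u w, switching_edge s G r u -> switching_edge s G r w -> S u = S w -> u = w) ->
  acyclic (switching_edge s G).
Proof.
move=> ac1 ac2 hr; apply: (acyclic_root (r := r) (S := S) (switching_edge_sym s G)) => //.
  move=> v w nv nw e; have lv := switching_edge_lt e.
  have lw : w.1 < size G by apply: (@switching_edge_lt s G w v); rewrite switching_edge_sym.
  case: (cover lv nv) (cover lw nw) => -[u hu eu] [] [u' hu' eu']; subst v w;
    rewrite ?(S1 hu) ?(S1 hu') ?(S2 hu) ?(S2 hu') //.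
    by rewrite join_separate in e.
  by rewrite switching_edge_sym join_separate in e.
move=> c sz cyc u nr Sc; have cov v : v \in c ->
    (exists2 u, u.1 < size G1 & v = g1 u) \/ (exists2 u, u.1 < size G2 & v = g2 u).
  move=> vc; apply: cover; last by apply: contraNneq nr => <-.
  by apply: switching_edge_lt (next_cycle cyc vc).
case: Sc => /allP Sc; [apply: (embeds_acyclic E1 ac1 sz cyc u)|apply: (embeds_acyclic E2 ac2 sz cyc u)] => v vc;
  case: (cov v vc) => // -[w hw ew]; have := Sc v vc; rewrite ew /=.
  by rewrite S2.
by rewrite S1.
Qed.

End Join.

Lemma tens_acyclic s A B G H : uniq (sleaves (Tens A B :: G ++ H)) ->
  closed_leaves (sleaves (A :: G)) ->
  (forall s, acyclic (switching_edge s (A :: G))) ->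
  (forall s, acyclic (switching_edge s (B :: H))) ->
  acyclic (switching_edge s (Tens A B :: G ++ H)).
Proof.
move=> u cl ac1 ac2.
pose g1 v := if v.1 is i.+1 then v else (0, false :: v.2) : vertex.
pose g2 v := if v.1 is i.+1 then ((size G + i).+1, v.2) else (0, true :: v.2) : vertex.
pose S (v : vertex) := if v.1 is i.+1 then i < size G else ~~ head true v.2.
apply: (acyclic_join (G1 := A :: G) (G2 := B :: H) (g1 := g1) (g2 := g2) (r := (0, [::])) (S := S)) => //.
- split; first by move=> [[|i] p] [[|j] q] //= [*]; subst.
    by move=> [[|i] p] b.
  by move=> [[|i] p] //= hi; rewrite /at_vertex /= onth_cat_l.
- split; first by move=> [[|i] p] [[|j] q] //= [*]; congr (_, _); lia || done.
    by move=> [[|i] p] b.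
  by move=> [[|i] p] //= hi; rewrite /at_vertex /= onth_cat_r.
- by move=> [[|i] p].
- by move=> [[|i] p] //= _; rewrite /S /= ltnNge leq_addr.
- move=> [[|i] p] /= hi np; last first.
    have [h|h] := ltnP i (size G);
      [left; exists (i.+1, p)|right; exists ((i - size G).+1, p)] => //.
      by rewrite /= !ltnS ltn_subLR // -size_cat.
    by rewrite /g2 /= subnKC.
  by case: p np => [//|[] p] _; [right; exists (0, p)|left; exists (0, p)].
- by rewrite -(perm_uniq (s1 := sleaves (Tens A B :: G ++ H))) //; sperm.
have nb v : switching_edge s (Tens A B :: G ++ H) (0, [::]) v ->
    v = (0, [:: false]) \/ v = (0, [:: true]).
  case/or3P=> [/=/orP[] /eqP ->|h|h]; [by left|by right| |by []].
  move: h; rewrite /arg_edge; case: (at_vertex _ _) => [[|C D|C D]|] //.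
    by case/orP=> /eqP [_]; case: (v.2).
  by move=> /eqP [_]; case: (v.2).
by move=> v w /nb[] -> /nb[] ->.
Qed.

Lemma mix_acyclic s G H : uniq (sleaves (G ++ H)) -> closed_leaves (sleaves G) ->
  (forall s, acyclic (switching_edge s G)) -> (forall s, acyclic (switching_edge s H)) ->
  acyclic (switching_edge s (G ++ H)).
Proof.
move=> u cl ac1 ac2.
pose g2 v := (size G + v.1, v.2) : vertex.
(* Mix creates no vertex; [r] is taken out of range, where it has no edge. *)
apply: (acyclic_join (G1 := G) (G2 := H) (g1 := id) (g2 := g2) (r := (size (G ++ H), [::]))
  (S := fun v => v.1 < size G)) => //.
- by split=> // v hv; rewrite /at_vertex onth_cat_l.
- split=> //; first by move=> [i p] [j q] [/addnI -> ->].
  by move=> [i p] hi; rewrite /at_vertex /= onth_cat_r.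
- by move=> v hv /=; rewrite ltnNge leq_addr.
- move=> v hv _; have [h|h] := ltnP v.1 (size G); [left; by exists v|right].
  exists (v.1 - size G, v.2); first by rewrite /= ltn_subLR // -size_cat.
  by rewrite /g2 /= subnKC //; case: (v).
- by rewrite sleaves_cat in u.
by move=> v w /switching_edge_lt /=; rewrite ltnn.
Qed.

Lemma par_acyclic s A B G : (forall s, acyclic (switching_edge s (A :: B :: G))) ->
  acyclic (switching_edge s (Par A B :: G)).
Proof.
move=> ac.
pose g v := match v.1 with 0 => (0, false :: v.2) | 1 => (0, true :: v.2)
  | i.+2 => (i.+1, v.2) end : vertex.
have gE : embeds (A :: B :: G) (Par A B :: G) g.
  split; first by move=> [[|[|i]] p] [[|[|j]] q] //= [*]; subst.
    by move=> [[|[|i]] p] b.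
  by move=> [[|[|i]] p].
(* A switching leaves the new par with a single neighbour, so no cycle passes through it and one
   class suffices. *)
apply: (acyclic_root (r := (0, [::])) (S := xpredT) (switching_edge_sym _ _)) => //.
  have nb v : switching_edge s (Par A B :: G) (0, [::]) v -> v = (0, [:: s (0, [::])]).
    case/or3P=> [/=/eqP //|h|h]; last by [].
    move: h; rewrite /arg_edge; case: (at_vertex _ _) => [[|C D|C D]|] //.
      by case/orP=> /eqP [_]; case: (v.2).
    by move=> /eqP [_]; case: (v.2).
  by move=> u w /nb -> /nb ->.
move=> c sz cyc u nr _; apply: (embeds_acyclic gE (ac _) sz cyc u) => v vc.
have := switching_edge_lt (next_cycle cyc vc).
have : v != (0, [::]) by apply: contraNneq nr => <-.
case: v {vc} => [[|i] p] /=; last by exists (i.+2, p).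
by case: p => // -[] p _ _; [exists (1, p)|exists (0, p)].
Qed.

Lemma ex_acyclic s G A B H : (forall s, acyclic (switching_edge s (G ++ A :: B :: H))) ->
  acyclic (switching_edge s (G ++ B :: A :: H)).
Proof.
move=> ac.
pose f i := if i == size G then i.+1 else if i == (size G).+1 then size G else i.
pose g v := (f v.1, v.2) : vertex.
have fK : involutive f by move=> i; rewrite /f; do ![case: eqP => /=]; lia.
have gE : embeds (G ++ A :: B :: H) (G ++ B :: A :: H) g.
  split=> //; first by move=> [i p] [j q] [/(can_inj fK) -> ->].
  move=> [i p] _; rewrite /at_vertex /= /f.
  have e0 K := onth_cat_r G K 0; have e1 K := onth_cat_r G K 1.
  rewrite addn0 in e0; rewrite addn1 in e1.
  case: eqP => [->|n1]; first by rewrite e0 e1.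
  case: eqP => [->|n2]; first by rewrite e0 e1.
  have [h|h] := ltnP i (size G); first by rewrite !onth_cat_l.
  have -> : i = size G + (i - size G - 2).+2 by lia.
  by rewrite !onth_cat_r.
move=> c sz; apply/negP => /andP[cyc u].
apply: (embeds_acyclic gE (ac _) sz cyc u) => v vc.
have := switching_edge_lt (next_cycle cyc vc); rewrite size_cat /= => hv.
exists (g v); last by rewrite /g /= fK; case: (v).
by rewrite size_cat /= /f; do ![case: eqP => /=]; lia.
Qed.

Lemma ax_acyclic s (x : link N) : acyclic (switching_edge s [:: Lit true x; Lit false x]).
Proof.
move=> c sz; apply/negP => /andP[cyc u].
have h : {subset c <= [:: (0, [::]); (1, [::])]}.
  have lit w z : arg_edge s [:: Lit true x; Lit false x] w z = false.
    by rewrite /arg_edge /at_vertex; case: w => [[|[|[|i]]] [|b p]].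
  move=> v vc; have := next_cycle cyc vc; rewrite /switching_edge !lit /axiom_edge /at_vertex /=.
  by case: v {vc} => [[|[|[|i]]] [|b p]].
by have := uniq_leq_size u h; rewrite leqNgt sz.
Qed.

Theorem deriv_proof_net G : deriv G -> uniq (sleaves G) -> proof_net G.
Proof.
move=> d u; split.
  have := der_closed (inhabits d); rewrite /proof_structure.
  by rewrite -/(sleaves G) u.
elim: d u => {G} [x|G A B H d IH|G H d IHd e IHe|A B G H d IHd e IHe|A B G d IH] u s.
- exact: ax_acyclic.
- apply: ex_acyclic => s'; apply: IH; rewrite -(perm_uniq (s1 := sleaves (G ++ B :: A :: H))) //; sperm.
- apply: mix_acyclic => //.
  + exact: der_closed (inhabits d).
  + by apply: IHd; move: u; rewrite sleaves_cat cat_uniq => /and3P[].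
  by apply: IHe; move: u; rewrite sleaves_cat cat_uniq => /and3P[].
- have u' : uniq (sleaves (A :: G) ++ sleaves (B :: H)).
    by rewrite -(perm_uniq (s1 := sleaves (Tens A B :: G ++ H))) //; sperm.
  have {u'} [u1 _ u2] := and3P (etrans (esym (cat_uniq _ _)) u').
  apply: tens_acyclic => //; [exact: der_closed (inhabits d)|exact: IHd|exact: IHe].
apply: par_acyclic => s'; apply: IH.
by rewrite -(perm_uniq (s1 := sleaves (Par A B :: G))) //; sperm.
Qed.

End Vertices.

Local Open Scope cat_scope.

(** * Coherence of symmetric monoidal structure *)

(* Structures with the same data are equal, whatever the proofs of the laws. *)
Lemma mixcat_eq O H id co c1 c2 c3 c1' c2' c3'
  T Tm U a ai l li r ri s
  p1 p2 p3 p4 p5 p6 p7 p8 p9 p10 p11 p12 p13 p14 p15 p16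
  p1' p2' p3' p4' p5' p6' p7' p8' p9' p10' p11' p12' p13' p14' p15' p16'
  d e n x q1 q2 q3 q4 q5 q1' q2' q3' q4' q5' m z z' :
  @MixCat (@StarCat (@SMCat (@Category O H id co c1 c2 c3) T Tm U p1 p2 a ai l li r ri s
     p3 p4 p5 p6 p7 p8 p9 p10 p11 p12 p13 p14 p15 p16) d e n q1 q2 q3 x q4 q5) m z =
  @MixCat (@StarCat (@SMCat (@Category O H id co c1' c2' c3') T Tm U p1' p2' a ai l li r ri s
     p3' p4' p5' p6' p7' p8' p9' p10' p11' p12' p13' p14' p15' p16') d e n q1' q2' q3' x q4' q5') m z'.
Proof.
repeat match goal with
  | x : ?T, y : ?T |- _ => destruct (proof_irrelevance _ x y)
  end.
by [].
Qed.

Section Light.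
Variable C : compact.
Local Notation S := (compact_star C).
Local Notation i := (iota C : hom (@unit S) bot).
Implicit Types A B : {A : gobj S | @orth S i A}.

(* [G1_mix C], with the proofs of the laws hidden: conversion gets stuck
   unfolding them otherwise. *)
Definition light_cat : category.
refine (@Category {A : gobj S | @orth S i A} (fun A B => ghom (sval A) (sval B))
  (fun A => exist _ 1 (garrow1 (sval A)))
  (fun A B D g f => exist _ (sval g ∘ sval f) (garrowM (svalP g) (svalP f))) _ _ _).
all: by abstract (move=> *; apply: ghom_eq;
  first [apply: compA | apply: comp1m | apply: compm1]).
Defined.

Definition light_tens (A B : light_cat) : light_cat :=
  exist _ (gtens (sval A) (sval B)) (orth_tens (svalP A) (svalP B)).
Definition light_unit : light_cat := exist _ (gunit i) (@orth_unit S i).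
Definition light_dual (A : light_cat) : light_cat :=
  exist _ (gdual (sval A)) (orth_dual (svalP A)).

Definition light_smcat : smcat.
refine (@SMCat light_cat light_tens
  (fun A B A' B' f g =>
     exist _ (sval f ⊠ sval g) (garrow_tensm (svalP f) (svalP g)))
  light_unit _ _
  (fun A B D => exist _ (assoc _ _ _) (garrow_assoc (sval A) (sval B) (sval D)))
  (fun A B D => exist _ (associ _ _ _) (garrow_associ (sval A) (sval B) (sval D)))
  (fun A => exist _ (lun _) (garrow_lun (svalP A)))
  (fun A => exist _ (luni _) (garrow_luni i (sval A)))
  (fun A => exist _ (run _) (garrow_run (svalP A)))
  (fun A => exist _ (runi _) (garrow_runi i (sval A)))
  (fun A B => exist _ (sym _ _) (garrow_sym (sval A) (sval B)))
  _ _ _ _ _ _ _ _ _ _ _ _ _ _);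
by abstract (move=> *; apply: ghom_eq; first [exact: tensm1 | exact: tensmM
  | exact: assocK | exact: associK | exact: lunK | exact: luniK | exact: runK
  | exact: runiK | exact: symK | exact: assoc_nat | exact: lun_nat | exact: run_nat
  | exact: sym_nat | exact: pentagon | exact: triangle | exact: hexagon]).
Defined.

Definition light : starcat.
refine (@StarCat light_smcat light_dual
  (fun A => exist _ (ev _) (garrow_ev (svalP A)))
  (fun X A f => exist _ (name (sval f)) (garrow_name (svalP f)))
  _ _ _
  (fun A => exist _ (chii _) (garrow_chii (sval A)))
  _ _).
all: by abstract (move=> *; apply: ghom_eq;
  first [exact: nameK | exact: evK | exact: ev_unit | exact: chiK | exact: chiiK]).
Defined.

Definition light_mix : mixcat.
refine (@MixCat light (exist _ (iotai C) (garrow_mixm C)) _).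
by abstract (apply: ghom_eq; exact: iotai_coh).
Defined.

Lemma light_mixE : G1_mix C = light_mix.
Proof. exact: mixcat_eq. Qed.

End Light.

Lemma compAE (C : category) (A B D : C) (g : hom B D) (f : hom A B) h :
  g ∘ f = h -> forall X (k : hom X A), g ∘ (f ∘ k) = h ∘ k.
Proof. by move=> e X k; rewrite compA e. Qed.

Lemma pentagonr (C : smcat) (X Y Z W : C) :
  (1 ⊠ assoc Y Z W) ∘ (assoc X (Y ⊗ Z) W ∘ (assoc X Y Z ⊠ 1)) =
  assoc X Y (Z ⊗ W) ∘ assoc (X ⊗ Y) Z W.
Proof. by rewrite pentagon !compA. Qed.

(** * Adjacent transpositions in right-nested tensors *)

Section Exchange.
Variable C : smcat.
Implicit Types X Y Z W : C.

Definition exch_def X Y Z : hom (X ⊗ (Y ⊗ Z)) (Y ⊗ (X ⊗ Z)) :=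
  assoc Y X Z ∘ (sym X Y ⊠ 1) ∘ associ X Y Z.
(* Locked, so that rewriting with [compA] does not see through it. *)
Definition exch := locked exch_def.

Lemma exchE X Y Z : exch X Y Z = assoc Y X Z ∘ (sym X Y ⊠ 1) ∘ associ X Y Z.
Proof. by rewrite /exch -lock. Qed.

Lemma exch_nat X X' Y Y' Z Z' (f : hom X X') (g : hom Y Y') (h : hom Z Z') :
  exch X' Y' Z' ∘ (f ⊠ (g ⊠ h)) = (g ⊠ (f ⊠ h)) ∘ exch X Y Z.
Proof.
rewrite !exchE -!compA associ_nat !compA; congr (_ ∘ _).
rewrite -(compA (assoc _ _ _)) -tensmM sym_nat comp1m.
by rewrite -{1}(compm1 h) tensmM !compA assoc_nat.
Qed.

Lemma exchK X Y Z : exch Y X Z ∘ exch X Y Z = 1.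
Proof.
rewrite !exchE -!compA (compAE (assocK _ _ _)) comp1m (compA (_ ⊠ 1)) -tensM1 symK.
by rewrite tensm1 comp1m associK.
Qed.

Lemma exch_assoc X Y Z : exch X Y Z ∘ assoc X Y Z = assoc Y X Z ∘ (sym X Y ⊠ 1).
Proof. by rewrite !exchE -!compA assocK compm1. Qed.

(** The hexagon with a tail [W]: moving [X] past [Y ⊗ Z] is moving it past [Y] and then past [Z]. *)
Lemma exch_hex X Y Z W :
  assoc Y Z (X ⊗ W) ∘ exch X (Y ⊗ Z) W =
  (1 ⊠ exch X Z W) ∘ exch X Y (Z ⊗ W) ∘ (1 ⊠ assoc Y Z W).
Proof.
have aK : (assoc X (Y ⊗ Z) W ∘ (assoc X Y Z ⊠ 1)) ∘
    ((associ X Y Z ⊠ 1) ∘ associ X (Y ⊗ Z) W) = 1.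
  rewrite -!compA (compAE (g := assoc X Y Z ⊠ 1) (f := associ X Y Z ⊠ 1) (h := 1)).
    by rewrite comp1m associK.
  by rewrite -tensM1 associK tensm1.
apply: (epi_l aK); rewrite !exchE -!compA.
rewrite (compAE (assocK _ _ _)) comp1m.
have -> : (idm X ⊠ assoc Y Z W) ∘ (assoc X (Y ⊗ Z) W ∘ (assoc X Y Z ⊠ 1)) =
   assoc X Y (Z ⊗ W) ∘ assoc (X ⊗ Y) Z W by rewrite pentagon !compA.
rewrite (compAE (assocK _ _ _)) comp1m.
have -> : (sym X Y ⊠ idm (Z ⊗ W)) ∘ assoc (X ⊗ Y) Z W =
   assoc (Y ⊗ X) Z W ∘ ((sym X Y ⊠ 1) ⊠ 1) by rewrite assoc_nat tensm1.
rewrite (compAE (pentagon Y X Z W)) -!compA.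
have e : (idm Y ⊠ (assoc Z X W ∘ ((sym X Z ⊠ idm W) ∘ associ X Z W)))
    ∘ (1 ⊠ assoc X Z W) = 1 ⊠ (assoc Z X W ∘ (sym X Z ⊠ idm W)).
  by rewrite -tens1M -!compA assocK compm1.
rewrite (compAE e) tens1M -!compA.
have -> : (idm Y ⊠ (sym X Z ⊠ idm W)) ∘ (assoc Y (X ⊗ Z) W
     ∘ ((assoc Y X Z ⊠ 1) ∘ ((sym X Y ⊠ 1) ⊠ 1))) =
   assoc Y (Z ⊗ X) W ∘ (((1 ⊠ sym X Z) ∘ assoc Y X Z ∘ (sym X Y ⊠ 1)) ⊠ 1).
  by rewrite !tensM1 -!compA !(compAE (assoc_nat _ _ _)) -!compA.
by rewrite -hexagon !tensM1 !compA -pentagon -!compA.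
Qed.

Lemma exch_hex_l X Y Z W :
  exch X Z (Y ⊗ W) ∘ (1 ⊠ exch Y Z W) ∘ assoc X Y (Z ⊗ W) =
  (1 ⊠ assoc X Y W) ∘ exch (X ⊗ Y) Z W.
Proof.
have e1 : (idm Z ⊠ assoc X Y W) ∘ (1 ⊠ associ X Y W) = 1.
  by rewrite -tens1M associK tensm1.
apply: (mono_l e1); apply: (mono_l (exchK Z (X ⊗ Y) W)).
apply: (mono_l (assocK X Y (Z ⊗ W))).
have e0 : (idm Z ⊠ associ X Y W) ∘ (1 ⊠ assoc X Y W) = 1.
  by rewrite -tens1M assocK tensm1.
rewrite (compAE e0) comp1m exchK compm1.
rewrite (compA (assoc _ _ _)) exch_hex -!compA.
have e2 : (idm Z ⊠ assoc X Y W) ∘ (1 ⊠ associ X Y W) = 1.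
  by rewrite -tens1M associK tensm1.
rewrite (compAE e2) comp1m (compAE (exchK _ _ _)) comp1m.
by rewrite (compA (1 ⊠ _)) -tens1M exchK tensm1 comp1m.
Qed.

(** The braid relation. By [exch_hex] both sides move [X] past [Y ⊗ Z] and exchange [Y] with [Z], in
    either order, and naturality identifies them. *)
Lemma exch_YB X Y Z W :
  exch Y Z (X ⊗ W) ∘ (1 ⊠ exch X Z W) ∘ exch X Y (Z ⊗ W) =
  (1 ⊠ exch X Y W) ∘ exch X Z (Y ⊗ W) ∘ (1 ⊠ exch Y Z W).
Proof.
have e : exch X Y (Z ⊗ W) = exch X Y (Z ⊗ W) ∘ (1 ⊠ assoc Y Z W) ∘ (1 ⊠ associ Y Z W).
  by rewrite -compA -tens1M associK tensm1 compm1.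
have e3 A B D V (k : hom V (A ⊗ ((B ⊗ D) ⊗ W))) :
    (1 ⊠ exch A D W) ∘ (exch A B (D ⊗ W) ∘ ((1 ⊠ assoc B D W) ∘ k)) =
    assoc B D (A ⊗ W) ∘ (exch A (B ⊗ D) W ∘ k).
  by rewrite !compA -exch_hex.
rewrite {1}e -!compA e3 (compAE (exch_assoc Y Z _)) -!compA -{1}(tensm1 X W).
rewrite (compAE (esym (exch_nat (idm X) (sym Y Z) (idm W)))) -!compA -e3.
by rewrite -!tens1M (exchE Y Z W) -!compA.
Qed.

Lemma lun_exch X Y : (1 ⊠ lun Y) ∘ exch unit X Y = lun (X ⊗ Y).
Proof.
have e : lun (X ⊗ Y) = (lun X ⊠ 1) ∘ associ unit X Y.
  by rewrite -lun_assoc -compA associK compm1.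
by rewrite !exchE !compA triangle -tensM1 run_sym e.
Qed.

Lemma exch_lun X Y : lun (X ⊗ Y) ∘ exch X unit Y = 1 ⊠ lun Y.
Proof.
apply: (epi_l (exchK X unit Y)); rewrite -compA exchK compm1.
by rewrite lun_exch.
Qed.

End Exchange.

(** * Coherence by flattening words into lists *)

Section Coherence.
Variables (C : compact) (N : nat) (R : 'I_N -> C).
Local Notation leaf := (bool * link N)%type.
Local Notation wob := (wob R).

Definition lit (l : leaf) : C := wob (WLit l.1 l.2).

Fixpoint lwob (s : seq leaf) : C :=
  if s is l :: s' then lit l ⊗ lwob s' else unit.

Fixpoint wleaves (w : word (link N)) (acc : seq leaf) : seq leaf :=
  match w with
  | WUnit => acc
  | WLit b x => (b, x) :: acc
  | WTens v w => wleaves v (wleaves w acc)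
  end.

(** Flattening onto a tail [acc] avoids concatenations of lists and the transports they would
    bring. *)
Fixpoint flat (w : word (link N)) (acc : seq leaf) :
    hom (wob w ⊗ lwob acc) (lwob (wleaves w acc)) :=
  match w with
  | WUnit => lun _
  | WLit b x => 1
  | WTens v w => flat v (wleaves w acc) ∘ (1 ⊠ flat w acc) ∘ assoc _ _ _
  end.

Fixpoint unflat (w : word (link N)) (acc : seq leaf) :
    hom (lwob (wleaves w acc)) (wob w ⊗ lwob acc) :=
  match w with
  | WUnit => luni _
  | WLit b x => 1
  | WTens v w => associ _ _ _ ∘ (1 ⊠ unflat w acc) ∘ unflat v (wleaves w acc)
  end.

Lemma flatK w acc : unflat w acc ∘ flat w acc = 1.
Proof.
elim: w acc => [|b x|v IHv w IHw] acc /=; [exact: lunK|exact: comp1m|].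
rewrite -!compA (compAE (IHv _)) comp1m (compA (1 ⊠ _)) -tens1M IHw tensm1 comp1m.
exact: assocK.
Qed.

(** An [arrangement] codes a permutation by successive insertions. It lives in [Type] because an
    arrow is computed from it, and it is unique when no leaf is repeated, which makes it a normal
    form. *)
Inductive ins (x : leaf) : seq leaf -> seq leaf -> Type :=
  | ins0 s : ins x s (x :: s)
  | insS y s t : ins x s t -> ins x (y :: s) (y :: t).

Fixpoint ins_arr x s t (i : ins x s t) : hom (lwob t) (lit x ⊗ lwob s) :=
  match i with
  | ins0 _ => 1
  | insS y s t i => exch _ _ _ ∘ (1 ⊠ ins_arr i)
  end.

Inductive arrangement : seq leaf -> seq leaf -> Type :=
  | arr0 : arrangement [::] [::]
  | arrS x s t r : ins x s t -> arrangement s r -> arrangement t (x :: r).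

Fixpoint arr_arr s t (p : arrangement s t) : hom (lwob s) (lwob t) :=
  match p with
  | arr0 => 1
  | arrS x s t r i p => (1 ⊠ arr_arr p) ∘ ins_arr i
  end.

Inductive reorder : seq leaf -> seq leaf -> Type :=
  | r_id s : reorder s s
  | r_comp s t u : reorder t u -> reorder s t -> reorder s u
  | r_skip x s t : reorder s t -> reorder (x :: s) (x :: t)
  | r_swap x y s : reorder (x :: y :: s) (y :: x :: s).

Fixpoint reorder_arr s t (r : reorder s t) : hom (lwob s) (lwob t) :=
  match r with
  | r_id s => 1
  | r_comp s t u q p => reorder_arr q ∘ reorder_arr p
  | r_skip x s t p => 1 ⊠ reorder_arr p
  | r_swap x y s => exch _ _ _
  end.

(** A leaf that is pulled to the front after a reordering may be pulled first, the others being
    reordered afterwards; [exch_YB] covers the swap of two other leaves. *)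
Lemma ins_reorder x s s' t (r : reorder s s') (i : ins x t s') :
  exists t' (i' : ins x t' s) (r' : reorder t' t),
    ins_arr i ∘ reorder_arr r = (1 ⊠ reorder_arr r') ∘ ins_arr i'.
Proof.
elim: r t i => {s s'} [s|s t u q IHq p IHp|y s t p IHp|y z s] v i /=.
- by exists v, i, (r_id v); rewrite /= tensm1 comp1m compm1.
- have [v1 [i1 [r1 e1]]] := IHq v i; have [v2 [i2 [r2 e2]]] := IHp v1 i1.
  exists v2, i2, (r_comp r1 r2); rewrite /= compA e1 -compA e2 compA tens1M.
  by [].
- dependent destruction i; first by exists s, (ins0 y s), p; rewrite /= comp1m compm1.
  have [t' [i' [r' e]]] := IHp s0 i.
  exists (y :: t'), (insS y i'), (r_skip y r'); rewrite /= -compA -tens1M e.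
  by rewrite compA -exch_nat -compA -tens1M.
- dependent destruction i.
    exists (y :: s), (insS y (ins0 z s)), (r_id _).
    by rewrite /= !tensm1 !comp1m compm1.
  dependent destruction i.
    exists (z :: s), (ins0 y _), (r_id _).
    by rewrite /= !tensm1 !compm1 exchK.
  exists (y :: z :: s0), (insS y (insS z i)), (r_swap _ _ _); rewrite /=.
  rewrite !tens1M !compA -exch_YB -!compA; congr (_ ∘ (_ ∘ _)).
  by rewrite exch_nat.
Qed.

(** Stated by cases on the lists, because the equation with the identity is typable only once both
    are empty. *)
Lemma reorder_nil s t (r : reorder s t) :
  match s, t return hom (lwob s) (lwob t) -> Prop with
  | [::], [::] => fun f => f = 1
  | _ :: _, _ :: _ => fun _ => True
  | _, _ => fun _ => False
  end (reorder_arr r).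
Proof.
elim: r => {s t} [[]|s t u q IHq p IHp|x s t p _|] //=.
by case: s t u q IHq p IHp => [|? ?] [|? ?] [|? ?] //= q -> p ->; rewrite comp1m.
Qed.

Lemma arrangement_reorder s t u (r : reorder s t) (p : arrangement t u) :
  exists q : arrangement s u, arr_arr q = arr_arr p ∘ reorder_arr r.
Proof.
elim: p s r => {t u} [|x t t' u i p IH] s r.
  case: s r (reorder_nil r) => [|//] r /= ->.
  by exists arr0; rewrite /= comp1m.
have [s' [i' [r' e]]] := ins_reorder r i; have [q eq] := IH _ r'.
by exists (arrS i' q); rewrite /= -compA e compA -tens1M eq.
Qed.

Lemma ins_mem x s t (i : ins x s t) : x \in t.
Proof. by elim: i => [s'|y s' t' _ IH]; rewrite inE ?eqxx // IH orbT. Qed.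

Lemma ins_mem_sub x s t (i : ins x s t) y : y \in s -> y \in t.
Proof.
elim: i y => [s' y|z s' t' _ IH y]; rewrite !inE => h; first by rewrite h orbT.
by case/orP: h => [->|/IH->]; rewrite ?orbT.
Qed.

Lemma ins_uniq x s t (i : ins x s t) : uniq t -> uniq s.
Proof.
elim: i => [s' /= /andP[]|y s' t' i IH /= /andP[h1 /IH ->]] //.
by rewrite andbT; apply: contra h1; exact: (ins_mem_sub i).
Qed.

Lemma ins_irr x s s' t (i : ins x s t) (i' : ins x s' t) :
  uniq t -> existT (fun r => ins x r t) s i = existT _ s' i'.
Proof.
elim: i s' i' => {s t} [s|y s t i IH] s' i'.
  by dependent destruction i' => //=; rewrite (ins_mem i').
dependent destruction i' => /= /andP[h u]; first by rewrite (ins_mem i) in h.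
by have e := IH _ i' u; dependent destruction e.
Qed.

Lemma arrangement_irr s t (p q : arrangement s t) : uniq s -> p = q.
Proof.
elim: p q => {s t} [|x s t r i p IH] q u; dependent destruction q => //.
have e := ins_irr i i0 u; dependent destruction e.
by rewrite (IH q (ins_uniq i0 u)).
Qed.

Fixpoint arr_id s : arrangement s s :=
  if s is x :: s' then arrS (ins0 x s') (arr_id s') else arr0.

Lemma arr_idE s : arr_arr (arr_id s) = 1.
Proof. by elim: s => //= x s ->; rewrite tensm1 comp1m. Qed.

Lemma flat_lift w s t (r : reorder s t) :
  exists r' : reorder (wleaves w s) (wleaves w t),
    reorder_arr r' ∘ flat w s = flat w t ∘ (1 ⊠ reorder_arr r).
Proof.
elim: w s t r => [|b x|v IHv w IHw] s t r /=.
- by exists r; rewrite lun_nat.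
- by exists (r_skip (b, x) r); rewrite /= comp1m compm1.
have [r1 e1] := IHw _ _ r; have [r2 e2] := IHv _ _ r1; exists r2.
rewrite !compA e2 -!compA; congr (_ ∘ _); rewrite !compA -tens1M e1 tens1M.
by rewrite -!compA -assoc_nat tensm1.
Qed.

Lemma flat_exch1 b x w s :
  exists r : reorder ((b, x) :: wleaves w s) (wleaves w ((b, x) :: s)),
    reorder_arr r ∘ (1 ⊠ flat w s) = flat w ((b, x) :: s) ∘ exch _ _ _.
Proof.
elim: w s => [|c y|v IHv w IHw] s /=.
- by exists (r_id _); rewrite comp1m exch_lun.
- by exists (r_swap _ _ _); rewrite /= tensm1 comp1m compm1.
have [r1 e1] := IHw s; have [r2 e2] := IHv (wleaves w s).
have [r3 e3] := flat_lift v r1.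
exists (r_comp r3 r2) => /=; rewrite !tens1M -!compA (compAE e2) -!compA.
rewrite (compAE e3) -!compA (compAE (exch_nat _ _ _)) -!compA.
rewrite (compA (1 ⊠ reorder_arr r1)) -tens1M e1 tens1M -!compA.
by congr (_ ∘ (_ ∘ _)); rewrite exch_hex -compA.
Qed.

Lemma flat_exch v w s :
  exists r : reorder (wleaves v (wleaves w s)) (wleaves w (wleaves v s)),
    reorder_arr r ∘ (flat v (wleaves w s) ∘ (1 ⊠ flat w s)) =
    flat w (wleaves v s) ∘ (1 ⊠ flat v s) ∘ exch _ _ _.
Proof.
elim: v s => [|b x|v1 IH1 v2 IH2] s /=.
- by exists (r_id _); rewrite comp1m lun_nat -compA lun_exch.
- have [r e] := flat_exch1 b x w s; exists r.
  by rewrite comp1m e tensm1 compm1.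
have [r2 e2] := IH2 s; have [r1 e1] := IH1 (wleaves v2 s).
have [r3 e3] := flat_lift v1 r2.
exists (r_comp r1 r3) => /=; rewrite -!compA (compAE e3) -!compA.
have -> : assoc (wob v1) (wob v2) (lwob (wleaves w s)) ∘ (1 ⊠ flat w s) =
    (1 ⊠ (1 ⊠ flat w s)) ∘ assoc _ _ _ by rewrite -assoc_nat tensm1.
rewrite (compA (1 ⊠ flat v2 _)) -tens1M (compA (1 ⊠ reorder_arr r2)) -tens1M e2.
rewrite !tens1M -!compA.
have := e1; rewrite -compA => /compAE e1'.
rewrite (compA (flat v1 _)) (compA (reorder_arr r1)) e1 -!compA.
congr (_ ∘ _); rewrite (compAE (exch_nat _ _ _)) -!compA.
by congr (_ ∘ (_ ∘ _)); rewrite compA exch_hex_l.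
Qed.

(** After flattening, associativity and unit isomorphisms become identities and a symmetry becomes a
    composite of adjacent swaps. *)
Lemma struct_reorder v w (f : struct v w) s :
  exists r : reorder (wleaves v s) (wleaves w s),
    reorder_arr r ∘ flat v s = flat w s ∘ (wstruct R f ⊠ 1).
Proof.
elim: f s => {v w} [v|u v w f IHf g IHg|v w v' w' f IHf g IHg|u v w|u v w|v|v|v|v|v w] s /=.
- by exists (r_id _); rewrite comp1m tensm1 compm1.
- have [r1 e1] := IHf s; have [r2 e2] := IHg s; exists (r_comp r1 r2) => /=.
  by rewrite -compA e2 compA e1 -compA -tensM1.
- have [r1 e1] := IHf (wleaves v' s); have [r2 e2] := IHg s.
  have [r3 e3] := flat_lift w r2; exists (r_comp r3 r1) => /=.
  rewrite -!compA (compAE e1) -!compA (compAE e3) -!compA; congr (_ ∘ _).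
  by rewrite assoc_nat !compA -!tensmM !comp1m !compm1 e2.
- exists (r_id _); rewrite comp1m !tens1M -!compA pentagonr.
  by rewrite -(tensm1 (wob u) (wob v)) (compAE (assoc_nat _ _ _)) -!compA.
- exists (r_id _); rewrite comp1m.
  apply: (epi_l (f := assoc (wob u) (wob v) (wob w) ⊠ 1) (g := associ _ _ _ ⊠ 1)).
    by rewrite -tensM1 associK tensm1.
  rewrite -[RHS]compA -tensM1 assocK tensm1 compm1.
  rewrite !tens1M -!compA pentagonr.
  by rewrite -(tensm1 (wob u) (wob v)) (compAE (assoc_nat _ _ _)) -!compA.
- by exists (r_id _); rewrite comp1m lun_nat -compA lun_assoc.
- exists (r_id _); rewrite comp1m lun_nat -!compA (compAE (lun_assoc _ _)).
  by rewrite -tensM1 luniK tensm1 compm1.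
- by exists (r_id _); rewrite comp1m -compA triangle.
- exists (r_id _); rewrite comp1m -!compA (compAE (triangle _ _)).
  by rewrite -tensM1 runiK tensm1 compm1.
have [r e] := flat_exch v w s; exists r; rewrite compA e -!compA.
by rewrite exch_assoc.
Qed.

(* Mac Lane's coherence for words without repeated leaves. *)
Lemma struct_coherence v w (f g : struct v w) :
  uniq (wleaves v [::]) -> wstruct R f = wstruct R g.
Proof.
move=> u; have [rf ef] := struct_reorder f [::]; have [rg eg] := struct_reorder g [::].
have [pf e1] := arrangement_reorder rf (arr_id _).
have [pg e2] := arrangement_reorder rg (arr_id _).
rewrite arr_idE comp1m in e1; rewrite arr_idE comp1m in e2.
have e : wstruct R f ⊠ idm unit = wstruct R g ⊠ 1.
  apply: (mono_l (flatK w [::])); rewrite -ef -eg -e1 -e2.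
  by rewrite (arrangement_irr pf pg u).
exact: tensI_inj e.
Qed.

End Coherence.

(** * Transport along equalities of objects *)

Section Cast.
Variable C : category.

Definition cast (X Y : C) (e : X = Y) : hom X Y :=
  match e in _ = Y return hom X Y with erefl => idm X end.

Lemma cast1 (X : C) (e : X = X) : cast e = 1.
Proof. by rewrite (proof_irrelevance _ e erefl). Qed.

Lemma castM (X Y Z : C) (e : X = Y) (e' : Y = Z) (e'' : X = Z) :
  cast e' ∘ cast e = cast e''.
Proof. by subst; rewrite !cast1 comp1m. Qed.

Lemma castK (X Y : C) (e : X = Y) (e' : Y = X) : cast e' ∘ cast e = 1.
Proof. by subst; rewrite !cast1 comp1m. Qed.

Lemma cast_irr (X Y : C) (e e' : X = Y) : cast e = cast e'.
Proof. by rewrite (proof_irrelevance _ e e'). Qed.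

End Cast.

Lemma cast_tens (C : smcat) (X Y X' Y' : C) (e : X = X') (e' : Y = Y') e'' :
  cast (C := C) e'' = cast e ⊠ cast e' :> hom (X ⊗ Y) (X' ⊗ Y').
Proof. by subst; rewrite !cast1 tensm1. Qed.

(** * Independence of the interpretation from the order and the names of links *)

Section Links.
Variables (C : compact) (N : nat).
Local Notation S := (compact_star C).
Implicit Types R : 'I_N -> C.

Lemma wleaves_formula (A : formula (link N)) s :
  wleaves (formula_word A) s = leaves A ++ s.
Proof. by elim: A s => //= A IHA B IHB s; rewrite IHB IHA catA. Qed.

Lemma wleaves_link (L : seq (link N)) :
  wleaves (link_word L) [::] =
  flatten [seq [:: (true, x); (false, x)] | x <- L].
Proof. by elim: L => //= x L ->. Qed.

Lemma mem_wleaves_link (L : seq (link N)) b x :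
  ((b, x) \in wleaves (link_word L) [::]) = (x \in L).
Proof.
rewrite wleaves_link; elim: L => //= y L IH; rewrite !inE IH orbA; congr orb.
by rewrite -!pair_eqE /=; case: (b); rewrite ?orbF.
Qed.

Lemma wleaves_cat (v : word (link N)) s : wleaves v s = wleaves v [::] ++ s.
Proof.
elim: v s => //= v IHv w IHw s.
by rewrite IHw IHv (IHv (wleaves w [::])) catA.
Qed.

Lemma struct_perm (v w : word (link N)) (f : struct v w) :
  perm_eq (wleaves v [::]) (wleaves w [::]).
Proof.
elim: f => {v w} [v|u v w f IHf g IHg|v w v' w' f IHf g IHg|u v w|u v w|v|v|v|v|v w] //=.
- exact: perm_trans IHg IHf.
- by rewrite wleaves_cat (wleaves_cat w); apply: perm_cat.
by rewrite (wleaves_cat v (wleaves w _)) (wleaves_cat w (wleaves v _)) perm_catC.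
Qed.

Lemma uniq_link (L : seq (link N)) : uniq (wleaves (link_word L) [::]) -> uniq L.
Proof.
elim: L => //= x L IH /andP[h /andP[_ /IH ->]]; rewrite andbT.
by move: h; rewrite inE negb_or => /andP[_]; rewrite mem_wleaves_link.
Qed.

Lemma exch_pt (X Y Z : C) (x : hom unit X) (y : hom unit Y) (z : hom unit Z) :
  exch X Y Z ∘ ((x ⊠ ((y ⊠ z) ∘ luni unit)) ∘ luni unit) =
  (y ⊠ ((x ⊠ z) ∘ luni unit)) ∘ luni unit.
Proof.
rewrite exchE -!compA associ_pt.
rewrite (compA (sym X Y ⊠ 1)) -tensmM (compA (sym X Y)) sym_nat -(compA _ (sym _ _)) sym_luni.
by rewrite -luni_runi comp1m assoc_pt.
Qed.

Lemma units_move (l1 l2 : seq (link N)) x :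
  exists r : struct (link_word (l1 ++ x :: l2)) (link_word (x :: l1 ++ l2)),
    forall R, wstruct R r ∘ units R (l1 ++ x :: l2) = units R (x :: l1 ++ l2).
Proof.
elim: l1 => [|y l1 [r IH]] /=.
  by exists (s_id _) => R'; rewrite /= comp1m.
exists (s_comp (s_comp (s_assoc _ _ _) (s_comp (s_tens (s_sym _ _) (s_id _))
  (s_associ _ _ _))) (s_tens (s_id _) r)) => R' /=.
rewrite -!compA (compA (1 ⊠ _)) -tensmM IH /= comp1m.
have := exch_pt (eta (R' y.1)) (eta (R' x.1)) (units R' (l1 ++ l2)).
by rewrite exchE -!compA.
Qed.

Lemma units_perm (L L' : seq (link N)) : perm_eq L L' ->
  exists r : struct (link_word L) (link_word L'),
    forall R, wstruct R r ∘ units R L = units R L'.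
Proof.
elim: L' L => [|x L' IH] L pL.
  by move/perm_size/size0nil: pL => ->; exists (s_id _) => R; rewrite comp1m.
have xL : x \in L by rewrite (perm_mem pL) mem_head.
case/splitPr: xL pL => l1 l2 pL.
have [|r er] := IH (l1 ++ l2).
  rewrite -(perm_cons x); apply: perm_trans pL.
  exact/permEl/(perm_catCA [:: x] l1 l2).
have [q eq] := units_move l1 l2 x.
exists (s_comp (s_tens (s_id _) r) q) => R /=.
by rewrite -compA eq /= compA -tensmM comp1m er.
Qed.

Definition ps_val (A : formula (link N)) L (s : struct (link_word L) (formula_word A))
    R : hom unit (fob (D := S) R R (erase A)) :=
  mixify R A ∘ wstruct R s ∘ units R L.

(** Both lists enumerate the links of [A], so they are permutations of each other; coherence then
    identifies the structural arrows. *)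
Lemma ps_val_irr A L L' (s : struct (link_word L) (formula_word A))
    (s' : struct (link_word L') (formula_word A)) R :
  uniq (leaves A) -> ps_val s R = ps_val s' R.
Proof.
move=> u; have uA : uniq (wleaves (formula_word A) [::]).
  by rewrite wleaves_formula cats0.
have uL : uniq (wleaves (link_word L) [::]) by rewrite (perm_uniq (struct_perm s)).
have uL' : uniq (wleaves (link_word L') [::]) by rewrite (perm_uniq (struct_perm s')).
have pL : perm_eq L L'.
  apply: uniq_perm; [exact: uniq_link uL|exact: uniq_link uL'|move=> x].
  rewrite -(mem_wleaves_link L true) -(mem_wleaves_link L' true).
  by rewrite (perm_mem (struct_perm s)) (perm_mem (struct_perm s')).
have [r er] := units_perm pL.
rewrite /ps_val -(er R) !compA -(compA _ (wstruct R s')).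
by have /= -> := struct_coherence R s (s_comp s' r) uL.
Qed.

(* [t] is the interpretation of the proof structure [A] on the formula [F]. *)
Definition is_ps (F : formula 'I_N) (t : family S F) (A : formula (link N)) :=
  exists (e : erase A = F) L (s : struct (link_word L) (formula_word A)),
    forall R, t R = cast (f_equal (fob (D := S) R R) e) ∘ ps_val s R.

Lemma cast_mix (X X' Y Y' Z W : C) (e : X = X') (e' : Y = Y') e''
    (f : hom Z X) (g : hom W Y) :
  cast (C := C) e'' ∘ (mix X Y ∘ (f ⊠ g)) = mix X' Y' ∘ ((cast e ∘ f) ⊠ (cast e' ∘ g)).
Proof. by subst; rewrite !cast1 !comp1m. Qed.

Lemma erase_parl (A : formula (link N)) G :
  erase (parl A G) = parl (erase A) (map (@erase N) G).
Proof. by elim: G A => //= B G IH A; congr (Par _ _); apply: IH. Qed.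

Lemma mixify_seqE R (A : formula (link N)) G e :
  mixify_seq R A G = cast (C := S) e ∘ mixify R (parl A G).
Proof.
elim: G A e => [|B G IH] A e /=; first by rewrite cast1 comp1m.
have e1 := f_equal (fob (D := S) R R) (erase_parl B G).
rewrite (cast_mix (erefl _) e1) cast1 comp1m; congr (_ ∘ (_ ⊠ _)).
exact: IH.
Qed.

Lemma ps_interp_is_ps (A : formula 'I_N) G (t : family S (parl A G)) :
  ps_interp t -> exists A' G', [/\ erase A' = A, map (@erase N) G' = G,
    proof_structure (A' :: G') & is_ps t (parl A' G')].
Proof.
case=> {A G t} A G L s t psA tE; exists A, G; split=> //.
exists (erase_parl A G), L, s => R; rewrite tE /ps_val !compA.
by rewrite (mixify_seqE (f_equal (fob (D := S) R R) (erase_parl A G))).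
Qed.

Section Rename.
Variable g : link N -> nat.
Let rho (x : link N) : link N := (x.1, g x).

Fixpoint wmap (w : word (link N)) : word (link N) :=
  match w with
  | WUnit => @WUnit _
  | WLit b x => WLit b (rho x)
  | WTens v w => WTens (wmap v) (wmap w)
  end.

Lemma wob_map R w : wob R w = wob R (wmap w).
Proof. by elim: w => //= v -> w ->. Qed.

Lemma wmap_link L : wmap (link_word L) = link_word (map rho L).
Proof. by elim: L => //= x L ->. Qed.

Lemma wmap_formula A : wmap (formula_word A) = formula_word (fmap rho A).
Proof. by elim: A => //= A -> B ->. Qed.

Lemma erase_rename A : erase (fmap rho A) = erase A.
Proof.
by elim: A => [b x|A IHA B IHB|A IHA B IHB] //; [congr Tens|congr Par].
Qed.

Lemma wstruct_map v w (f : struct v w) :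
  exists f' : struct (wmap v) (wmap w), forall R,
    wstruct R f' ∘ cast (wob_map R v) = cast (wob_map R w) ∘ wstruct R f.
Proof.
have tE R v' w' : cast (wob_map R (WTens v' w')) = cast (wob_map R v') ⊠ cast (wob_map R w').
  exact: cast_tens.
elim: f => {v w} [v|u v w f [f' IHf] h [h' IHh]|v w v' w' f [f' IHf] h [h' IHh]
   |u v w|u v w|v|v|v|v|v w].
- by exists (s_id _) => R; rewrite comp1m compm1.
- by exists (s_comp f' h') => R /=; rewrite -compA IHh compA IHf -compA.
- by exists (s_tens f' h') => R; rewrite !tE /= -!tensmM IHf IHh.
- by exists (s_assoc _ _ _) => R; rewrite !tE /= assoc_nat.
- by exists (s_associ _ _ _) => R; rewrite !tE /= associ_nat.
- by exists (s_lun _) => R; rewrite !tE /= cast1 lun_nat.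
- by exists (s_luni _) => R; rewrite !tE /= cast1 luni_nat.
- by exists (s_run _) => R; rewrite !tE /= cast1 run_nat.
- by exists (s_runi _) => R; rewrite !tE /= cast1 runi_nat.
by exists (s_sym _ _) => R; rewrite !tE /= sym_nat.
Qed.

Lemma units_map R L (e : wob R (link_word L) = wob R (link_word (map rho L))) :
  units R (map rho L) = cast e ∘ units R L.
Proof.
elim: L e => [|x L IH] e /=; first by rewrite cast1 comp1m.
have e' : wob R (link_word L) = wob R (link_word (map rho L)).
  by rewrite -wmap_link -wob_map.
rewrite (cast_tens (erefl _) e') cast1 compA -tensmM comp1m -IH.
by [].
Qed.

Lemma mixify_map R A (e : wob R (formula_word A) = wob R (formula_word (fmap rho A)))
    e' :
  mixify R A = cast (C := S) e' ∘ mixify R (fmap rho A) ∘ cast e.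
Proof.
have wE B : wob R (formula_word B) = wob R (formula_word (fmap rho B)).
  by rewrite -wmap_formula -wob_map.
have fE B : fob (D := S) R R (erase (fmap rho B)) = fob (D := S) R R (erase B).
  by rewrite erase_rename.
elim: A e e' => [[] x|A IHA B IHB|A IHA B IHB] e e' /=.
- by rewrite !cast1 !comp1m.
- by rewrite !cast1 !comp1m.
- rewrite (IHA (wE A) (fE A)) (IHB (wE B) (fE B)).
  by rewrite (cast_tens (wE A) (wE B)) (cast_tens (C := S) (fE A) (fE B)) -!tensmM.
rewrite (IHA (wE A) (fE A)) (IHB (wE B) (fE B)) (cast_tens (wE A) (wE B)).
rewrite (cast_mix (fE A) (fE B)) -(compA (mix _ _) _ (_ ⊠ _)) -tensmM.
by [].
Qed.

(** A renaming keeps the literal of each link, hence every object, and the arrows change by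
    transports that cancel. *)
Lemma is_ps_rename F (t : family S F) A : is_ps t A -> is_ps t (fmap rho A).
Proof.
case=> e [L [s tE]]; exists (etrans (erase_rename A) e), (map rho L).
have [s1 s1E] := wstruct_map s.
have [s2 s2E] : exists s2 : struct (link_word (map rho L)) (formula_word (fmap rho A)),
    forall R e1 e2, wstruct R s2 ∘ cast e1 = cast e2 ∘ wstruct R s.
  move: (wmap_link L) (wmap_formula A); case: _ /; case: _ /.
  exists s1 => R e1 e2.
  by rewrite (cast_irr e1 (wob_map R _)) (cast_irr e2 (wob_map R _)) s1E.
exists s2 => R; rewrite tE /ps_val.
have e1 : wob R (link_word L) = wob R (link_word (map rho L)).
  by rewrite -wmap_link -wob_map.
have e2 : wob R (formula_word A) = wob R (formula_word (fmap rho A)).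
  by rewrite -wmap_formula -wob_map.
have e3 : fob (D := S) R R (erase (fmap rho A)) = fob (D := S) R R (erase A).
  by rewrite erase_rename.
rewrite (units_map e1) (mixify_map e2 e3).
set h1 := cast (f_equal _ _); set h2 := cast (f_equal _ _).
have -> : h2 = h1 ∘ cast (C := S) e3 by rewrite (castM _ _ (f_equal (fob (D := S) R R) (etrans (erase_rename A) e))).
rewrite -!compA; do 3!congr (_ ∘ _).
by rewrite (compAE (s2E R e1 e2)) -!compA.
Qed.

End Rename.

End Links.

(** The hypothesis compares the transposes [X -> (Z ⊗ W^⊥)^⊥] under the adjunction of [- ⊗ Z] with
    the internal hom. *)
Lemma curry_inj (D : starcat) (X Z W : D) (f g : hom (X ⊗ Z) W) :
  name (ev W ∘ sym W (W^⊥) ∘ (f ⊠ 1) ∘ associ X Z (W^⊥)) =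
  name (ev W ∘ sym W (W^⊥) ∘ (g ⊠ 1) ∘ associ X Z (W^⊥)) -> f = g.
Proof.
move=> e; apply: (mono_l (chiK W)); rewrite !name_comp; congr name.
have aK := assocK X Z (W^⊥); apply: (epi_l aK).
by rewrite -(nameK (_ ∘ associ _ _ _)) e nameK.
Qed.

(** * Sums in a compact closed category with biproducts *)

Section Additive.
Variables (C : compact) (P : biproducts C).
Local Notation S := (compact_star C).
Local Notation "0" := (zerom P _ _).
Local Notation "f + g" := (addm P f g).
Implicit Types X Y Z W : C.

Lemma zeroM X Y Z (f : hom Y Z) : f ∘ zerom P X Y = zerom P X Z.
Proof. by rewrite /zerom compA (zfrom_uniq (f ∘ _)). Qed.

Lemma Mzero X Y Z (f : hom X Y) : zerom P Y Z ∘ f = zerom P X Z.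
Proof. by rewrite /zerom -compA (zto_uniq (_ ∘ f)). Qed.

Lemma bpair_comp X X' Y Z (f : hom X Y) (g : hom X Z) (h : hom X' X) :
  bpair P f g ∘ h = bpair P (f ∘ h) (g ∘ h).
Proof. by rewrite (bpair_uniq (bpair P f g ∘ h)) !compA bpair1 bpair2. Qed.

Lemma bpair_l0 X Y Z (k : hom X Y) : bpair P k (zerom P X Z) = bin1 P Y Z ∘ k.
Proof.
rewrite [RHS]bpair_uniq !compA bpr1_bin1 bpr2_bin1 comp1m.
by rewrite -/(zerom P _ _) Mzero.
Qed.

Lemma bpair_0r X Y Z (k : hom X Z) : bpair P (zerom P X Y) k = bin2 P Y Z ∘ k.
Proof.
rewrite [RHS]bpair_uniq !compA bpr2_bin2 bpr1_bin2 comp1m.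
by rewrite -/(zerom P _ _) Mzero.
Qed.

Lemma bip_ext X Y Z (f g : hom (bip P X Y) Z) :
  f ∘ bin1 P X Y = g ∘ bin1 P X Y -> f ∘ bin2 P X Y = g ∘ bin2 P X Y -> f = g.
Proof. by move=> e1 e2; rewrite (bcopair_uniq f) e1 e2 -bcopair_uniq. Qed.

Lemma bip_ext_r X Y Z (f g : hom Z (bip P X Y)) :
  bpr1 P X Y ∘ f = bpr1 P X Y ∘ g -> bpr2 P X Y ∘ f = bpr2 P X Y ∘ g -> f = g.
Proof. by move=> e1 e2; rewrite (bpair_uniq f) e1 e2 -bpair_uniq. Qed.

Lemma addm0 X Y (f : hom X Y) : f + 0 = f.
Proof. by rewrite /addm bpair_l0 compA bcopair1 comp1m. Qed.

Lemma add0m X Y (f : hom X Y) : 0 + f = f.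
Proof. by rewrite /addm bpair_0r compA bcopair2 comp1m. Qed.

Lemma addm_compl X X' Y (f g : hom X Y) (h : hom X' X) : (f + g) ∘ h = f ∘ h + g ∘ h.
Proof. by rewrite /addm -compA bpair_comp. Qed.

Lemma addm_compr X Y Z (f g : hom X Y) (h : hom Y Z) : h ∘ (f + g) = h ∘ f + h ∘ g.
Proof.
have e : h ∘ bcopair P 1 1 = (h ∘ bpr1 P Y Y) + (h ∘ bpr2 P Y Y).
  apply: bip_ext; rewrite addm_compl -!compA ?bcopair1 ?bcopair2.
    by rewrite bpr1_bin1 bpr2_bin1 -/(zerom P _ _) zeroM addm0.
  by rewrite bpr2_bin2 bpr1_bin2 -/(zerom P _ _) zeroM add0m.
by rewrite {1}/addm compA e addm_compl -!compA bpair1 bpair2.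
Qed.

Lemma bip_split X Y :
  idm (bip P X Y) = (bin1 P X Y ∘ bpr1 P X Y) + (bin2 P X Y ∘ bpr2 P X Y).
Proof.
apply: bip_ext; rewrite addm_compl -!compA comp1m.
  by rewrite bpr1_bin1 bpr2_bin1 -/(zerom P _ _) zeroM addm0 compm1.
by rewrite bpr1_bin2 bpr2_bin2 -/(zerom P _ _) zeroM add0m compm1.
Qed.

(** Sums of pairs are computed componentwise. As in the Eckmann-Hilton argument, inserting zeros
    then gives associativity and commutativity. *)
Lemma addmACA X Y (a b c d : hom X Y) : (a + b) + (c + d) = (a + c) + (b + d).
Proof.
have e u v : u + v = bcopair P 1 1 ∘ bpair P u v :> hom X Y by [].
rewrite (e a b) (e c d) -addm_compr (e (a + c)); congr (_ ∘ _).
by apply: bip_ext_r; rewrite addm_compr ?bpair1 ?bpair2.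
Qed.

Lemma addmA X Y (a b c : hom X Y) : a + (b + c) = (a + b) + c.
Proof. by rewrite -{2}(add0m c) addmACA addm0. Qed.

Lemma addmC X Y (a b : hom X Y) : a + b = b + a.
Proof. by rewrite -{1}(add0m a) -{1}(addm0 b) addmACA add0m addm0. Qed.

(* Tensoring is a left adjoint, so it preserves biproducts, hence sums. *)
Lemma tens_ext X Y Z W (f g : hom (bip P X Y ⊗ Z) W) :
  f ∘ (bin1 P X Y ⊠ 1) = g ∘ (bin1 P X Y ⊠ 1) ->
  f ∘ (bin2 P X Y ⊠ 1) = g ∘ (bin2 P X Y ⊠ 1) -> f = g.
Proof.
move=> e1 e2; apply: (@curry_inj S); apply: bip_ext; rewrite !(@name_comp S).
  rewrite -!(compA _ (associ _ _ _)) -tensm1 associ_nat !(compA _ (_ ⊠ 1)).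
  rewrite -!(compA _ (_ ⊠ 1) (_ ⊠ 1)) -!tensM1.
  by rewrite e1.
rewrite -!(compA _ (associ _ _ _)) -tensm1 associ_nat !(compA _ (_ ⊠ 1)).
rewrite -!(compA _ (_ ⊠ 1) (_ ⊠ 1)) -!tensM1.
by rewrite e2.
Qed.

Lemma zero_tens1 X Y Z : zerom P X Y ⊠ idm Z = zerom P (X ⊗ Z) (Y ⊗ Z).
Proof.
have u W (f g : hom (zob P ⊗ Z) W) : f = g.
  by apply: (@curry_inj S); rewrite [LHS]zfrom_uniq [RHS]zfrom_uniq.
by rewrite {1}/zerom tensM1 (u _ (zfrom P Y ⊠ 1) (zerom P _ _)) Mzero.
Qed.

Lemma addm_tens1 X Y Z (f g : hom X Y) : (f + g) ⊠ idm Z = (f ⊠ 1) + (g ⊠ 1).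
Proof.
have e : idm (bip P Y Y ⊗ Z) =
    ((bin1 P Y Y ∘ bpr1 P Y Y) ⊠ 1) + ((bin2 P Y Y ∘ bpr2 P Y Y) ⊠ 1).
  apply: tens_ext; rewrite addm_compl comp1m -!tensM1 -!compA.
    rewrite bpr1_bin1 bpr2_bin1 -/(zerom P _ _) zeroM zero_tens1 compm1.
    by rewrite addm0.
  rewrite bpr1_bin2 bpr2_bin2 -/(zerom P _ _) zeroM zero_tens1 compm1.
  by rewrite add0m.
rewrite {1}/addm tensM1 -(comp1m (bpair P f g ⊠ 1)) e addm_compl addm_compr.
by rewrite -!tensM1 -!compA bpair1 bpair2 !compA bcopair1 bcopair2 !comp1m.
Qed.

Lemma zero_tens X Y Z W (f : hom Z W) : zerom P X Y ⊠ f = zerom P _ _.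
Proof. by rewrite tensm_l zero_tens1 Mzero. Qed.

Lemma addm_tens X Y Z W (f g : hom X Y) (h : hom Z W) :
  (f + g) ⊠ h = (f ⊠ h) + (g ⊠ h).
Proof. by rewrite tensm_l addm_tens1 addm_compl -!tensm_l. Qed.

Lemma tens_swap X Y Z W (h : hom Z W) (f : hom X Y) :
  h ⊠ f = sym Y W ∘ (f ⊠ h) ∘ sym Z X.
Proof. by rewrite sym_nat -compA symK compm1. Qed.

Lemma tens_addm X Y Z W (h : hom Z W) (f g : hom X Y) :
  h ⊠ (f + g) = (h ⊠ f) + (h ⊠ g).
Proof. by rewrite !(tens_swap h) addm_tens addm_compr addm_compl. Qed.

Lemma addm_dualm X Y (f g : hom X Y) :
  @dualm S _ _ (f + g) = @dualm S _ _ f + @dualm S _ _ g.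
Proof.
apply: (@ev_inj S); rewrite ev_dualm addm_tens tens_addm !addm_compr.
by rewrite -!(@ev_dualm S).
Qed.

(** The algebraic preorder of the sums. It is compatible with composition, tensor and duals, and
    over a zero-sum-free semiring everything below 0 is 0. *)
Definition ge X Y (f g : hom X Y) : Prop := exists h, f = g + h.

Lemma ge_refl X Y (f : hom X Y) : ge f f.
Proof. by exists 0; rewrite addm0. Qed.

Lemma ge_addr X Y (f g : hom X Y) : ge (f + g) g.
Proof. by exists f; rewrite addmC. Qed.

Lemma ge_addl X Y (f g : hom X Y) : ge (f + g) f.
Proof. by exists g. Qed.

Lemma ge_trans X Y (f g h : hom X Y) : ge f g -> ge g h -> ge f h.
Proof. by move=> [a ->] [b ->]; exists (b + a); rewrite addmA. Qed.

Lemma ge_comp X Y Z (f f' : hom Y Z) (g g' : hom X Y) :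
  ge f f' -> ge g g' -> ge (f ∘ g) (f' ∘ g').
Proof.
move=> [a ->] [b ->]; rewrite addm_compl !addm_compr -addmA.
exact: ge_addl.
Qed.

Lemma ge_tens X Y Z W (f f' : hom X Y) (g g' : hom Z W) :
  ge f f' -> ge g g' -> ge (f ⊠ g) (f' ⊠ g').
Proof.
move=> [a ->] [b ->]; rewrite addm_tens !tens_addm -addmA.
exact: ge_addl.
Qed.

Lemma ge_dualm X Y (f f' : hom X Y) : ge f f' -> ge (@dualm S _ _ f) (@dualm S _ _ f').
Proof. by move=> [a ->]; rewrite addm_dualm; apply: ge_addl. Qed.

Lemma ge_big X Y n (F : 'I_n -> hom X Y) k :
  ge (\big[addm P/zerom P X Y]_(i < n) F i) (F k).
Proof.
have : k \in index_enum 'I_n by rewrite mem_index_enum.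
elim: (index_enum _) => //= i r IH; rewrite inE big_cons => /orP[/eqP <-|/IH h].
  exact: ge_addl.
exact: ge_trans (ge_addr _ _) h.
Qed.

Lemma ge0 (zsf : zero_sum_free P) (s r : hom (@unit C) unit) :
  ge s r -> s = 0 -> r = 0.
Proof. by move=> [t ->] e; apply: zsf; exists t. Qed.

Lemma comp_big X Y Z n (F : 'I_n -> hom X Y) (g : hom Y Z) :
  g ∘ (\big[addm P/zerom P X Y]_(i < n) F i) =
  \big[addm P/zerom P X Z]_(i < n) (g ∘ F i).
Proof.
apply: (big_morph (comp g)) => [f f'|]; [exact: addm_compr|exact: zeroM].
Qed.

Lemma comp_scalem X Y Z a (f : hom X Y) (g : hom Y Z) :
  g ∘ scalem a f = scalem a (g ∘ f).
Proof.
rewrite /scalem !compA -lun_nat -(compA (lun Z)) -tensmM comp1m.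
by [].
Qed.

Lemma scalem0 X Y (f : hom X Y) : scalem (zerom P unit unit) f = zerom P X Y.
Proof. by rewrite /scalem zero_tens zeroM Mzero. Qed.

Lemma scalemD X Y a b (f : hom X Y) :
  scalem (a + b) f = scalem a f + scalem b f.
Proof. by rewrite /scalem addm_tens addm_compr addm_compl. Qed.

Lemma scalem_id a : scalem a (idm (@unit C)) = a.
Proof. by rewrite /scalem lun_run run_nat -compA luni_runi runiK compm1. Qed.

Lemma scale1m X Y (f : hom X Y) : scalem 1 f = f.
Proof. by rewrite /scalem lun_nat -compA luniK compm1. Qed.

Lemma big_scalem X Y n (a : 'I_n -> hom (@unit C) unit) (f : hom X Y) :
  \big[addm P/zerom P X Y]_(i < n) scalem (a i) f =
  scalem (\big[addm P/zerom P unit unit]_(i < n) a i) f.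
Proof.
symmetry; apply: (big_morph (fun a => scalem a f)) => [b c|].
  exact: scalemD.
exact: scalem0.
Qed.

End Additive.

(** * Tests in the double glueing *)

Section ParUnit.
Variables (D : starcat) (i : hom (@unit D) bot).
Implicit Types X Y : D.

(** The unit of par is [bot], but tests send an argument of a par to [unit]; [i] bridges the two. *)
Definition parun X : hom (X ⅋ unit) X := chii X ∘ dualm ((1 ⊠ i) ∘ runi (X^⊥)).
Definition parunl X : hom (unit ⅋ X) X := chii X ∘ dualm ((i ⊠ 1) ∘ luni (X^⊥)).

Lemma parmM A B E A' B' E' (g : hom B E) (f : hom A B) (g' : hom B' E') (f' : hom A' B') :
  @parm D _ _ _ _ (g ∘ f) (g' ∘ f') = parm g g' ∘ parm f f'.
Proof. by rewrite /parm !dualmM tensmM dualmM. Qed.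

Lemma parun_nat X Y (f : hom X Y) : f ∘ parun X = parun Y ∘ parm f 1.
Proof.
rewrite /parun /parm dualm1 -compA -dualmM compA chii_nat -compA -dualmM.
congr (_ ∘ dualm _); rewrite !compA -tensmM comp1m compm1 -compA -runi_nat.
by rewrite compA -tensmM comp1m compm1.
Qed.

Lemma parunl_nat X Y (f : hom X Y) : f ∘ parunl X = parunl Y ∘ parm 1 f.
Proof.
rewrite /parunl /parm dualm1 -compA -dualmM compA chii_nat -compA -dualmM.
congr (_ ∘ dualm _); rewrite !compA -tensmM comp1m compm1 -compA -luni_nat.
by rewrite compA -tensmM comp1m compm1.
Qed.

Lemma parun_unit (j : hom bot unit) : i ∘ j = 1 -> parun unit = parunl unit.
Proof.
move=> ij; congr (_ ∘ dualm _); apply: (epi_l ij).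
rewrite -!compA -runi_nat -luni_nat !compA -!tensmM !comp1m compm1.
by rewrite luni_runi.
Qed.

End ParUnit.

Lemma dualm_copoint (D : starcat) (A : D) (x : hom A bot) :
  x ∘ chii A = dualm (dualm x ∘ chi unit).
Proof. by rewrite dualmM chii_nat chii_dual. Qed.

Section Pairing.
Variable C : compact.
Local Notation S := (compact_star C).

(** The zigzag law slides the transpose of [v] along [eta X] until it meets [f]. *)
Lemma pairE (X : C) (f : hom X unit) (v : hom unit X) :
  lun unit ∘ (f ⊠ (iotai C ∘ @dualm S _ _ v)) ∘ eta X = f ∘ v.
Proof.
set g := iotai C ∘ _.
have eg : eps X ∘ (1 ⊠ v) = g ∘ run _.
  have e : iota C ∘ (eps unit ∘ (@dualm S _ _ v ⊠ 1)) = iota C ∘ (eps X ∘ (1 ⊠ v)).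
    by rewrite !compA; apply: (@ev_dualm S _ _ v).
  rewrite -(mono_l (iotaK C) e).
  have -> : eps unit = iotai C ∘ run (cdual (@unit C)) by rewrite -compA runK compm1.
  by rewrite -compA run_nat compA.
have := epslK v; rewrite eg /ctrl tens1M -!compA (compAE (run_assoc _ _)).
rewrite (compAE (run_nat _)) luni_runi -!compA runiK compm1 => <-.
rewrite !compA; congr (_ ∘ _).
by rewrite -run_nat -compA -tensmM comp1m compm1 lun_run.
Qed.

End Pairing.

Section WordFunctional.
Variables (C : compact) (N : nat) (R : 'I_N -> C).
Variables (f : forall x : link N, hom (R x.1) unit)
  (g : forall x : link N, hom (cdual (R x.1)) unit).

Fixpoint wval (w : word (link N)) : hom (wob R w) unit :=
  match w with
  | WUnit => 1
  | WLit b x => if b return hom (wob R (WLit b x)) unit then f x else g x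
  | WTens v w => lun _ ∘ (wval v ⊠ wval w)
  end.

(** By naturality the structural arrow moves to powers of [unit], where [lun] and [run] agree and
    the symmetry is absorbed. *)
Lemma wval_struct v w (s : struct v w) : wval w ∘ wstruct R s = wval v.
Proof.
elim: s => {v w} [v|u v w s IHs r IHr|v w v' w' s IHs r IHr|u v w|u v w|v|v|v|v|v w] /=.
- by rewrite compm1.
- by rewrite compA IHs.
- by rewrite -compA -tensmM IHs IHr.
- have e : wval u ⊠ (lun unit ∘ (wval v ⊠ wval w)) =
      (1 ⊠ lun unit) ∘ (wval u ⊠ (wval v ⊠ wval w)) by rewrite -tensmM comp1m.
  have e' : (lun unit ∘ (wval u ⊠ wval v)) ⊠ wval w =
      (lun unit ⊠ 1) ∘ ((wval u ⊠ wval v) ⊠ wval w) by rewrite -tensmM comp1m.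
  rewrite e e' -!compA -assoc_nat; congr (_ ∘ _); rewrite compA; congr (_ ∘ _).
  by rewrite triangle lun_run.
- have e : wval u ⊠ (lun unit ∘ (wval v ⊠ wval w)) =
      (1 ⊠ lun unit) ∘ (wval u ⊠ (wval v ⊠ wval w)) by rewrite -tensmM comp1m.
  have e' : (lun unit ∘ (wval u ⊠ wval v)) ⊠ wval w =
      (lun unit ⊠ 1) ∘ ((wval u ⊠ wval v) ⊠ wval w) by rewrite -tensmM comp1m.
  rewrite e e' -!compA -associ_nat; congr (_ ∘ _); rewrite compA; congr (_ ∘ _).
  by rewrite {1}lun_run -triangle -compA associK compm1.
- by rewrite lun_nat.
- by rewrite -compA luni_nat compA luniK comp1m.
- by rewrite lun_run run_nat.
- by rewrite -compA runi_nat compA lun_run runiK comp1m.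
by rewrite -compA -sym_nat compA lun_sym lun_run.
Qed.

Lemma wval_units L :
  (forall x, x \in L -> lun unit ∘ (f x ⊠ g x) ∘ eta (R x.1) = 1) ->
  wval (link_word L) ∘ units R L = 1.
Proof.
elim: L => [|x L IH] h /=; first by rewrite comp1m.
rewrite -compA (compA (_ ⊠ _)) -tensmM h ?mem_head // IH => [|y yL].
  by rewrite tensm1 comp1m luniK.
by apply: h; rewrite inE yL orbT.
Qed.

End WordFunctional.

Lemma plugl_pt (D : smcat) (X Y : D) (b : hom unit X) (x : hom unit Y) :
  ((b ⊠ 1) ∘ luni Y) ∘ x = (b ⊠ x) ∘ luni unit.
Proof. by rewrite -compA -luni_nat compA -tensmM comp1m compm1. Qed.

Lemma plugr_pt (D : smcat) (X Y : D) (b : hom unit X) (x : hom unit Y) :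
  ((1 ⊠ x) ∘ runi X) ∘ b = (b ⊠ x) ∘ luni unit.
Proof. by rewrite -compA -runi_nat compA -tensmM comp1m compm1 luni_runi. Qed.

Lemma run_pt (D : smcat) (X Y : D) (k : hom Y unit) (b : hom unit X) (x : hom unit Y) :
  k ∘ x = 1 -> (run X ∘ (1 ⊠ k)) ∘ ((b ⊠ x) ∘ luni unit) = b.
Proof.
move=> e; rewrite -compA (compA (1 ⊠ k)) -tensmM e comp1m compA run_nat -compA.
by rewrite luni_runi runiK compm1.
Qed.

Lemma lun_pt (D : smcat) (X Y : D) (k : hom X unit) (b : hom unit X) (x : hom unit Y) :
  k ∘ b = 1 -> (lun Y ∘ (k ⊠ 1)) ∘ ((b ⊠ x) ∘ luni unit) = x.
Proof.
move=> e; rewrite -compA (compA (k ⊠ 1)) -tensmM e comp1m compA lun_nat -compA.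
by rewrite luniK compm1.
Qed.

Section Test.
Variables (C : compact) (P : biproducts C).
Local Notation S := (compact_star C).
Local Notation G := (light_mix C).
Local Notation "0" := (zerom P _ _).

Definition car (X : G) : S := gcar (sval X).

Definition bas (b : bool) : hom (@unit C) (bip P unit unit) :=
  if b then bin2 P unit unit else bin1 P unit unit.
Definition cob (b : bool) : hom (bip P unit unit) (@unit C) :=
  if b then bpr2 P unit unit else bpr1 P unit unit.
Definition tot : hom (bip P unit unit) (@unit C) := bcopair P 1 1.

Lemma cob_bas b : cob b ∘ bas b = 1.
Proof. by case: b; [apply: bpr2_bin2|apply: bpr1_bin1]. Qed.

Lemma cob_basN b : cob (~~ b) ∘ bas b = zerom P unit unit.
Proof. by case: b; [apply: bpr1_bin2|apply: bpr2_bin1]. Qed.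

Lemma tot_bas b : tot ∘ bas b = 1.
Proof. by case: b; [apply: bcopair2|apply: bcopair1]. Qed.

Definition gM : gobj S :=
  @GObj S (bip P unit unit) (fun u => exists b, u = bas b) (fun x => x = iota C ∘ tot).

Lemma orth_gM : @orth S (iota C) gM.
Proof. by move=> _ _ [b ->] ->; rewrite -compA tot_bas compm1. Qed.

Definition M : G := exist _ gM orth_gM.

Lemma garrow_bas b : @garrow S (@gunit S (iota C)) gM (bas b).
Proof.
split=> [_ ->|_ ->]; first by exists b; rewrite compm1.
by rewrite /= -compA tot_bas compm1.
Qed.

Lemma garrow_tot : @garrow S gM (@gunit S (iota C)) tot.
Proof. by split=> [_ [b ->]|_ ->] //; rewrite tot_bas. Qed.

Lemma garrow_iota : @garrow S (@gunit S (iota C)) (gdual (@gunit S (iota C))) (iota C).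
Proof.
split=> [_ ->|y /gcopt_bot ->]; last exact: comp1m.
by apply/gpt_bot; rewrite compm1.
Qed.

Definition basG (b : bool) : @hom G unit M := exist _ (bas b) (garrow_bas b).
Definition totG : @hom G M unit := exist _ tot garrow_tot.
Definition iotaG : @hom G unit bot :=
  exist (@garrow S (@gunit S (iota C)) (gdual (@gunit S (iota C)))) (iota C) garrow_iota.

Definition Rs : G := M ⊗ M^⊥.
Definition dtotG : @hom G unit (M^⊥) := dualm totG ∘ iotaG.
(** On a positive literal one factor of [Rs] is used and the other discarded, [M] by [totG] and
    [M^⊥] by evaluation at the arbitrary vector [basG false]. On a negative literal a factor is
    filled instead, with [basG false] or with [dtotG], the only point of [M^⊥]. *)
Definition outp : @hom G Rs M := run M ∘ (1 ⊠ (mixm ∘ dualm (basG false))).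
Definition inp : @hom G Rs (M^⊥) := lun _ ∘ (totG ⊠ 1).
Definition outn : @hom G (Rs^⊥) M := chii M ∘ dualm ((basG false ⊠ 1) ∘ luni (M^⊥)).
Definition inn : @hom G (Rs^⊥) (M^⊥) := dualm ((1 ⊠ dtotG) ∘ runi M).
Definition cstp : @hom G Rs unit := totG ∘ outp.
Definition cstn (j : bool) : @hom G (Rs^⊥) unit :=
  mixm ∘ dualm ((basG j ⊠ dtotG) ∘ luni unit).

Definition dcob (b : bool) : hom (car (M^⊥)) (@unit C) :=
  iotai C ∘ @dualm S _ _ (bas b).

(* How a test treats a literal: it reads off a basis vector, feeds one in, or
   plugs in a constant. *)
Inductive label := Out | In | Const of bool.

Definition lobj (b : bool) : G := if b then Rs else Rs^⊥.

(** The bit of a constant matters at a negative literal, where it is the vector handed to the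
    positive end of the link. *)
Definition lval (b : bool) (l : label) (i : bool) : hom (car (lobj b)) (@unit C) :=
  if b as b return hom (car (lobj b)) (@unit C) then
    match l with
    | Out => cob i ∘ sval outp
    | In => dcob i ∘ sval inp
    | Const _ => sval cstp
    end
  else
    match l with
    | Out => cob i ∘ sval outn
    | In => dcob i ∘ sval inn
    | Const j => sval (cstn j)
    end.

(** The vector at which a functional on [Rs^⊥] evaluates, see [lval_neg]. It lives in [C] and need
    not be a point of [Rs]. *)
Definition lpt (l : label) (i : bool) : hom (@unit C) (car Rs) :=
  match l with
  | Out => (bas false ⊠ (@dualm S _ _ (iota C ∘ cob i) ∘ chi (@unit S))) ∘ luni unit
  | In => (bas i ⊠ sval dtotG) ∘ luni unit
  | Const j => (bas j ⊠ sval dtotG) ∘ luni unit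
  end.

Lemma lval_neg l i : lval false l i = iotai C ∘ @dualm S _ _ (lpt l i).
Proof.
case: l => [||j] //.
- have e : cob i ∘ @chii S (bip P unit unit) =
     iotai C ∘ @dualm S _ _ (@dualm S _ _ (iota C ∘ cob i) ∘ chi (@unit S)).
    have := @dualm_copoint S _ (iota C ∘ cob i); rewrite -compA => <-.
    by rewrite (compA (iotai C)) iotaK comp1m.
  rewrite /lval [sval outn]/(_ ∘ _) (compA (cob i)) e -(compA (iotai C)).
  rewrite -(@dualmM S); congr (_ ∘ dualm _); exact: plugl_pt.
rewrite /lval [sval inn]/(@dualm S _ _ _) /dcob -(compA (iotai C)) -(@dualmM S).
by congr (_ ∘ dualm _); exact: plugr_pt.
Qed.

Lemma dtot_bas b : iotai C ∘ @dualm S _ _ (bas b) ∘ sval dtotG = 1.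
Proof.
rewrite [sval dtotG]/(@dualm S _ _ tot ∘ iota C) -(compA (iotai C)).
rewrite (compA (@dualm S _ _ (bas b))) -(@dualmM S) tot_bas dualm1.
by rewrite comp1m iotaK.
Qed.

Lemma outp_pt b (x : hom (@unit C) (car (M^⊥))) :
  iotai C ∘ @dualm S _ _ (bas false) ∘ x = 1 ->
  sval outp ∘ ((bas b ⊠ x) ∘ luni unit) = bas b.
Proof. exact: run_pt. Qed.

Lemma inp_pt b (x : hom (@unit C) (car (M^⊥))) :
  sval inp ∘ ((bas b ⊠ x) ∘ luni unit) = x.
Proof. by apply: lun_pt; apply: tot_bas. Qed.

(** Labels of the positive and of the negative end for which a link contributes the factor 1.
    Reading against a constant depends on [i], since the constant is the vector read. *)
Definition compat (l l' : label) (i : bool) : bool :=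
  match l, l' with
  | Const _, Const _ | Out, In | In, Out => true
  | Out, Const j => j == i
  | _, _ => false
  end.

Lemma pair_compat l l' i : compat l l' i ->
  lun unit ∘ (lval true l i ⊠ lval false l' i) ∘ eta (car Rs) = 1.
Proof.
rewrite lval_neg pairE; case: l => [||j]; case: l' => [||j'] //.
- move=> _; rewrite [lval _ _ _]/(cob i ∘ sval outp) -(compA (cob i)).
  by rewrite outp_pt ?cob_bas ?dtot_bas.
- move=> /eqP ->; rewrite [lval _ _ _]/(cob i ∘ sval outp) -(compA (cob i)).
  by rewrite outp_pt ?cob_bas ?dtot_bas.
- move=> _; rewrite [lval _ _ _]/(dcob i ∘ sval inp) -(compA (dcob i)).
  rewrite inp_pt /dcob -(compA (iotai C)) (compA (@dualm S _ _ (bas i))).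
  rewrite -(@dualmM S) -(compA (iota C)) cob_bas compm1.
  by rewrite (@copoint_unit S) iotaK.
move=> _; rewrite [lval _ _ _]/(tot ∘ sval outp) -(compA tot).
by rewrite outp_pt ?tot_bas ?dtot_bas.
Qed.

Section Formula.
Variables (N : nat) (lb : bool -> link N -> label) (i : bool).
Implicit Types A B : formula (link N).

Definition Rf : 'I_N -> G := fun _ => Rs.

Fixpoint theta A : hom (car (fob Rf Rf (erase A))) (@unit C) :=
  match A with
  | Lit b x =>
    if b as b return hom (car (fob Rf Rf (erase (Lit b x)))) (@unit C)
    then lval true (lb true x) i else lval false (lb false x) i
  | Tens A B => lun unit ∘ (theta A ⊠ theta B)
  | Par A B => parun (iota C : hom (@unit S) bot) unit ∘ parm (D := S) (theta A) (theta B)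
  end.

End Formula.

Section Tests.
Variables (N : nat) (lb : bool -> link N -> label).
Implicit Types A B : formula (link N).

(** One arrow [f] serves both values of [i], so that the two coordinates are taken of the same point
    of [Y]. *)
Definition test A (Y : G) (y : bool -> hom (car Y) (@unit C)) : Prop :=
  exists f : @hom G (fob (@Rf N) (@Rf N) (erase A)) Y,
    forall i, ge P (y i ∘ sval f) (theta lb i A).

Lemma test_map A (Y Z : G) (g : @hom G Y Z) y z :
  test A y -> (forall i, ge P (z i ∘ sval g) (y i)) -> @test A Z z.
Proof.
move=> [f hf] h; exists (g ∘ f) => i; apply: ge_trans (hf i).
rewrite [sval (g ∘ f)]/(sval g ∘ sval f) compA.
exact: ge_comp (h i) (ge_refl _ _).
Qed.

Lemma test_tens A B (Y Z : G) y z : @test A Y y -> @test B Z z ->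
  @test (Tens A B) (Y ⊗ Z) (fun i => lun unit ∘ (y i ⊠ z i)).
Proof.
move=> [f hf] [g hg]; exists (f ⊠ g) => i.
rewrite [sval (f ⊠ g)]/(sval f ⊠ sval g) -compA -tensmM.
by apply: ge_comp; [apply: ge_refl|apply: ge_tens].
Qed.

Lemma test_parl A B (Y : G) y :
  @test A Y y -> @test B unit (fun _ => 1) -> @test (Par A B) Y y.
Proof.
move=> [f hf] [g hg]; exists (parun (iotaG : @hom G unit bot) Y ∘ parm f g) => i.
rewrite [sval (_ ∘ parm f g)]/(@parun S (iota C) (car Y) ∘ @parm S _ _ _ _ (sval f) (sval g)).
rewrite compA (@parun_nat S) -(compA (parun _ _)) -(@parmM S) comp1m.
apply: ge_comp; first exact: ge_refl.
apply/ge_dualm/ge_tens; apply/ge_dualm; first exact: hf.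
by have := hg i; rewrite comp1m.
Qed.

Lemma test_parr A B (Y : G) y :
  @test A unit (fun _ => 1) -> @test B Y y -> @test (Par A B) Y y.
Proof.
move=> [f hf] [g hg]; exists (parunl (iotaG : @hom G unit bot) Y ∘ parm f g) => i.
rewrite [sval (_ ∘ parm f g)]/(@parunl S (iota C) (car Y) ∘ @parm S _ _ _ _ (sval f) (sval g)).
rewrite compA (@parunl_nat S) -(compA (parunl _ _)) -(@parmM S) comp1m.
rewrite /= (@parun_unit S _ (iotai C) (iotaiK C)).
apply: ge_comp; first exact: ge_refl.
apply/ge_dualm/ge_tens; apply/ge_dualm; last exact: hg.
by have := hf i; rewrite comp1m.
Qed.

Lemma test_lit b x (Y : G) (f : @hom G (lobj b) Y) y :
  (forall i, y i ∘ sval f = lval b (lb b x) i) -> @test (Lit b x) Y y.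
Proof. by case: b f => f e; exists f => i; rewrite e; apply: ge_refl. Qed.

Lemma test_out b x : lb b x = Out -> @test (Lit b x) M cob.
Proof.
move=> e; apply: (@test_lit b x M (if b return @hom G (lobj b) M then outp else outn)).
by rewrite e; case: b {e}.
Qed.

Lemma test_in b x : lb b x = In -> @test (Lit b x) (M^⊥) dcob.
Proof.
move=> e; apply: (@test_lit b x (M^⊥) (if b return @hom G (lobj b) (M^⊥) then inp else inn)).
by rewrite e; case: b {e}.
Qed.

Lemma test_const b x j : lb b x = Const j -> @test (Lit b x) unit (fun _ => 1).
Proof.
move=> e; apply: (@test_lit b x unit (if b return @hom G (lobj b) unit then cstp else cstn j)).
by rewrite e; case: b {e} => i; rewrite comp1m.
Qed.

Lemma test_unitr A (Y : G) y :
  @test A (Y ⊗ unit) (fun i => lun unit ∘ (y i ⊠ 1)) -> @test A Y y.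
Proof.
move=> h; apply: (test_map (g := (run Y : @hom G (Y ⊗ unit) Y)) h) => i.
rewrite [sval (run Y)]/(run (car Y)) lun_run run_nat.
exact: ge_refl.
Qed.

Lemma test_unitl A (Y : G) y :
  @test A (unit ⊗ Y) (fun i => lun unit ∘ (1 ⊠ y i)) -> @test A Y y.
Proof.
move=> h; apply: (test_map (g := (lun Y : @hom G (unit ⊗ Y) Y)) h) => i.
rewrite [sval (lun Y)]/(lun (car Y)) lun_nat.
exact: ge_refl.
Qed.

Definition pcob (i : bool) : hom (car (M ⊗ M^⊥)) (@unit C) :=
  lun unit ∘ (cob i ⊠ dcob i).

Lemma test_sym A :
  @test A (M^⊥ ⊗ M) (fun i => lun unit ∘ (dcob i ⊠ cob i)) ->
  @test A (M ⊗ M^⊥) pcob.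
Proof.
move=> h; apply: (test_map (g := (sym (M^⊥) M : @hom G (M^⊥ ⊗ M) _)) h) => i.
rewrite [X in ge _ (_ ∘ X) _]/(sym (car (M^⊥)) (car M)) /pcob -compA -sym_nat compA.
by rewrite lun_sym lun_run; apply: ge_refl.
Qed.

(** The identity of the carrier of [M] is the sum of the projections [bas i ∘ cob i]; keeping one
    summand inside the evaluation leaves [pcob i]. *)
Lemma pcob_le_ev i :
  ge P (iotai C ∘ @ev S (car M) ∘ sym (car M) (car (M^⊥))) (pcob i).
Proof.
set h := _ ∘ _.
have e : h ∘ (bas i ⊠ 1) = dcob i ∘ lun _.
  rewrite /h -(compA _ (sym _ _)) sym_nat (compA _ (1 ⊠ _)) -(compA (iotai C)).
  rewrite -(@ev_dualm S) ev_unit run_nat -(run_sym (car (M^⊥))).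
  by rewrite (compA (iotai C)) -(compA _ (run _) (sym _ _)).
have eh : h = h ∘ (1 ⊠ 1) by rewrite tensm1 compm1.
have -> : pcob i = h ∘ ((bas i ∘ cob i) ⊠ 1).
  rewrite tensM1 (compA h) e -(lun_nat (dcob i)) -(compA (lun _)) -tensm_r.
  by [].
have hb : ge P (idm (bip P unit unit)) (bas i ∘ cob i).
  by rewrite bip_split; case: (i); [apply: ge_addr|apply: ge_addl].
rewrite {1}eh; apply: ge_comp; first exact: ge_refl.
exact: ge_tens hb (ge_refl _ _).
Qed.

Lemma test_cut A : @test A (M ⊗ M^⊥) pcob -> @test A unit (fun _ => 1).
Proof.
move=> h; apply: (test_map (g := (mixm ∘ ev M ∘ sym M (M^⊥) : @hom G (M ⊗ M^⊥) unit)) h) => i.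
by rewrite comp1m; apply: pcob_le_ev.
Qed.

End Tests.
End Test.

(** * Assembling tests along a formula *)

Section Tests.
Variables (C : compact) (P : biproducts C) (N : nat).
Variable lb : bool -> link N -> label.
Local Notation leaf := (bool * link N)%type.
Local Notation test := (@test C P N lb).
Local Notation M := (M P).
Implicit Types (A B : formula (link N)) (l m : leaf).

Definition active l := if lb l.1 l.2 is Const _ then false else true.

Lemma test_inactive A : (forall l, l \in leaves A -> ~~ active l) ->
  test A (fun _ => idm (@unit C) : hom (car (unit : light_mix C)) _).
Proof.
elim: A => [b x|A IHA B IHB|A IHA B IHB] /= h.
- move: (h (b, x) (mem_head _ _)); rewrite /active /=.
  by case e: (lb b x) => [||j] // _; apply: test_const e.
- apply: test_unitr; apply: (test_tens (IHA _) (IHB _)) => l hl; apply: h.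
    by rewrite mem_cat hl.
  by rewrite mem_cat hl orbT.
by apply: (test_parl (IHA _) (IHB _)) => l hl; apply: h; rewrite mem_cat hl ?orbT.
Qed.

Definition test_single A l : Prop :=
  if lb l.1 l.2 is Out then test A (@cob C P : bool -> hom (car M) _)
  else test A (@dcob C P : bool -> hom (car (M^⊥)%cat) _).

Lemma test_single_active A l : uniq (leaves A) -> l \in leaves A -> active l ->
  (forall m, m \in leaves A -> active m -> m = l) -> test_single A l.
Proof.
rewrite /test_single; elim: A => [b x|A IHA B IHB|A IHA B IHB] /=.
- move=> _; rewrite inE => /eqP -> /=; rewrite /active /=.
  by case e: (lb b x) => [||j] // _ _; [apply: test_out|apply: test_in].
- rewrite cat_uniq mem_cat => /and3P[uA /hasPn dAB uB] lAB al h.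
  have hA m : m \in leaves A -> active m -> m = l by move=> hm; apply: h; rewrite mem_cat hm.
  have hB m : m \in leaves B -> active m -> m = l by move=> hm; apply: h; rewrite mem_cat hm orbT.
  case/orP: lAB => hl.
    have iB : test B (fun _ => idm (@unit C) : hom (car (unit : light_mix C)) _).
      apply: test_inactive => m hm; apply: contraL hm => am.
      by apply/negP => hm; have := dAB _ hm; rewrite (hB m) // hl.
    have := IHA uA hl al hA.
    by case: (lb l.1 l.2) => [||j] t; apply: test_unitr; apply: test_tens t iB.
  have iA : test A (fun _ => idm (@unit C) : hom (car (unit : light_mix C)) _).
    apply: test_inactive => m hm; apply: contraL hm => am.
    by apply/negP => hm; have := dAB _ hl; rewrite -(hA m) // hm.
  have := IHB uB hl al hB.
  by case: (lb l.1 l.2) => [||j] t; apply: test_unitl; apply: test_tens iA t.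
rewrite cat_uniq mem_cat => /and3P[uA /hasPn dAB uB] lAB al h.
have hA m : m \in leaves A -> active m -> m = l by move=> hm; apply: h; rewrite mem_cat hm.
have hB m : m \in leaves B -> active m -> m = l by move=> hm; apply: h; rewrite mem_cat hm orbT.
case/orP: lAB => hl.
  have iB : test B (fun _ => idm (@unit C) : hom (car (unit : light_mix C)) _).
    apply: test_inactive => m hm; apply: contraL hm => am.
    by apply/negP => hm; have := dAB _ hm; rewrite (hB m) // hl.
  have := IHA uA hl al hA.
  by case: (lb l.1 l.2) => [||j] t; apply: test_parl t iB.
have iA : test A (fun _ => idm (@unit C) : hom (car (unit : light_mix C)) _).
  apply: test_inactive => m hm; apply: contraL hm => am.
  by apply/negP => hm; have := dAB _ hl; rewrite -(hA m) // hm.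
have := IHB uB hl al hB.
by case: (lb l.1 l.2) => [||j] t; apply: test_parr iA t.
Qed.

(** [pt] pairs each active leaf with the one that it will meet at a tensor; one of the two is read
    and the other fed. *)
Variable pt : leaf -> leaf.
Hypothesis ptK : forall l, active l -> pt (pt l) = l.
Hypothesis pt_lb : forall l, active l ->
  lb (pt l).1 (pt l).2 = if lb l.1 l.2 is Out then In else Out.

Lemma active_pt l : active l -> active (pt l).
Proof. by move=> al; rewrite /active pt_lb //; case: (lb _ _). Qed.

Lemma test_pair A B l : test_single A l -> test_single B (pt l) -> active l ->
  test (Tens A B) (@pcob C P : bool -> hom (car (M ⊗ M^⊥)%cat) _).
Proof.
rewrite /test_single /active => tA tB al; move: tA tB; rewrite pt_lb //.
move: al; case: (lb l.1 l.2) => // _ tA tB; first exact: test_tens tA tB.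
by apply: test_sym; apply: test_tens tA tB.
Qed.

Definition pairs_in A : Prop := forall l, l \in leaves A -> active l ->
  pt l \in leaves A /\ coh A l (pt l).
Definition pairs_only A : Prop :=
  forall l m, active l -> active m -> coh A l m -> m = pt l.

(** At a tensor, active leaves on opposite sides are partners, so if both sides have some, each has
    exactly one and the pair is formed there. At a par, both sides are closed under [pt]: one keeps
    its pair, the other is sent to [unit], by evaluation if it has active leaves. *)
Lemma test_cycle A r : uniq (leaves A) -> pairs_in A -> pairs_only A ->
  r \in leaves A -> active r ->
  test A (@pcob C P : bool -> hom (car (M ⊗ M^⊥)%cat) _).
Proof.
elim: A r => [b x|A IHA B IHB|A IHA B IHB] r.
- by move=> _ cl _ hr ar; have [] := cl r hr ar.
- rewrite /= cat_uniq => /and3P[uA /hasPn dAB uB] cl on hr ar.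
  have onA : pairs_only A by move=> l m al am c; apply: on; rewrite //= c.
  have onB : pairs_only B by move=> l m al am c; apply: on; rewrite //= c orbT.
  have cross l m : l \in leaves A -> m \in leaves B -> active l -> active m ->
      m = pt l.
    by move=> hl hm al am; apply: on; rewrite //= hl hm !orbT.
  have [/hasP[l hl al]|/hasPn nA] := boolP (has active (leaves A));
    have [/hasP[m hm am]|/hasPn nB] := boolP (has active (leaves B)).
  + have em := cross l m hl hm al am.
    apply: (@test_pair A B l) => //.
      apply: test_single_active => // l' hl' al'.
      by rewrite -(ptK al') -(cross l' m hl' hm al' am) em ptK.
    by rewrite -em; apply: test_single_active => // m' hm' am'; rewrite (cross l m') -?em.
  + apply: test_unitr; apply: test_tens (test_inactive nB).
    apply: (IHA l) => // k hk ak.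
    have [] := cl k _ ak; first by rewrite /= mem_cat hk.
    rewrite /= mem_cat; case/orP => hp; last by have := nB _ hp; rewrite active_pt.
    have kB : k \notin leaves B by apply/negP => /nB; rewrite ak.
    have pB : pt k \notin leaves B by apply/negP => /nB; rewrite active_pt.
    rewrite (negbTE kB) (negbTE pB) !andbF !orbF; case/orP => [c|/coh_mem[]] //.
    by rewrite (negbTE kB).
  + apply: test_unitl; apply: test_tens (test_inactive nA) _.
    apply: (IHB m) => // k hk ak.
    have [] := cl k _ ak; first by rewrite /= mem_cat hk orbT.
    rewrite /= mem_cat; case/orP => hp; first by have := nA _ hp; rewrite active_pt.
    have kA : k \notin leaves A by apply/negP => /nA; rewrite ak.
    have pA : pt k \notin leaves A by apply/negP => /nA; rewrite active_pt.
    rewrite (negbTE kA) (negbTE pA) !andbF !orbF; case/orP => [/coh_mem[]|] //.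
    by rewrite (negbTE kA).
  by move: hr; rewrite mem_cat => /orP[/nA|/nB]; rewrite ar.
rewrite /= cat_uniq => /and3P[uA /hasPn dAB uB] cl on hr ar.
have onA : pairs_only A by move=> l m al am c; apply: on; rewrite //= c.
have onB : pairs_only B by move=> l m al am c; apply: on; rewrite //= c orbT.
have clA : pairs_in A.
  move=> k hk ak; have [] := cl k _ ak; first by rewrite /= mem_cat hk.
  move=> _ /= /orP[c|/coh_mem[kB _]]; last by have := dAB _ kB; rewrite /= hk.
  by split=> //; case/coh_mem: c.
have clB : pairs_in B.
  move=> k hk ak; have [] := cl k _ ak; first by rewrite /= mem_cat hk orbT.
  move=> _ /= /orP[/coh_mem[kA _]|c]; first by have := dAB _ hk; rewrite /= kA.
  by split=> //; case/coh_mem: c.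
have t1 D : pairs_in D -> (forall r, r \in leaves D -> active r ->
      test D (@pcob C P : bool -> hom (car (M ⊗ M^⊥)%cat) _)) ->
    test D (fun _ => idm (@unit C) : hom (car (unit : light_mix C)) _).
  move=> clD IHD; have [/hasP[l hl al]|/hasPn n] := boolP (has active (leaves D)).
    by apply: test_cut; apply: IHD hl al.
  exact: test_inactive.
move: hr; rewrite mem_cat => /orP[] hr.
  by apply: test_parl; [apply: IHA hr ar|apply: t1 => // q; apply: IHB].
by apply: test_parr; [apply: t1 => // q; apply: IHA|apply: IHB hr ar].
Qed.

End Tests.

Lemma dualm_eval (D : starcat) (i : hom (@unit D) bot) (j : hom bot unit) :
  i ∘ j = 1 -> forall (Z B : D) (m : hom Z (B^⊥)) (p : hom (unit^⊥) B) (w : hom Z unit),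
  ev B ∘ (m ⊠ 1) ∘ (1 ⊠ (p ∘ i)) ∘ runi Z = i ∘ w ->
  chii unit ∘ dualm p ∘ m = w.
Proof.
move=> ij Z B m p w e.
rewrite -compA; apply: (mono_l (chiK unit)); rewrite -/(chi _) compA chi_chii comp1m.
apply: ev_inj; rewrite !tensM1 !compA ev_dualm -compA -tensm_r tensm_l compA ev_chi.
have iK : ((1 ⊠ i) ∘ runi Z) ∘ (run Z ∘ (1 ⊠ j)) = 1.
  by rewrite -compA (compAE (runK Z)) comp1m -tens1M ij tensm1.
apply: (epi_l iK); rewrite !compA -(compA _ (1 ⊠ p)) -tens1M e.
rewrite -(compA _ (w ⊠ 1)) -tensm_l -(compA (ev unit)) sym_nat !compA ev_unit.
rewrite -(compA _ (sym _ _)) sym_runi tensm_l compA run_nat -lun_run.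
by rewrite -!compA luni_nat (compAE (luniK _)) comp1m.
Qed.

(** * Evaluating functionals through Mix *)

Section MixEval.
Variable C : compact.
Local Notation S := (compact_star C).
Implicit Types X Y A B : C.

Lemma middle_swap_nat X Y A B X' Y' A' B' (f : hom X X') (g : hom Y Y')
    (a : hom A A') (b : hom B B') :
  middle_swap X' Y' A' B' ∘ ((f ⊠ g) ⊠ (a ⊠ b)) =
  ((f ⊠ a) ⊠ (g ⊠ b)) ∘ middle_swap X Y A B.
Proof.
have e X1 Y1 A1 B1 : middle_swap X1 Y1 A1 B1 =
    associ X1 A1 (Y1 ⊗ B1) ∘ (1 ⊠ exch Y1 A1 B1) ∘ assoc X1 Y1 (A1 ⊗ B1).
  by rewrite exchE.
rewrite !e -!compA assoc_nat (compA (1 ⊠ _)) -tensmM exch_nat comp1m.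
rewrite -[X in X ⊠ _](compm1 f) tensmM -compA (compAE (associ_nat _ _ _)).
by rewrite -compA.
Qed.

(** An instance of coherence: both sides are structural arrows between the same words, with two
    distinct formal literals standing for [X] and [Y]. *)
Lemma middle_swap_unit X Y :
  middle_swap X Y unit unit ∘ (1 ⊠ luni unit) ∘ runi (X ⊗ Y) = runi X ⊠ runi Y.
Proof.
pose R (i : 'I_2) := if nat_of_ord i is 0 then X else Y.
pose x := WLit true (ord0 : 'I_2, 0); pose y := WLit true (ord_max : 'I_2, 0).
pose U := @WUnit (link 2).
pose f : struct (WTens x y) (WTens (WTens x U) (WTens y U)) :=
  s_comp (s_comp (s_comp (s_comp (s_associ x U (WTens y U))
    (s_tens (s_id x) (s_comp (s_comp (s_assoc U y U) (s_tens (s_sym y U) (s_id U)))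
       (s_associ y U U)))) (s_assoc x y (WTens U U)))
    (s_tens (s_id (WTens x y)) (s_luni U))) (s_runi (WTens x y)).
pose g : struct (WTens x y) (WTens (WTens x U) (WTens y U)) :=
  s_tens (s_runi x) (s_runi y).
exact: (@struct_coherence C 2 R _ _ f g).
Qed.

Lemma dual_point_eval X (f : hom X unit) :
  eps X ∘ sym X (cdual X) ∘ (1 ⊠ (@dualm S _ _ f ∘ iota C)) ∘ runi X = f.
Proof.
have e : eps X ∘ (@dualm S _ _ f ⊠ 1) = eps unit ∘ (1 ⊠ f).
  apply: (mono_l (iotaK C)); rewrite !compA; exact: (@ev_dualm S _ _ f).
move: (@dualm S _ _ f : hom (cdual unit) (cdual X)) e => d e.
rewrite -(compA (eps X)) sym_nat -!compA sym_runi tensM1 -!compA (compAE e) -!compA.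
rewrite (compA (1 ⊠ f)) -tensm_r tensm_l -compA luni_nat !compA.
rewrite -[RHS]comp1m; congr (_ ∘ _).
have -> : eps unit = iotai C ∘ run (cdual (@unit C)) by rewrite -compA runK compm1.
by rewrite -(compA (iotai C)) run_nat (compA (iotai C)) iotaK comp1m -lun_run luniK.
Qed.

Lemma middle_swap_pt X Y A B (x : hom (@unit C) A) (y : hom (@unit C) B) :
  middle_swap X Y A B ∘ (1 ⊠ ((x ⊠ y) ∘ luni unit)) ∘ runi (X ⊗ Y) =
  ((1 ⊠ x) ∘ runi X) ⊠ ((1 ⊠ y) ∘ runi Y).
Proof.
rewrite tens1M -(tensm1 X Y) (compA (middle_swap _ _ _ _)) middle_swap_nat tensm1.
set E := (_ ⊠ _) ⊠ _; rewrite -(compA E (middle_swap _ _ _ _)).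
by rewrite -(compA E (middle_swap _ _ _ _ ∘ _)) middle_swap_unit /E -tensmM.
Qed.

Lemma mix_formE X Y (x : hom (@unit C) (cdual X)) (y : hom (@unit C) (cdual Y)) :
  eps _ ∘ (mix X Y ⊠ 1) ∘ (1 ⊠ ((x ⊠ y) ∘ luni unit)) ∘ runi (X ⊗ Y) =
  lun unit ∘ ((eps X ∘ sym X (cdual X) ∘ (1 ⊠ x) ∘ runi X) ⊠
              (eps Y ∘ sym Y (cdual Y) ∘ (1 ⊠ y) ∘ runi Y)).
Proof.
rewrite ctrK; set E := _ ⊠ _.
rewrite -(compA (lun unit ∘ E)) -(compA (lun unit ∘ E)) middle_swap_pt.
rewrite -(compA (lun unit)) /E -tensmM; congr (_ ∘ (_ ⊠ _)).
  by rewrite compA.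
by rewrite compA.
Qed.

(** Through [mix], a pair of functionals on a par becomes their product on the tensor, so the value
    of a proof structure does not distinguish the two connectives. *)
Lemma mix_eval X Y (f : hom X (@unit C)) (g : hom Y (@unit C)) :
  @parun S (iota C) unit ∘ @parm S _ _ _ _ f g ∘ mix X Y = lun unit ∘ (f ⊠ g).
Proof.
rewrite /parun /parm -(compA (chii _)) -(@dualmM S).
apply: (@dualm_eval S (iota C) (iotai C) (iotaiK C)).
rewrite -(compA (@dualm S _ _ f ⊠ @dualm S _ _ g)) plugr_pt.
rewrite (compA (@dualm S _ _ f ⊠ @dualm S _ _ g)) -tensmM.
rewrite [ev _]/(iota C ∘ eps _) -!(compA (iota C)); congr (_ ∘ _).
have := @mix_formE X Y (@dualm S _ _ f ∘ iota C) (@dualm S _ _ g ∘ iota C).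
by rewrite !dual_point_eval.
Qed.

End MixEval.

Lemma cast_tens_sq (D : smcat) (X X' Y Y' A A' B B' : D) (u : hom X X') (u' : hom Y Y')
    (v : hom A A') (v' : hom B B') (e1 : X = A) (e1' : X' = A') (e2 : Y = B)
    (e2' : Y' = B') (e : X ⊗ Y = A ⊗ B) (e' : X' ⊗ Y' = A' ⊗ B') :
  cast (C := D) e1' ∘ u = v ∘ cast e1 -> cast (C := D) e2' ∘ u' = v' ∘ cast e2 ->
  cast (C := D) e' ∘ (u ⊠ u') = (v ⊠ v') ∘ cast e.
Proof. by subst; rewrite !cast1 !comp1m !compm1 => -> ->. Qed.

Lemma cast_par_sq (D : starcat) (X X' Y Y' A A' B B' : D) (u : hom X X') (u' : hom Y Y')
    (v : hom A A') (v' : hom B B') (e1 : X = A) (e1' : X' = A') (e2 : Y = B)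
    (e2' : Y' = B') (e : X ⅋ Y = A ⅋ B) (e' : X' ⅋ Y' = A' ⅋ B') :
  cast (C := D) e1' ∘ u = v ∘ cast e1 -> cast (C := D) e2' ∘ u' = v' ∘ cast e2 ->
  cast (C := D) e' ∘ parm u u' = parm v v' ∘ cast e.
Proof. by subst; rewrite !cast1 !comp1m !compm1 => -> ->. Qed.

Lemma cast_comp_sq (D : category) (X X' Y Y' Z Z' : D) (u : hom X X') (v : hom Y Y')
    (w : hom Z Z') (e1 : X = Y) (e1' : X' = Y') (e2 : Y = Z) (e2' : Y' = Z') e e' :
  cast (C := D) e1' ∘ u = v ∘ cast e1 -> cast (C := D) e2' ∘ v = w ∘ cast e2 ->
  cast (C := D) e' ∘ u = w ∘ cast e.
Proof. by subst; rewrite !cast1 !comp1m !compm1 => -> ->. Qed.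

Lemma cast_dual_sq (D : starcat) (X X' Y Y' : D) (u : hom X X') (v : hom Y Y')
    (e1 : X = Y) (e1' : X' = Y') e e' :
  cast (C := D) e1' ∘ u = v ∘ cast e1 -> cast (C := D) e' ∘ dualm u = dualm v ∘ cast e.
Proof. by subst; rewrite !cast1 !comp1m !compm1 => ->. Qed.

Lemma fmor1 (D : starcat) N (R S : 'I_N -> D) F :
  fmor (fun i => idm (R i)) (fun i => idm (S i)) F = 1.
Proof.
elim: F => [[] i|F IHF F' IHF'|F IHF F' IHF'] //=.
- exact: dualm1.
- by rewrite IHF IHF' tensm1.
by rewrite IHF IHF' /parm !dualm1 tensm1 dualm1.
Qed.

(** * Underlying objects and arrows of a transformation *)

Section Strict.
Variables (D E : starcat) (N : nat) (o : D -> E).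
Variable m : forall A B : D, hom A B -> hom (o A) (o B).
Hypothesis oT : forall A B, o (A ⊗ B) = o A ⊗ o B.
Hypothesis oD : forall A, o (A^⊥) = (o A)^⊥.
Hypothesis mT : forall A A' B B' (f : hom A A') (g : hom B B'),
  cast (C := E) (oT A' B') ∘ m (f ⊠ g) = (m f ⊠ m g) ∘ cast (oT A B).
Hypothesis mD : forall A A' (f : hom A A'),
  cast (C := E) (oD A) ∘ m (dualm f) = dualm (m f) ∘ cast (oD A').

Lemma strict_par A B : o (A ⅋ B) = o A ⅋ o B.
Proof. by rewrite /par oD oT !oD. Qed.

Lemma strict_parm A A' B B' (f : hom A A') (g : hom B B') :
  cast (C := E) (strict_par A' B') ∘ m (parm f g) = parm (m f) (m g) ∘ cast (strict_par A B).
Proof.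
have e1 A1 B1 : (o (A1 ⊗ B1))^⊥ = (o A1 ⊗ o B1)^⊥ by rewrite oT.
have e2 A1 B1 : (o (A1^⊥) ⊗ o (B1^⊥))^⊥ = ((o A1)^⊥ ⊗ (o B1)^⊥)^⊥ by rewrite !oD.
have e3 A1 B1 : o (A1^⊥) ⊗ o (B1^⊥) = (o A1)^⊥ ⊗ (o B1)^⊥ by rewrite !oD.
have s1 := mD (dualm f ⊠ dualm g).
have s2 := cast_dual_sq (e1 _ _) (e1 _ _) (mT (dualm f) (dualm g)).
have s3 := cast_dual_sq (e2 _ _) (e2 _ _) (cast_tens_sq (e3 _ _) (e3 _ _) (mD f) (mD g)).
have e4 A1 B1 : (o (A1^⊥ ⊗ B1^⊥))^⊥ = ((o A1)^⊥ ⊗ (o B1)^⊥)^⊥ by rewrite oT !oD.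
exact: (cast_comp_sq _ _ s1 (cast_comp_sq (e4 _ _) (e4 _ _) s2 s3)).
Qed.

Lemma strict_fob (R R' : 'I_N -> D) F :
  o (fob R R' F) = fob (fun i => o (R i)) (fun i => o (R' i)) F.
Proof.
elim: F => [[] i|F IHF F' IHF'|F IHF F' IHF'] //=.
- by rewrite oT IHF IHF'.
by rewrite strict_par IHF IHF'.
Qed.

Lemma strict_fmor (R1 R2 R1' R2' : 'I_N -> D) (f : forall i, hom (R1 i) (R1' i))
    (g : forall i, hom (R2' i) (R2 i)) F :
  cast (C := E) (strict_fob R1' R2' F) ∘ m (fmor f g F) =
  fmor (fun i => m (f i)) (fun i => m (g i)) F ∘ cast (strict_fob R1 R2 F).
Proof.
elim: F => [[] i|F IHF F' IHF'|F IHF F' IHF'] /=.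
- by rewrite !cast1 comp1m compm1.
- by rewrite (cast_irr _ (oD (R2' i))) (cast_irr _ (oD (R2 i))) mD.
- have e A1 A2 B1 B2 : A1 = A2 -> B1 = B2 -> A1 ⊗ B1 = A2 ⊗ B2 :> E by move=> -> ->.
  exact: (cast_comp_sq _ _ (mT _ _) (cast_tens_sq (e _ _ _ _ (strict_fob _ _ F) (strict_fob _ _ F'))
    (e _ _ _ _ (strict_fob _ _ F) (strict_fob _ _ F')) IHF IHF')).
have e A1 A2 B1 B2 : A1 = A2 -> B1 = B2 -> A1 ⅋ B1 = A2 ⅋ B2 :> E by move=> -> ->.
exact: (cast_comp_sq _ _ (strict_parm _ _) (cast_par_sq (e _ _ _ _ (strict_fob _ _ F) (strict_fob _ _ F'))
  (e _ _ _ _ (strict_fob _ _ F) (strict_fob _ _ F')) IHF IHF')).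
Qed.

End Strict.

Section Carrier.
Variables (C : compact) (N : nat).
Local Notation S := (compact_star C).
Local Notation G := (light_mix C).
Implicit Types (R : 'I_N -> G) (F : formula 'I_N).

Lemma car_tens (A B : G) : car (A ⊗ B) = car A ⊗ car B.
Proof. by []. Qed.

Lemma car_dual (A : G) : car (A^⊥) = (car A)^⊥.
Proof. by []. Qed.

Lemma sval_tensm (A A' B B' : G) (f : hom A A') (g : hom B B') :
  cast (C := S) (car_tens A' B') ∘ sval (f ⊠ g) = (sval f ⊠ sval g) ∘ cast (car_tens A B).
Proof. by rewrite !cast1 comp1m compm1. Qed.

Lemma sval_dualm (A A' : G) (f : hom A A') :
  cast (C := S) (car_dual A) ∘ sval (dualm f) = @dualm S _ _ (sval f) ∘ cast (car_dual A').
Proof. by rewrite !cast1 comp1m compm1. Qed.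

Definition car_fob R R' F :
  car (fob R R' F) = fob (D := S) (fun i => car (R i)) (fun i => car (R' i)) F :=
  strict_fob car_tens car_dual R R' F.

Lemma sval_fmor R1 R2 R1' R2' (f : forall i, @hom G (R1 i) (R1' i))
    (g : forall i, @hom G (R2' i) (R2 i)) F :
  cast (C := S) (car_fob R1' R2' F) ∘ sval (fmor f g F) =
  fmor (D := S) (fun i => sval (f i)) (fun i => sval (g i)) F ∘ cast (car_fob R1 R2 F).
Proof.
exact (@strict_fmor G S N (@car C) (fun A B (h : hom A B) => sval h)
  car_tens car_dual sval_tensm sval_dualm R1 R2 R1' R2' f g F).
Qed.

Lemma orth_nopt (A : S) X : @orth S (iota C) (@GObj S A (fun _ => False) X).
Proof. by move=> u x []. Qed.

(** With neither points nor copoints the conditions on objects and arrows are void, so [C] embeds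
    fully. *)
Definition free (A : S) : G := exist _ _ (@orth_nopt A (fun _ => False)).

Definition underlying F (t : family G F) R :
    hom unit (fob (D := S) (fun i => car (R i)) (fun i => car (R i)) F) :=
  cast (C := S) (car_fob R R F) ∘ sval (t R).

Lemma underlying_nat F (t : family G F) R1 R2 (f : forall i, @hom G (R1 i) (R2 i)) :
  transformation t ->
  fmor (D := S) (fun i => sval (f i)) (fun i => idm (car (R1 i))) F ∘ underlying t R1 =
  fmor (D := S) (fun i => idm (car (R2 i))) (fun i => sval (f i)) F ∘ underlying t R2.
Proof.
move=> tt; have /(congr1 sval) := tt R1 R2 f.
move=> e; have {}e : sval (fmor f (fun i => idm (R1 i)) F) ∘ sval (t R1) =
  sval (fmor (fun i => idm (R2 i)) f F) ∘ sval (t R2) by exact: e.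
rewrite /underlying !compA.
have h1 := esym (sval_fmor f (fun i => idm (R1 i)) F).
have h2 := esym (sval_fmor (fun i => idm (R2 i)) f F).
apply: etrans (congr1 (fun h => h ∘ sval (t R1)) h1) _.
apply: etrans (esym (congr1 (fun h => h ∘ sval (t R2)) h2)).
by rewrite -!(compA (cast _)); congr (_ ∘ _).
Qed.

(** The object with the copoints of [R i] and no points maps identically both to [R i] and to
    [free (car (R i))]; dinaturality along these two arrows compares the components. *)
Lemma underlying_free F (t : family G F) R :
  transformation t -> underlying t R = underlying t (fun i => free (car (R i))).
Proof.
move=> tt.
pose mid i : G := exist _ _ (@orth_nopt (car (R i)) (@gcopt S (sval (R i)))).
have f1 i : @garrow S (sval (mid i)) (sval (R i)) (idm (car (R i))).
  by split=> // y hy; rewrite compm1.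
have f2 i : @garrow S (sval (mid i)) (sval (free (car (R i)))) (idm (car (R i))).
  by split.
pose g1 i : @hom G (mid i) (R i) := exist _ (idm (car (R i))) (f1 i).
pose g2 i : @hom G (mid i) (free (car (R i))) := exist _ (idm (car (R i))) (f2 i).
have := underlying_nat g1 tt; rewrite !(@fmor1 S) !comp1m => <-.
by have := underlying_nat g2 tt; rewrite !(@fmor1 S) !comp1m.
Qed.

Definition carrier_family F (t : family G F) : family S F :=
  fun Q => underlying t (fun i => free (Q i)).

Lemma carrier_transformation F (t : family G F) :
  transformation t -> transformation (carrier_family t).
Proof.
move=> tt R1 R2 f.
have h i : @garrow S (sval (free (R1 i))) (sval (free (R2 i))) (f i) by split.
pose g i : @hom G (free (R1 i)) (free (R2 i)) := exist _ (f i) (h i).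
exact: (underlying_nat g tt).
Qed.

Lemma sval_family F (t : family G F) R e : transformation t ->
  sval (t R) = cast (C := S) e ∘ carrier_family t (fun i => car (R i)).
Proof.
move=> tt; rewrite /carrier_family -underlying_free // /underlying compA.
by rewrite (castK (C := S) (car_fob R R F)) comp1m.
Qed.

End Carrier.

Lemma cast_tens_app (D : smcat) (X Y A B U V W : D) (g : hom (U ⊗ V) W) (u : hom X U)
    (v : hom Y V) (a : hom A U) (b : hom B V) (e1 : X = A) (e2 : Y = B)
    (e : X ⊗ Y = A ⊗ B) :
  u = a ∘ cast (C := D) e1 -> v = b ∘ cast (C := D) e2 ->
  g ∘ (u ⊠ v) = g ∘ (a ⊠ b) ∘ cast (C := D) e.
Proof. by subst; rewrite !cast1 !compm1 => -> ->. Qed.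

Lemma cast_par_app (D : starcat) (X Y A B U V W : D) (g : hom (U ⅋ V) W) (u : hom X U)
    (v : hom Y V) (a : hom A U) (b : hom B V) (e1 : X = A) (e2 : Y = B)
    (e : X ⅋ Y = A ⅋ B) :
  u = a ∘ cast (C := D) e1 -> v = b ∘ cast (C := D) e2 ->
  g ∘ parm u v = g ∘ parm a b ∘ cast (C := D) e.
Proof. by subst; rewrite !cast1 !compm1 => -> ->. Qed.

(** * Values of proof structures under the functionals of tests *)

Section Eval.
Variables (C : compact) (P : biproducts C) (N : nat).
Local Notation S := (compact_star C).
Local Notation G := (light_mix C).
Local Notation leaf := (bool * link N)%type.
Local Notation Rf := (@Rf C P N).
Local Notation theta := (@theta C P N).
Implicit Types (A B : formula (link N)) (F : formula 'I_N).

Definition Rc : 'I_N -> C := fun _ => car (Rs P).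

(* [theta] on the underlying objects. *)
Fixpoint thetaC (lb : bool -> link N -> label) i A :
    hom (fob (D := S) Rc Rc (erase A)) (@unit C) :=
  match A with
  | Lit b x =>
    if b as b return hom (fob (D := S) Rc Rc (erase (Lit b x))) (@unit C)
    then lval P true (lb true x) i else lval P false (lb false x) i
  | Tens A B => lun unit ∘ (thetaC lb i A ⊠ thetaC lb i B)
  | Par A B => @parun S (iota C) unit ∘ @parm S _ _ _ _ (thetaC lb i A) (thetaC lb i B)
  end.

Lemma thetaC_E lb i A :
  theta lb i A = thetaC lb i A ∘ cast (C := S) (car_fob Rf Rf (erase A)).
Proof.
elim: A => [[] x|A IHA B IHB|A IHA B IHB].
- by rewrite cast1 !compm1.
- by rewrite cast1 !compm1.
- exact (cast_tens_app (lun unit) (car_fob Rf Rf (Tens (erase A) (erase B))) IHA IHB).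
exact (cast_par_app (D := S) (@parun S (iota C) unit) (car_fob Rf Rf (Par (erase A) (erase B))) IHA IHB).
Qed.

Lemma thetaC_mixify lb i A :
  thetaC lb i A ∘ mixify Rc A =
  wval (R := Rc) (fun x => lval P true (lb true x) i)
    (fun x => lval P false (lb false x) i) (formula_word A).
Proof.
elim: A => [[] x|A IHA B IHB|A IHA B IHB] /=.
- by rewrite !compm1.
- by rewrite !compm1.
- by rewrite -!(compA (lun unit)) -!tensmM IHA IHB.
rewrite (compA _ (mix _ _)) mix_eval -(compA (lun _)) -tensmM.
by rewrite IHA IHB.
Qed.

Definition compat_on lb i A :=
  forall x, (true, x) \in leaves A -> compat (lb true x) (lb false x) i.

(** The functional is pulled back through Mix and the structural arrows to the links, each of which
    contributes the factor 1. *)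
Lemma theta_ps_val lb i A L (s : struct (link_word L) (formula_word A)) :
  compat_on lb i A -> thetaC lb i A ∘ ps_val s Rc = 1.
Proof.
move=> cp; rewrite /ps_val !compA thetaC_mixify.
rewrite (wval_struct _ _ s); apply: wval_units => x xL; apply: pair_compat.
apply: cp; rewrite -(mem_wleaves_link L true) in xL.
by rewrite -[leaves A]cats0 -wleaves_formula -(perm_mem (struct_perm s)).
Qed.

(** Only the labels in the order of the leaves count, so a labelling chosen for one proof structure
    can be evaluated on another over the same sequent. *)
Lemma theta_transfer lb lb' i A B (e : erase A = erase B) :
  [seq lb l.1 l.2 | l <- leaves A] = [seq lb' l.1 l.2 | l <- leaves B] ->
  thetaC lb i A = thetaC lb' i B ∘ cast (C := S) (f_equal (fob (D := S) Rc Rc) e).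
Proof.
move=> h; move: (f_equal _ e) => he.
elim: A B e h he => [b x|A1 IH1 A2 IH2|A1 IH1 A2 IH2] [b' y|B1 B2|B1 B2] //.
- move=> [eb _] /= [h] he; subst b'; case: b h he => h he;
  by rewrite cast1 compm1 /= h.
- case=> e1 e2 /=; rewrite !map_cat => h he.
  have [|h1 h2] := cat_inj _ h; first by rewrite !size_map (erase_size e1).
  have he1 := f_equal (fob (D := S) Rc Rc) e1.
  have he2 := f_equal (fob (D := S) Rc Rc) e2.
  exact (cast_tens_app (lun unit) he (IH1 _ e1 h1 he1) (IH2 _ e2 h2 he2)).
case=> e1 e2 /=; rewrite !map_cat => h he.
have [|h1 h2] := cat_inj _ h; first by rewrite !size_map (erase_size e1).
have he1 := f_equal (fob (D := S) Rc Rc) e1.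
have he2 := f_equal (fob (D := S) Rc Rc) e2.
exact (cast_par_app (@parun S (iota C) unit) he (IH1 _ e1 h1 he1) (IH2 _ e2 h2 he2)).
Qed.

End Eval.

(** * The labelling of a chordless cycle *)

Section Cycle.
Variable N : nat.
Local Notation leaf := (bool * link N)%type.
Implicit Types (A B : formula (link N)) (l m : leaf).

Section Chordless.
Variables (A : formula (link N)) (k : nat) (x : nat -> leaf).
Hypothesis cx : chordless (coh A) k x.

Definition cleaves := mkseq x k.

Lemma cleavesP l : reflect (exists2 i, i < k & l = x i) (l \in cleaves).
Proof.
apply: (iffP mapP) => [[i]|[i ik ->]]; first by rewrite mem_iota => /andP[_ ?] ->; exists i.
by exists i; rewrite // mem_iota.
Qed.

Lemma chordless_inj i j : i < k -> j < k -> x i = x j -> i = j.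
Proof.
have [_ hE _ _ hS] := cx => ik jk e.
have si : cyc_succ k i < k by apply: cyc_succ_lt.
have := hS j _ jk si; rewrite -e => /(_ (hE _ ik)) /(congr1 (cyc_pred k)).
by rewrite !cyc_succK.
Qed.

Lemma index_cleaves i : i < k -> index (x i) cleaves = i.
Proof.
move=> ik; rewrite -(nth_mkseq (x i) x ik) index_uniq ?size_mkseq //.
by rewrite map_inj_in_uniq ?iota_uniq // => a b; rewrite !mem_iota; apply: chordless_inj.
Qed.

(** If both ends of a link were listed, the coherence that follows one of them would join two
    conjugates. *)
Lemma cleaves_conj l : l \in cleaves -> conj l \notin cleaves.
Proof.
have [_ hE _ hC _] := cx.
case/cleavesP=> i ik ->; apply/cleavesP => -[j jk e].
have := hC i _ ik (cyc_succ_lt jk); rewrite e.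
by rewrite hE.
Qed.

Definition cycle_label b (y : link N) : label :=
  if (b, y) \in cleaves then Out
  else if conj (b, y) \in cleaves then In else Const false.

Definition cycle_partner l : leaf :=
  if l \in cleaves then conj (x (cyc_succ k (index l cleaves)))
  else x (cyc_pred k (index (conj l) cleaves)).

Lemma cycle_active l :
  active cycle_label l = (l \in cleaves) || (conj l \in cleaves).
Proof.
rewrite /active /cycle_label -surjective_pairing.
by case: ifP => //= _; case: ifP.
Qed.

Lemma cycle_partner_out i : i < k ->
  cycle_partner (x i) = conj (x (cyc_succ k i)).
Proof.
move=> ik; rewrite /cycle_partner index_cleaves //.
by have -> : x i \in cleaves by apply/cleavesP; exists i.
Qed.

Lemma cycle_partner_in i : i < k ->
  cycle_partner (conj (x i)) = x (cyc_pred k i).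
Proof.
move=> ik; rewrite /cycle_partner conjK index_cleaves //.
have xi : x i \in cleaves by apply/cleavesP; exists i.
by rewrite (negbTE (cleaves_conj xi)).
Qed.

Variant cycle_spec l : Prop :=
  | CycleOut i of i < k & l = x i
  | CycleIn i of i < k & l = conj (x i).

Lemma cycle_activeP l : active cycle_label l -> cycle_spec l.
Proof.
rewrite cycle_active => /orP[/cleavesP[i ik ->]|/cleavesP[i ik e]].
  exact: CycleOut ik erefl.
by apply: (CycleIn ik); rewrite -e conjK.
Qed.

Lemma cycle_partnerK l : active cycle_label l -> cycle_partner (cycle_partner l) = l.
Proof.
case/cycle_activeP=> i ik ->.
  by rewrite cycle_partner_out // cycle_partner_in ?cyc_succ_lt // cyc_succK.
by rewrite cycle_partner_in // cycle_partner_out ?cyc_pred_lt // cyc_predK.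
Qed.

Lemma cycle_label_out i : i < k -> cycle_label (x i).1 (x i).2 = Out.
Proof.
move=> ik; rewrite /cycle_label -surjective_pairing.
by have -> : x i \in cleaves by apply/cleavesP; exists i.
Qed.

Lemma cycle_label_in i : i < k -> cycle_label (conj (x i)).1 (conj (x i)).2 = In.
Proof.
move=> ik; have xi : x i \in cleaves by apply/cleavesP; exists i.
by rewrite /cycle_label -surjective_pairing (negbTE (cleaves_conj xi)) conjK xi.
Qed.

Lemma cycle_partner_label l : active cycle_label l ->
  cycle_label (cycle_partner l).1 (cycle_partner l).2 =
  if cycle_label l.1 l.2 is Out then In else Out.
Proof.
case/cycle_activeP=> i ik ->.
  by rewrite cycle_partner_out // cycle_label_in ?cyc_succ_lt // cycle_label_out.
by rewrite cycle_partner_in // cycle_label_out ?cyc_pred_lt // cycle_label_in.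
Qed.

Lemma cycle_pairs_in : pairs_in cycle_label cycle_partner A.
Proof.
have [_ hE _ _ _] := cx => l _ al.
suff c : coh A l (cycle_partner l) by split=> //; case/coh_mem: c.
case: (cycle_activeP al) => i ik ->; first by rewrite cycle_partner_out ?hE.
rewrite cycle_partner_in // coh_sym -{2}(cyc_predK ik).
by apply: hE; apply: cyc_pred_lt.
Qed.

Lemma cycle_pairs_only : pairs_only cycle_label cycle_partner A.
Proof.
have [_ _ hA hC hS] := cx => l m /cycle_activeP[] i ik -> /cycle_activeP[] j jk -> c.
- by have := hA i j ik jk; rewrite c.
- by rewrite cycle_partner_out // (hS i j).
- by rewrite coh_sym in c; rewrite cycle_partner_in // (hS j i) ?cyc_succK.
by have := hC i j ik jk; rewrite c.
Qed.

Lemma cycle_compat i : compat_on cycle_label i A.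
Proof.
move=> y _; rewrite /compat /cycle_label /conj /=.
case h: ((true, y) \in cleaves) => /=; last by case: ifP.
by have /negbTE := cleaves_conj h; rewrite /conj /= => ->.
Qed.

End Chordless.
End Cycle.

(** * Vanishing coordinates *)

Section Vanish.
Variables (C : compact) (P : biproducts C) (zsf : zero_sum_free P) (N : nat).
Local Notation S := (compact_star C).
Local Notation G := (light_mix C).
Local Notation leaf := (bool * link N)%type.
Local Notation Rf := (@Rf C P N).
Local Notation Rc := (@Rc C P N).
Local Notation M := (M P).
Local Notation thetaC := (@thetaC C P N).
Implicit Types (A : formula (link N)) (F : formula 'I_N).

(** The identity is a point of [unit], and arrows preserve points. *)
Lemma gpt_comp (X Y : G) (f : @hom G X Y) (u : @hom G unit X) :
  @gpt S (sval Y) (sval f ∘ sval u).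
Proof.
have [h _] := svalP u; have [h' _] := svalP f; apply: h'.
by have := h _ (erefl : @gpt S (@gunit S (iota C)) 1); rewrite compm1.
Qed.

Lemma theta_family lb i A (t : family G (erase A)) : transformation t ->
  theta P lb i A ∘ sval (t Rf) = thetaC lb i A ∘ carrier_family t Rc.
Proof.
move=> tt; rewrite (sval_family (esym (car_fob Rf Rf (erase A))) tt).
rewrite thetaC_E compA -(compA (thetaC _ _ _)) (castK (C := S) (esym _)) compm1.
by [].
Qed.

Lemma test_vanish lb i A (t : family G (erase A)) (Y : G) y
    (f : @hom G (fob Rf Rf (erase A)) Y) : transformation t ->
  ge P (y i ∘ sval f) (theta P lb i A) ->
  y i ∘ (sval f ∘ sval (t Rf)) = zerom P unit unit ->
  thetaC lb i A ∘ carrier_family t Rc = zerom P unit unit.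
Proof.
move=> tt h e; rewrite -theta_family //.
apply: (ge0 zsf) e; rewrite compA.
exact: ge_comp h (ge_refl _ _).
Qed.

(** The test sends [t] to a point of [M ⊗ M^⊥], whose first factor is some [bas b], killed by
    [cob (~~ b)]. *)
Lemma cycle_vanish A k x (t : family G (erase A)) :
  uniq (leaves A) -> chordless (coh A) k x -> transformation t ->
  exists i, thetaC (cycle_label k x) i A ∘ carrier_family t Rc = zerom P unit unit.
Proof.
move=> uA cx tt; have [k0 hE _ _ _] := cx.
have xA : x 0 \in leaves A by have [] := coh_mem (hE 0 k0).
have ax : active (cycle_label k x) (x 0).
  by rewrite cycle_active; apply/orP; left; apply/cleavesP; exists 0.
have [f hf] := test_cycle P (cycle_partnerK cx) (cycle_partner_label cx) uA (cycle_pairs_in cx) (cycle_pairs_only cx) xA ax.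
have [u [v [[b ub] _ e]]] := gpt_comp f (t Rf).
exists (~~ b); apply: (test_vanish (f := f) tt (hf _)).
rewrite e ub /pcob -(compA (lun unit)) (compA (_ ⊠ _)) -tensmM cob_basN.
by rewrite zero_tens Mzero zeroM.
Qed.

(* Reads the leaf [(true, x)], with the constant [b] plugged into the leaf
   [(false, x)] and [false] elsewhere. *)
Definition single_label (x : link N) (b : bool) (y : link N) : label :=
  if b then (if y == x then Out else Const false) else Const (y == x).

Lemma single_vanish A x (t : family G (erase A)) :
  uniq (leaves A) -> (true, x) \in leaves A -> transformation t ->
  exists i, thetaC (single_label x) i A ∘ carrier_family t Rc = zerom P unit unit.
Proof.
move=> uA xA tt.
have ax : active (single_label x) (true, x) by rewrite /active /= eqxx.
have := test_single_active P uA xA ax; rewrite /test_single /= eqxx => -[].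
  by case=> -[] y _; rewrite /active //=; case: ifP => // /eqP ->.
move=> f hf; have [b e] := gpt_comp f (t Rf).
exists (~~ b); apply: (test_vanish (f := f) tt (hf _)).
by rewrite e cob_basN.
Qed.

End Vanish.

(** * Identifying the proof structure of a transformation *)

Section Analysis.
Variables (C : compact) (P : biproducts C) (N : nat).
Local Notation S := (compact_star C).
Local Notation G := (light_mix C).
Local Notation Rc := (@Rc C P N).
Local Notation thetaC := (@thetaC C P N).
Implicit Types (A B : formula (link N)) (F : formula 'I_N).

Lemma theta_is_ps lb i A B (v : family S (erase A)) (e : erase B = erase A) L
    (s : struct (link_word L) (formula_word B)) lb' :
  (forall R, v R = cast (C := S) (f_equal (fob (D := S) R R) e) ∘ ps_val s R) ->
  [seq lb l.1 l.2 | l <- leaves A] = [seq lb' l.1 l.2 | l <- leaves B] ->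
  compat_on lb' i B -> thetaC lb i A ∘ v Rc = 1.
Proof.
move=> vE hl cp; rewrite vE (theta_transfer P i (esym e) hl) compA.
rewrite -(compA (thetaC _ _ _)) castK compm1.
exact: theta_ps_val.
Qed.

Lemma theta_is_ps_self lb i A (v : family S (erase A)) :
  is_ps v A -> compat_on lb i A -> thetaC lb i A ∘ v Rc = 1.
Proof. by move=> [e [L [s vE]]] cp; apply: (theta_is_ps vE erefl cp). Qed.

Lemma single_compat A x : compat_on (single_label x) true A.
Proof. by move=> y _; rewrite /single_label; case: eqP. Qed.

(** If the links differ, some positive leaf [x] of [A] is linked in [B] to a negative leaf other
    than the one in [A]. That leaf carries the constant [false], so [B] has value 1 at [false],
    whereas [A] would have it at [true]. *)
Lemma match_or_vanish A B (v : family S (erase A)) :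
  linked A -> linked B -> is_ps v B ->
  is_ps v A \/
  exists x, (true, x) \in leaves A /\ thetaC (single_label x) false A ∘ v Rc = 1.
Proof.
move=> lA lB vB; have [e [L [s vE]]] := vB; have e' := esym e.
case: (boolP (all (fun l => (twin A B (true, l.2)).2 == (twin A B (false, l.2)).2)
   [seq l <- leaves B | l.1])) => [/allP h|/allPn[[[] y]]].
- left; suff -> : is_ps v A = is_ps v (fmap (fun y => (y.1, rename A B y)) B).
    exact: is_ps_rename.
  congr is_ps; apply: (rename_eq lB e') => y hy.
  by apply/eqP/(h (true, y)); rewrite mem_filter.
- rewrite mem_filter /= => hy ne; right; exists (twin A B (true, y)).2.
  have [s1 _] := twin_shape e' hy; rewrite /= in s1; split.
    by rewrite -[X in (X, _)]s1 -surjective_pairing; apply: twin_mem.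
  set x := (twin A B (true, y)).2.
  pose lb b z := single_label x (twin A B (b, z)).1 (twin A B (b, z)).2.
  apply: (theta_is_ps (lb' := lb) vE) => [|z hz].
    by rewrite (leaves_twin lB e') -map_comp; apply: eq_map => -[b z].
  have hz' : (false, z) \in leaves B by case/andP: lB => _ /allP/(_ _ hz).
  have [t1 _] := twin_shape e' hz; have [t2 _] := twin_shape e' hz'.
  rewrite /lb t1 t2 /single_label /=; case: eqP => // ez /=.
  suff ey : y = z by rewrite -ey (eq_sym _ x) (negbTE ne).
  suff [] : (true, y) = (true, z) by [].
  apply: (twin_inj lA e') => //; rewrite [LHS]surjective_pairing [RHS]surjective_pairing.
  by rewrite s1 t1 ez.
by rewrite mem_filter.
Qed.

End Analysis.

Section Analysis.
Variables (C : compact) (P : biproducts C) (N : nat).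
Hypothesis zsf : zero_sum_free P.
Hypothesis nontrivial : zerom P (@unit C) unit <> idm unit.
Local Notation S := (compact_star C).
Local Notation G := (light_mix C).
Local Notation Rf := (@Rf C P N).
Local Notation Rc := (@Rc C P N).
Local Notation thetaC := (@thetaC C P N).
Implicit Types (A B : formula (link N)) (F : formula 'I_N).

Definition const_label (b : bool) (x : link N) : label := Const false.

Lemma const_arrow A i : exists f : @hom G (fob Rf Rf (erase A)) unit,
  sval f = theta P const_label i A.
Proof.
elim: A => [[] x|A [f fE] B [g gE]|A [f fE] B [g gE]].
- by exists (cstp P).
- by exists (cstn P false).
- exists (lun unit ∘ (f ⊠ g)).
  by rewrite [LHS]/(lun unit ∘ (sval f ⊠ sval g)) fE gE.
exists (parun (iotaG C : @hom G unit bot) unit ∘ parm f g).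
rewrite [LHS]/(@parun S (iota C) unit ∘ @parm S _ _ _ _ (sval f) (sval g)).
by rewrite fE gE.
Qed.

(** With constants only, the functional is itself an arrow of the glued category into [unit], whose
    only point is the identity. *)
Lemma const_value A (t : family G (erase A)) i : transformation t ->
  thetaC const_label i A ∘ carrier_family t Rc = 1.
Proof.
move=> tt; rewrite -theta_family //; have [f <-] := const_arrow A i.
exact: (gpt_comp f (t Rf)).
Qed.

Lemma const_ps A B (v : family S (erase A)) i :
  is_ps v B -> thetaC const_label i A ∘ v Rc = 1.
Proof.
move=> [e [L [s vE]]]; have cp : compat_on const_label i B by [].
apply: (theta_is_ps P vE _ cp).
have := erase_size e; elim: (leaves B) (leaves A) => [|l s1 IH] [|m s2] //= [].
by move/IH => ->.
Qed.

Lemma erase_surj F : exists A, erase A = F.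
Proof.
exists (fmap (fun i => (i, 0)) F).
by elim: F => [b i|F1 e1 F2 e2|F1 e1 F2 e2] //; [congr Tens|congr Par].
Qed.

Section Sum.
Variables (n : nat) (a : 'I_n -> hom (@unit C) unit).

Lemma theta_sum lb i A (v : family S (erase A)) (u : 'I_n -> family S (erase A)) :
  (forall R, v R = \big[addm P/zerom P _ _]_(k < n) scalem (a k) (u k R)) ->
  thetaC lb i A ∘ v Rc =
  \big[addm P/zerom P _ _]_(k < n) scalem (a k) (thetaC lb i A ∘ u k Rc).
Proof.
move=> ->; rewrite comp_big; apply: eq_bigr => k _.
exact: comp_scalem.
Qed.

Lemma coef_vanish lb i A (v : family S (erase A)) (u : 'I_n -> family S (erase A)) k :
  (forall R, v R = \big[addm P/zerom P _ _]_(k < n) scalem (a k) (u k R)) ->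
  thetaC lb i A ∘ u k Rc = 1 -> thetaC lb i A ∘ v Rc = zerom P unit unit ->
  a k = zerom P unit unit.
Proof.
move=> vE uk; rewrite (theta_sum lb i vE); apply: (ge0 zsf).
rewrite -(scalem_id (a k)) -uk.
exact: (ge_big P (fun k => scalem (a k) (thetaC lb i A ∘ u k Rc)) k).
Qed.

Lemma sum_coef F (t : family G F) (u : 'I_n -> family S F) Q :
  transformation t -> (forall k, is_ps (u k) (Q k)) ->
  (forall R, carrier_family t R = \big[addm P/zerom P _ _]_(k < n) scalem (a k) (u k R)) ->
  \big[addm P/zerom P _ _]_(k < n) a k = 1.
Proof.
move=> tt uQ vE; have [A eA] := erase_surj F.
move: t u tt uQ vE; case: _ / eA => t u tt uQ vE.
rewrite -(const_value false tt) (theta_sum _ _ vE); apply: eq_bigr => k _.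
by rewrite (const_ps _ (uQ k)) scalem_id.
Qed.

(** Let [a k0] be nonzero. If [Q k] has other links than [Q k0], reading a suitable link gives value
    1 to [u k0] at [true] and to [u k] at [false]. One coordinate of the sum vanishes; it cannot be
    [true], so [a k] is zero. The other summands coincide, and their coefficients add up to 1. *)
Lemma sum_is_ps F (t : family G F) (u : 'I_n -> family S F) Q :
  transformation t -> (forall k, is_ps (u k) (Q k)) -> (forall k, linked (Q k)) ->
  (forall R, carrier_family t R = \big[addm P/zerom P _ _]_(k < n) scalem (a k) (u k R)) ->
  exists k, is_ps (carrier_family t) (Q k).
Proof.
move=> tt uQ lQ vE; have s1 := sum_coef tt uQ vE.
have [k0 ak0] : exists k0, a k0 <> zerom P unit unit.
  apply: NNPP => nex; apply: nontrivial; rewrite -s1.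
  elim/big_rec: _ => // k s _ <-; rewrite addm0.
  by apply: NNPP => ak; apply: nex; exists k => e; apply: ak.
exists k0; have [e _] := uQ k0.
move: t u tt uQ vE; case: _ / e => t u tt uQ vE.
have uQk k : a k = zerom P unit unit \/ is_ps (u k) (Q k0).
  have [|[x [xQ uk]]] := match_or_vanish P (lQ k0) (lQ k) (uQ k); first by right.
  left; have uQ0 : uniq (leaves (Q k0)) by case/andP: (lQ k0).
  have [[] v0] := single_vanish zsf uQ0 xQ tt; last exact: (coef_vanish vE uk v0).
  case: ak0; apply: (coef_vanish vE _ v0).
  by apply: theta_is_ps_self; [apply: uQ|apply: single_compat].
have [e0 [L0 [s0 u0E]]] := uQ k0; exists e0, L0, s0 => R; rewrite vE -u0E.
rewrite -[RHS]scale1m -s1 -big_scalem; apply: eq_bigr => k _.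
have [->|[e1 [L1 [s1' u1E]]]] := uQk k; first by rewrite !scalem0.
rewrite u1E u0E; congr (scalem _ (_ ∘ _)); first exact: cast_irr.
by apply: ps_val_irr; case/andP: (lQ k0).
Qed.

End Sum.

Lemma ps_chordless F (t : family G F) A : transformation t ->
  linked A -> is_ps (carrier_family t) A -> ~ cyclic (coh A).
Proof.
move=> tt lA vA [k [x cx]]; have [e _] := vA; case/andP: lA => uA _.
move: t tt vA; case: _ / e => t tt vA.
have [i v0] := cycle_vanish zsf uA cx tt; apply: nontrivial.
by rewrite -v0; apply: theta_is_ps_self => //; apply: cycle_compat cx _.
Qed.

Hypothesis feeble : feeble_full_completeness P.

Lemma transformation_is_ps (A : formula 'I_N) L (t : family G (parl A L)) :
  transformation t ->
  exists A' L', [/\ erase A' = A, map (@erase N) L' = L, linked (parl A' L')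
    & is_ps (carrier_family t) (parl A' L')].
Proof.
move=> tt; have [n [a [u [uP vE]]]] := feeble (carrier_transformation tt).
have h k : exists Q : formula (link N) * seq (formula (link N)),
    [/\ erase Q.1 = A, map (@erase N) Q.2 = L, proof_structure (Q.1 :: Q.2)
      & is_ps (u k) (parl Q.1 Q.2)].
  by have [A' [L' ?]] := ps_interp_is_ps (uP k); exists (A', L').
have [Q hQ] := fin_all_exists h.
have [|k|k vk] := sum_is_ps (u := u) (Q := fun k => parl (Q k).1 (Q k).2) tt _ _ vE.
- by move=> k; have [] := hQ k.
- by rewrite -proof_structure_linked; have [] := hQ k.
have [e1 e2 ps _] := hQ k; exists (Q k).1, (Q k).2.
by split=> //; rewrite -proof_structure_linked.
Qed.

(** Another proof structure would have value 1 at [false] for some link of [A]; together with the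
    value 1 at [true] this contradicts the vanishing of one coordinate. *)
Lemma is_ps_match F (t : family G F) A B : transformation t ->
  linked A -> linked B -> is_ps (carrier_family t) B ->
  forall e : erase A = F,
  (forall x, (true, x) \in leaves A ->
     thetaC (single_label x) true A ∘ cast (f_equal (fob (D := S) Rc Rc) (esym e))
     ∘ carrier_family t Rc = 1) ->
  is_ps (carrier_family t) A.
Proof.
move=> tt lA lB vB e; move: t tt vB; case: _ / e => t tt vB h1.
have uA : uniq (leaves A) by case/andP: lA.
have [//|[x [xA v1]]] := match_or_vanish P lA lB vB.
have [[] v0] := single_vanish zsf uA xA tt; case: nontrivial; rewrite -v0 //.
by rewrite -(h1 x xA) cast1 compm1.
Qed.

End Analysis.

(** * Interpretations of derivations are dinatural *)

Section StarMore.
Variable D : starcat.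

Lemma dualm_name (X A B : D) (h : hom B A) (q : hom (X ⊗ A) bot) :
  dualm h ∘ name q = name (q ∘ (1 ⊠ h)).
Proof.
apply: ev_inj; rewrite tensM1 compA ev_dualm -compA -tensm_r tensm_l compA.
by rewrite !nameK.
Qed.

Lemma chii_name_nat (X Y A B : D) (p : hom A B) (c : hom Y X) (q : hom (A^⊥ ⊗ X) bot) :
  p ∘ (chii A ∘ name (q ∘ sym _ _)) ∘ c =
  chii B ∘ name (q ∘ (dualm p ⊠ c) ∘ sym _ _).
Proof.
rewrite (compA p) chii_nat -!(compA (chii B)) dualm_name name_comp; congr (_ ∘ name _).
by rewrite -!compA -tensmM comp1m compm1 sym_nat.
Qed.

Lemma undualm_nat (X A B : D) (p : hom A B) (m : hom (A^⊥) (X^⊥)) :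
  p ∘ undualm m = undualm (m ∘ dualm p).
Proof. by rewrite /undualm !compA chii_nat dualmM !compA. Qed.

Lemma axiom_nat (A B X : D) (g : hom A B) (k : hom X (A^⊥^⊥)) :
  ev (A^⊥) ∘ sym _ _ ∘ (dualm g ⊠ k) = ev (B^⊥) ∘ sym _ _ ∘ (1 ⊠ (dualm (dualm g) ∘ k)).
Proof.
by rewrite -!compA !sym_nat tensM1 tensm_r !compA ev_dualm.
Qed.

Lemma tens_nat (A A' B B' X Y Z W : D) (p : hom A A') (q : hom B B')
    (u : hom X A) (v : hom Y B) (s : hom Z (X ⊗ Y)) (c : hom W Z) :
  ev (A ⊗ B) ∘ (1 ⊠ ((u ⊠ v) ∘ s)) ∘ (dualm (p ⊠ q) ⊠ c) =
  ev (A' ⊗ B') ∘ (1 ⊠ (((p ∘ u) ⊠ (q ∘ v)) ∘ (s ∘ c))).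
Proof.
rewrite -compA -tensmM comp1m tensm_l compA ev_dualm -compA -tens1M.
by rewrite tensmM !compA.
Qed.

Lemma par_nat (A A' B B' X Y W : D) (p : hom A A') (r : hom B B')
    (q : hom (A^⊥ ⊗ B^⊥ ⊗ X) W) (c : hom Y X) :
  q ∘ assoc _ _ _ ∘ (chii _ ⊠ 1) ∘ (dualm (parm p r) ⊠ c) =
  q ∘ (dualm p ⊠ dualm r ⊠ c) ∘ assoc _ _ _ ∘ (chii _ ⊠ 1).
Proof.
rewrite -compA -tensmM comp1m /parm -chii_nat -!compA; congr (_ ∘ _).
by rewrite (compA (_ ⊠ _)) -assoc_nat -!compA -tensmM compm1.
Qed.

End StarMore.

Section ContextMap.
Variables (D : mixcat) (N : nat) (R : 'I_N -> D).
Local Notation fm := (formula (link N)).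
(** The objects [o A] will be duals of mixed variance, from which the contexts of both sides of
    dinaturality are reached. *)
Variables (o : fm -> D) (h : forall A, hom (o A) ((lob R A)^⊥)).
Implicit Types (A B : fm) (G H : seq fm).

Fixpoint octx G : D := if G is A :: G' then o A ⊗ octx G' else unit.

Fixpoint cmap G : hom (octx G) (ctx R G) :=
  match G with
  | [::] => 1
  | A :: G' => h A ⊠ cmap G'
  end.

Fixpoint osplit G H : hom (octx (G ++ H)) (octx G ⊗ octx H) :=
  match G with
  | [::] => luni _
  | A :: G' => associ _ _ _ ∘ (1 ⊠ osplit G' H)
  end.

Fixpoint oswap G A B H : hom (octx (G ++ B :: A :: H)) (octx (G ++ A :: B :: H)) :=
  match G with
  | [::] => assoc _ _ _ ∘ (sym _ _ ⊠ 1) ∘ associ _ _ _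
  | X :: G' => 1 ⊠ oswap G' A B H
  end.

Lemma split_nat G H :
  (cmap G ⊠ cmap H) ∘ osplit G H = ctx_split R G H ∘ cmap (G ++ H).
Proof.
elim: G => [|A G IH] /=; first exact: luni_nat.
rewrite compA -associ_nat -!compA; congr (_ ∘ _).
by rewrite -!tensmM comp1m compm1 IH.
Qed.

Lemma swap_nat G A B H :
  cmap (G ++ A :: B :: H) ∘ oswap G A B H = ctx_swap R G A B H ∘ cmap (G ++ B :: A :: H).
Proof.
elim: G => [|X G IH] /=; last by rewrite -!tensmM comp1m compm1 IH.
rewrite !compA -assoc_nat -!compA; congr (_ ∘ _).
by rewrite associ_nat !compA -!tensmM sym_nat compm1 comp1m.
Qed.

End ContextMap.

Section Dinatural.
Variables (D : mixcat) (N : nat) (R S : 'I_N -> D) (f : forall i, hom (R i) (S i)).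
Local Notation fm := (formula (link N)).
Implicit Types (A B : fm) (G H : seq fm).

Let pR A : hom (lob R A) (fob S R (erase A)) := fmor f (fun i => idm (R i)) (erase A).
Let pS A : hom (lob S A) (fob S R (erase A)) := fmor (fun i => idm (S i)) f (erase A).
Let o A : D := (fob S R (erase A))^⊥.
Let hR A : hom (o A) ((lob R A)^⊥) := dualm (pR A).
Let hS A : hom (o A) ((lob S A)^⊥) := dualm (pS A).

(** With every formula interpreted as [fob S R], one context maps to those of [R] and of [S], so the
    induction compares two arrows out of the same object. *)
Lemma dint_dinatural G (d : deriv G) : dint R d ∘ cmap hR G = dint S d ∘ cmap hS G.
Proof.
elim: d => {G} [x|G A B H d IH|G H d IHd e IHe|A B G H d IHd e IHe|A B G d IH] /=.
- rewrite -!(compA (ev _ ∘ _)) -!tensmM /hR /hS /pR /pS /= !dualm1 !tensm1 !comp1m !compm1.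
  by rewrite axiom_nat run_nat.
- by rewrite -!compA -!swap_nat !compA IH.
- rewrite -!(compA _ (ctx_split _ _ _)) -!split_nat.
  by rewrite !(compA _ (cmap _ _ ⊠ _)) -!(compA _ (_ ⊠ _) (_ ⊠ _)) -!tensmM IHd IHe.
- rewrite /hR /hS /pR /pS /= !tens_nat -!split_nat !(compA _ (cmap _ _ ⊠ _)) -!tensmM.
  by rewrite !chii_name_nat -/(hR A) IHd IHe.
rewrite /hR /hS /pR /pS /= !par_nat; congr (_ ∘ _ ∘ _); exact: IH.
Qed.

Fixpoint oclose A G : hom ((fob S R (parl (erase A) (map (@erase N) G)))^⊥) (octx o (A :: G)) :=
  match G with
  | [::] => runi _
  | B :: G' => (1 ⊠ oclose B G') ∘ chii _
  end.

Lemma close_nat (T : 'I_N -> D) (p : forall X : formula 'I_N, hom (fob T T X) (fob S R X))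
    (pP : forall A B : formula 'I_N, p (Par A B) = parm (p A) (p B)) A G :
  ctx_close T A G ∘ dualm (p (parl (erase A) (map (@erase N) G))) =
  cmap (fun A => dualm (p (erase A))) (A :: G) ∘ oclose A G.
Proof.
elim: G A => [|B G IH] A /=; first by rewrite -runi_nat.
rewrite pP /parm -compA -chii_nat !compA -!tensmM comp1m compm1.
by rewrite IH.
Qed.

Lemma interp_dinatural A G (d : deriv (A :: G)) :
  fmor f (fun i => idm (R i)) _ ∘ interp R d = fmor (fun i => idm (S i)) f _ ∘ interp S d.
Proof.
rewrite /interp !undualm_nat -!compA.
rewrite (close_nat (p := fmor f (fun i => idm (R i)))) //.
rewrite (close_nat (p := fmor (fun i => idm (S i)) f)) //.
by rewrite !compA; congr (undualm (_ ∘ _)); apply: dint_dinatural.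
Qed.

End Dinatural.

Lemma interp_transformation (D : mixcat) N A (G : seq (formula (link N))) (d : deriv (A :: G)) :
  transformation (fun R : 'I_N -> D => interp R d).
Proof. by move=> R S f; apply: interp_dinatural. Qed.

(** * Evaluating interpretations of derivations *)

Section Points.
Variables (D : smcat).

Lemma assoc_pts A B X (a : hom unit A) (b : hom unit B) (x : hom (@unit D) X) :
  assoc A B X ∘ ((((a ⊠ b) ∘ luni unit) ⊠ x) ∘ luni unit) =
  (a ⊠ ((b ⊠ x) ∘ luni unit)) ∘ luni unit.
Proof.
rewrite -[x in LHS]compm1 tensmM !compA assoc_nat -!compA -[a in RHS]compm1 tensmM -!compA.
congr (_ ∘ _).
by rewrite compA assoc_luni luni_nat.
Qed.

Lemma split_pts A X Y Z (a : hom unit A) (x : hom unit X) (y : hom unit Y)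
    (s : hom Z (X ⊗ Y)) (z : hom (@unit D) Z) :
  s ∘ z = (x ⊠ y) ∘ luni unit ->
  associ _ _ _ ∘ (1 ⊠ s) ∘ ((a ⊠ z) ∘ luni unit) =
  (((a ⊠ x) ∘ luni unit) ⊠ y) ∘ luni unit.
Proof.
move=> e; apply: (mono_l (assocK _ _ _)); rewrite assoc_pts -!compA (compA (assoc _ _ _)) associK.
by rewrite comp1m (compA (1 ⊠ s)) -tensmM comp1m e.
Qed.

Lemma swap_pts A B X (a : hom unit A) (b : hom unit B) (x : hom (@unit D) X) :
  assoc _ _ _ ∘ (sym _ _ ⊠ 1) ∘ associ _ _ _ ∘ ((a ⊠ ((b ⊠ x) ∘ luni unit)) ∘ luni unit) =
  (b ⊠ ((a ⊠ x) ∘ luni unit)) ∘ luni unit.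
Proof.
rewrite -assoc_pts -!compA (compA (associ _ _ _)) assocK comp1m -[RHS]assoc_pts.
congr (_ ∘ _); rewrite (compA (_ ⊠ _)) -tensmM comp1m (compA (sym _ _)) sym_nat.
by rewrite -(compA (_ ⊠ _)) sym_luni luni_runi.
Qed.

Lemma map_pts X Y A (a : hom unit A) (s : hom X Y) (x : hom (@unit D) X) y :
  s ∘ x = y -> (1 ⊠ s) ∘ ((a ⊠ x) ∘ luni unit) = (a ⊠ y) ∘ luni unit.
Proof. by move=> <-; rewrite compA -tensmM comp1m. Qed.

End Points.

Section Read.
Variables (D : starcat) (i : hom (@unit D) bot) (j : hom (@bot D) unit).
Hypotheses (ij : i ∘ j = 1) (ji : j ∘ i = 1).
Implicit Types A B X : D.

(** A functional turned into a vector of the dual; interpretations of derivations, being arrows out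
    of duals, are evaluated at such vectors. *)
Definition copt A (k : hom A unit) : hom unit (A^⊥) := dualm k ∘ i.

Lemma coptE A (k : hom A unit) : copt k = dualm (i ∘ k) ∘ chi unit.
Proof. by rewrite dualmM -compA copoint_unit. Qed.

Lemma copt_dualm A (k : hom A unit) : dualm (i ∘ k) = copt k ∘ chii unit.
Proof. by rewrite coptE -compA chi_chii compm1. Qed.

Lemma copt_point A (k : hom A unit) (v : hom unit A) :
  k ∘ v = 1 -> (j ∘ dualm v) ∘ copt k = 1.
Proof.
move=> e; rewrite /copt -compA (compA (dualm v)) -dualmM e dualm1 comp1m.
exact: ji.
Qed.

Lemma i_unlift : i ∘ chii unit = dualm i :> hom ((@unit D)^⊥^⊥) _.
Proof. by rewrite dualm_copoint copoint_unit. Qed.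

Lemma ev_copt A (k : hom A unit) : ev A ∘ (copt k ⊠ 1) = i ∘ k ∘ lun A.
Proof. by rewrite coptE ev_copoint. Qed.

Lemma undualm_copt A (k : hom A unit) (m : hom (A^⊥) ((@unit D)^⊥)) :
  m ∘ copt k = i -> k ∘ undualm m = 1.
Proof.
move=> e; apply: (mono_l ji); rewrite compm1 compA undualm_nat copt_dualm compA e.
by rewrite i_unlift /undualm -compA chi_nat compA chii_chi comp1m.
Qed.

Lemma chii_unit : chii _ ∘ dualm (chii unit) = 1 :> hom ((@unit D)^⊥) _.
Proof. by rewrite chii_dual -dualmM chii_chi dualm1. Qed.

Lemma name_copt A X (k : hom A unit) (q : hom (A^⊥ ⊗ X) bot) (x : hom unit X) :
  q ∘ ((copt k ⊠ x) ∘ luni unit) = i -> k ∘ (chii A ∘ name (q ∘ sym _ _)) ∘ x = 1.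
Proof.
move=> e; apply: (mono_l ji); rewrite compm1 !compA -(compA (i ∘ k)) chii_name_nat.
rewrite copt_dualm.
have -> : q ∘ ((copt k ∘ chii unit) ⊠ x) = i ∘ lun unit ∘ (chii unit ⊠ 1).
  rewrite -[x in LHS]compm1 tensmM compA; congr (_ ∘ _).
  by apply: (epi_l (lunK unit)); rewrite -!compA luniK compm1.
rewrite -(compA _ _ (sym _ _)) -sym_nat !compA -(compA i) lun_sym -dualm_name.
have -> : name (i ∘ run unit) = i by rewrite -(run_nat i) -ev_unit evK.
by rewrite compA chii_unit comp1m.
Qed.

Lemma par_copt A B (k : hom A unit) (l : hom B unit) :
  chii _ ∘ copt (parun i unit ∘ parm k l) = (copt k ⊠ copt l) ∘ luni unit.
Proof.
rewrite /copt dualmM -compA (compA (chii _)) /parm -chii_nat tensmM -!compA; congr (_ ∘ _).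
rewrite /parun [dualm (chii unit ∘ _)]dualmM -!compA (compA (chii _)) -chii_nat -!compA (compA (chii _)) chii_unit comp1m.
by rewrite -runi_nat compA -tensmM comp1m compm1 luni_runi.
Qed.

Lemma axiom_copt A (k : hom A unit) (l : hom (A^⊥) unit) :
  l ∘ copt k = 1 ->
  ev (A^⊥) ∘ sym _ _ ∘ (1 ⊠ run _) ∘
    ((copt k ⊠ ((copt l ⊠ 1) ∘ luni unit)) ∘ luni unit) = i.
Proof.
move=> e; rewrite -!compA.
rewrite (compA (1 ⊠ _) (_ ⊠ _)) -tensmM comp1m (compA (run _)) run_nat -compA luni_runi runiK compm1.
rewrite (compA (sym _ _)) sym_nat tensm_l -!compA (compA (ev _)) ev_copt.
by rewrite sym_runi luni_nat -!compA (compA (lun _)) luniK comp1m e compm1.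
Qed.

Lemma mix_copt X Y (f : hom X bot) (g : hom Y bot) (x : hom unit X) (y : hom unit Y) :
  f ∘ x = i -> g ∘ y = i ->
  lun bot ∘ (j ⊠ 1) ∘ (f ⊠ g) ∘ ((x ⊠ y) ∘ luni unit) = i.
Proof.
move=> fx gy; rewrite -!compA (compA (f ⊠ g)) -tensmM fx gy.
by rewrite (compA (j ⊠ 1)) -tensmM ji comp1m compA lun_nat -compA luniK compm1.
Qed.

Lemma tens_copt A B X Y Z (k : hom A unit) (l : hom B unit) (u : hom X A) (v : hom Y B)
    (s : hom Z (X ⊗ Y)) (x : hom unit X) (y : hom unit Y) (z : hom unit Z) :
  s ∘ z = (x ⊠ y) ∘ luni unit -> k ∘ u ∘ x = 1 -> l ∘ v ∘ y = 1 ->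
  ev (A ⊗ B) ∘ (1 ⊠ ((u ⊠ v) ∘ s)) ∘
    ((copt (lun unit ∘ (k ⊠ l)) ⊠ z) ∘ luni unit) = i.
Proof.
move=> e kx ly; rewrite -!compA (compA (_ ⊠ _) (_ ⊠ _)) -tensmM comp1m.
rewrite tensm_l -!compA (compA (ev _)) ev_copt -!compA.
rewrite luni_nat (compA (lun _) (luni _)) luniK comp1m e (compA (u ⊠ v)) -tensmM.
by rewrite (compA (k ⊠ l)) -tensmM !compA kx ly tensm1 compm1 -(compA i) luniK compm1.
Qed.

Lemma par_eval A B X Y (k : hom A unit) (l : hom B unit) (q : hom (A^⊥ ⊗ B^⊥ ⊗ X) Y)
    (x : hom unit X) :
  q ∘ assoc _ _ _ ∘ (chii _ ⊠ 1) ∘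
    ((copt (parun i unit ∘ parm k l) ⊠ x) ∘ luni unit) =
  q ∘ ((copt k ⊠ ((copt l ⊠ x) ∘ luni unit)) ∘ luni unit).
Proof.
rewrite -(compA (q ∘ _)) (compA (_ ⊠ _) (_ ⊠ _)) -tensmM comp1m par_copt.
by rewrite -(compA q) assoc_pts.
Qed.

End Read.

Section Evaluation.
Variables (C : compact) (P : biproducts C) (N : nat).
Variables (lb : bool -> link N -> label) (i : bool).
Hypothesis cp : forall x, compat (lb true x) (lb false x) i.
Local Notation S := (compact_star C).
Local Notation D := (light_mix C).
Local Notation Rf := (@Rf C P N).
Local Notation theta := (@theta C P N lb i).
Implicit Types (A B : formula (link N)) (G H : seq (formula (link N))).

Definition fpt A : hom (@unit C) (car ((lob Rf A)^⊥)) :=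
  @copt S (iota C) (car (lob Rf A)) (theta A).

Fixpoint cpt G : hom (@unit C) (car (ctx Rf G)) :=
  match G with
  | [::] => idm (@unit C)
  | A :: G' => (fpt A ⊠ cpt G') ∘ luni unit
  end.

Lemma split_cpt G H : sval (ctx_split Rf G H) ∘ cpt (G ++ H) = (cpt G ⊠ cpt H) ∘ luni unit.
Proof.
elim: G => [|A G IH]; first exact: (esym (@luni_nat C _ _ (cpt H))).
exact: (split_pts _ IH).
Qed.

Lemma swap_cpt G A B H :
  sval (ctx_swap Rf G A B H) ∘ cpt (G ++ B :: A :: H) = cpt (G ++ A :: B :: H).
Proof.
elim: G => [|X G IH]; last exact: (map_pts _ IH).
exact: (swap_pts (fpt B) (fpt A) (cpt H)).
Qed.

Lemma lit_cpt x : theta (Lit false x) ∘ fpt (Lit true x) = 1.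
Proof.
have := pair_compat P (cp x); rewrite lval_neg pairE => e.
have := @copt_point S (iota C) (iotai C) (iotaK C) _ _ _ e.
by rewrite -lval_neg.
Qed.

Lemma premise_cpt A G (q : @hom D (ctx Rf (A :: G)) bot) :
  sval q ∘ cpt (A :: G) = iota C ->
  theta A ∘ sval (chii (lob Rf A) ∘ name (q ∘ sym (ctx Rf G) ((lob Rf A)^⊥))) ∘ cpt G = 1.
Proof. by move=> e; apply: (@name_copt S (iota C) (iotai C)) e; apply: iotaK. Qed.

(** Labels enter at axioms only, where compatible ones pair to 1; every other rule multiplies values
    that are 1. *)
Lemma dint_cpt G (d : deriv G) : sval (dint Rf d) ∘ cpt G = iota C.
Proof.
elim: d => {G} [x|G A B H d IH|G H d IHd e IHe|A B G H d IHd e IHe|A B G d IH].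
- by apply: (@axiom_copt S (iota C) (car (Rs P))); apply: lit_cpt.
- by rewrite [X in X ∘ _ = _]/(sval (dint Rf d) ∘ sval (ctx_swap Rf G A B H)) -compA swap_cpt.
- rewrite [X in X ∘ _ = _]/(lun _ ∘ (iotai C ⊠ 1) ∘ (sval (dint Rf d) ⊠ sval (dint Rf e)) ∘ sval (ctx_split Rf G H)).
  rewrite -compA split_cpt; apply: (@mix_copt S (iota C) (iotai C)) => //.
  exact: iotaK.
- apply: (@tens_copt S (iota C) _ _ _ _ _ _ _ _ _ _ _ _ _ (split_cpt G H)); exact: premise_cpt.
exact: etrans (@par_eval S (iota C) _ _ _ _ _ _ (sval (dint Rf d)) (cpt G)) IH.
Qed.

Fixpoint theta_seq A G : hom (car (fob Rf Rf (parl (erase A) (map (@erase N) G)))) (@unit C) :=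
  match G with
  | [::] => theta A
  | B :: G' => @parun S (iota C) unit ∘ @parm S _ _ _ _ (theta A) (theta_seq B G')
  end.

Lemma close_cpt A G :
  sval (ctx_close Rf A G) ∘ @copt S (iota C) _ (theta_seq A G) = cpt (A :: G).
Proof.
elim: G A => [|B G IH] A.
  apply: etrans (esym (@runi_nat S _ _ (fpt A))) _.
  by rewrite /= -luni_runi.
rewrite [X in X ∘ _ = _]/((1 ⊠ sval (ctx_close Rf B G)) ∘ @chii S _).
rewrite -compA; apply: etrans (f_equal _ (@par_copt S (iota C) _ _ (theta A) (theta_seq B G))) _.
exact: map_pts (IH B).
Qed.

Lemma theta_interp A G (d : deriv (A :: G)) : theta_seq A G ∘ sval (interp Rf d) = 1.
Proof.
apply: (@undualm_copt S (iota C) (iotai C) (iotaK C) _ _ (sval (dint Rf d) ∘ sval (ctx_close Rf A G))).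
by rewrite -compA close_cpt dint_cpt.
Qed.

Lemma theta_seqE A G he :
  theta_seq A G = @thetaC C P N lb i (parl A G) ∘ cast (C := S) he.
Proof.
elim: G A he => [|B G IH] A he; first by rewrite /= thetaC_E; congr (_ ∘ _); apply: cast_irr.
have he2 : car (fob Rf Rf (parl (erase B) (map (@erase N) G))) =
    fob (D := S) (@Rc C P N) (@Rc C P N) (erase (parl B G)).
  by rewrite car_fob erase_parl.
exact (cast_par_app (D := S) (@parun S (iota C) unit) he (thetaC_E P lb i A) (IH B he2)).
Qed.

Lemma thetaC_interp A G (d : deriv (A :: G)) he :
  @thetaC C P N lb i (parl A G) ∘ cast (C := S) he ∘
    carrier_family (fun R => interp R d : @hom D unit (fob R R (parl (erase A) (map (@erase N) G))))
      (@Rc C P N) = 1.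
Proof.
pose t : family D (parl (erase A) (map (@erase N) G)) := fun R => interp R d.
have tt : transformation t by apply: interp_transformation.
rewrite -(theta_interp d) -[interp Rf d]/(t Rf).
rewrite (sval_family (esym (car_fob Rf Rf _)) tt).
move: (carrier_family t _) => c; rewrite (theta_seqE (etrans (car_fob Rf Rf _) he)).
by rewrite -(castM (C := S) (esym (car_fob Rf Rf _)) (etrans (car_fob Rf Rf _) he) he) !compA.
Qed.

End Evaluation.

Lemma is_ps_unique (C : compact) N (F : formula 'I_N) (t u : family (compact_star C) F)
    (A : formula (link N)) R : uniq (leaves A) -> is_ps t A -> is_ps u A -> t R = u R.
Proof.
move=> uA [e [K [s tE]]] [e' [K' [s' uE]]]; rewrite tE uE; congr (_ ∘ _).
  exact: cast_irr.
exact: ps_val_irr.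
Qed.

Theorem theorem5p11 (C : compact) (P : biproducts C)
  (zsf : zero_sum_free P)
  (nontrivial : zerom P (@unit C) unit <> idm unit)
  (feeble : feeble_full_completeness P) :
  full_completeness (G1_mix C).
Proof.
rewrite light_mixE => N A G t tt.
have [A' [G' [eA eG lk ps]]] := transformation_is_ps zsf nontrivial feeble tt.
subst A G; have nb := ps_chordless zsf nontrivial tt lk ps.
have pst : proof_structure (A' :: G') by rewrite proof_structure_linked.
have [uG cG] := andP pst.
have [|d] := @sequentialization N (A' :: G') isT.
  by split=> //; apply: contra_not nb; apply: cyclic_eq => l m; rewrite coh_parl.
apply: (NetInterp (d := d)); first exact: deriv_proof_net.
pose u : family (light_mix C) (parl (erase A') (map (@erase N) G')) := fun R => interp R d.
have tu : transformation u by apply: interp_transformation.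
(* Feeble full completeness is applied a second time: [u] comes from some proof structure, and the
   values of [d] on single links force it to be that of [t]. This replaces a computation of
   [interp R d] as a proof structure. *)
have [B [H [_ _ lB psB]]] := transformation_is_ps zsf nontrivial feeble tu.
have psu : is_ps (carrier_family u) (parl A' G').
  apply: (is_ps_match zsf nontrivial tu lk lB psB (e := erase_parl A' G')) => x _.
  by apply: thetaC_interp => y; rewrite /single_label; case: eqP.
move=> R; rewrite -[interp R d]/(u R); apply: ghom_eq.
have e := esym (car_fob R R (parl (erase A') (map (@erase N) G'))).
rewrite (sval_family e tt) (sval_family e tu); congr (_ ∘ _).
by apply: is_ps_unique ps psu; case/andP: lk.
Qed.
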